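(* For all $F,G\in\mathbb{D}^{1,2}$, $$\mathrm{cov}(F,G):=\tau\big[(F-\tau(F))(G-\tau(G))\big]=\int_0^{\infty}e^{-t}\,\big\langle P_t^{\otimes2}(\nabla F),\nabla G^*\big\rangle_{\mathcal{B}_2}\,dt .$$
   Context: Setting. Inner products are linear in the first variable. On the full Fock space $\mathbb{C}\Omega\oplus\bigoplus_{n\ge1}L^2(\mathbb{R}_+)^{\otimes n}$ (complex $L^2$, $\|\Omega\|=1$), let $l(h)$ be the left creation operator, $l(h)\Omega=h$, $l(h)(g_1\otimes\cdots\otimes g_n)=h\otimes g_1\otimes\cdots\otimes g_n$, and for real-valued $h\in L^2_{\mathbb{R}}(\mathbb{R}_+)$ let $S(h)=l(h)+l(h)^*$. $\mathcal{SC}$ is the von Neumann algebra generated by $\{S(h):h\in L^2_{\mathbb{R}}(\mathbb{R}_+)\}$ and $\tau(X)=\langle X\Omega,\Omega\rangle$ its faithful normal tracial state; $L^2(\mathcal{SC})$ has inner product $\langle X,Y\rangle=\tau(Y^*X)$. $\mathcal{SC}_{alg}$ is the unital $*$-algebra generated by the $S(h)$, $h\in L^2_{\mathbb{R}}(\mathbb{R}_+)$. Wigner integrals. The map $X\mapsto X\Omega$ extends to a unitary from $L^2(\mathcal{SC})$ onto the Fock space. For $f\in L^2(\mathbb{R}_+^n)\cong L^2(\mathbb{R}_+)^{\otimes n}$, $I_n(f)$ is the element of $L^2(\mathcal{SC})$ corresponding to $f$ (and $I_0(c)=c1$). Every $F\in L^2(\mathcal{SC})$ has a unique expansion $F=\sum_{n\ge0}I_n(f_n)$.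 Malliavin derivative. $\mathcal{B}_2=L^2(\mathbb{R}_+;L^2(\mathcal{SC}\otimes\mathcal{SC}^{op},\tau\otimes\tau^{op}))$ with $\langle U,V\rangle_{\mathcal{B}_2}=\int_0^\infty\langle U_t,V_t\rangle_{L^2(\tau\otimes\tau^{op})}dt$. $\nabla:\mathcal{SC}_{alg}\to\mathcal{B}_2$, $A\mapsto(\nabla_tA)_{t\ge0}$, is the linear map with $\nabla_tS(h)=h(t)\,1\otimes1$ and $\nabla_t(AB)=A\cdot\nabla_tB+\nabla_tA\cdot B$, where $A\cdot(x\otimes y)\cdot B=Ax\otimes yB$. It is closable from $L^2(\mathcal{SC})$ to $\mathcal{B}_2$; its closure is still denoted $\nabla$, with domain $\mathbb{D}^{1,2}$, the completion of $\mathcal{SC}_{alg}$ for $\|F\|_{1,2}^2=\|F\|_2^2+\|\nabla F\|_{\mathcal{B}_2}^2$. Free Ornstein-Uhlenbeck semigroup: $P_t\big(\sum_nI_n(f_n)\big)=\sum_ne^{-nt}I_n(f_n)$ on $L^2(\mathcal{SC})$, $t\ge0$; $P_t^{\otimes2}=P_t\otimes P_t$ acts on $\mathcal{B}_2$ pointwise in the time variable. *)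

(* Defs.v *)
(* MathComp-Analysis. Scalars are R[i] for an arbitrary R : realType.         *)
(* Elements of L^2 spaces are represented by functions (not by their classes  *)
(* modulo a.e. equality); every notion below only depends on the class.       *)
From HB Require Import structures.
From mathcomp Require Import all_boot all_order all_algebra.
From mathcomp.real_closed Require Import complex.
From mathcomp Require Import all_classical all_reals all_analysis.

Set Implicit Arguments.
Unset Strict Implicit.
Unset Printing Implicit Defensive.

Import Order.TTheory GRing.Theory Num.Theory.
Import numFieldNormedType.Exports.

Local Open Scope classical_set_scope.
Local Open Scope ring_scope.
Local Open Scope complex_scope.

Section complex_L2.
Context {d : measure_display} {T : measurableType d} {R : realType}.
Variables (mu : {measure set T -> \bar R}) (D : set T).
Implicit Types f g : T -> R[i].

Definition cmeasurable f :=
  measurable_fun D (fun x => complex.Re (f x)) /\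
  measurable_fun D (fun x => complex.Im (f x)).

Definition cintegral f : R[i] :=
  Rintegral mu D (fun x => complex.Re (f x)) +i*
  Rintegral mu D (fun x => complex.Im (f x)).

Definition cabs2 (z : R[i]) : R := complex.Re z ^+ 2 + complex.Im z ^+ 2.

Definition L2normsq f : \bar R := (\int[mu]_(x in D) (cabs2 (f x))%:E)%E.

Definition L2dot f g : R[i] := cintegral (fun x => f x * (g x)^*).

End complex_L2.

Definition csum {R : realType} (u : nat -> R[i]) : R[i] :=
  limn (fun n => \sum_(0 <= i < n) complex.Re (u i)) +i*
  limn (fun n => \sum_(0 <= i < n) complex.Im (u i)).

(* Lebesgue measure on R^n, R^n being n.-tuple (measurableTypeR R) with the   *)
(* product sigma-algebra: it is the image of lebesgue_measure \x leb n under  *)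
(* (x, s) |-> x :: s.                                                         *)
Section lebesgue_tuple.
Context {R : realType}.
Local Notation RR := (measurableTypeR R).

Definition tcons n (p : RR * n.-tuple RR) : n.+1.-tuple RR :=
  [the n.+1.-tuple RR of p.1 :: p.2].

Lemma measurable_tcons n : measurable_fun setT (@tcons n).
Proof. exact: measurable_cons. Qed.

Section step.
Variables (n : nat) (m : {sigma_finite_measure set (n.-tuple RR) -> \bar R}).

Definition leb_step : set (n.+1.-tuple RR) -> \bar R :=
  pushforward (@lebesgue_measure R \x m)%E (@tcons n).

Let leb_step0 : leb_step set0 = 0%E.
Proof. by rewrite /leb_step /pushforward preimage_set0 measure0. Qed.

Let leb_step_ge0 A : (0 <= leb_step A)%E.
Proof. by rewrite /leb_step /pushforward measure_ge0. Qed.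

Let leb_step_sigma_additive : semi_sigma_additive leb_step.
Proof.
move=> F mF tF mUF; rewrite /leb_step /pushforward preimage_bigcup.
apply: measure_semi_sigma_additive.
- by move=> k; rewrite -[X in measurable X]setTI; exact: measurable_tcons.
- apply/trivIsetP => /= i j _ _ ij; rewrite -preimage_setI.
  by move/trivIsetP : tF => /(_ _ _ _ _ ij) ->//; rewrite preimage_set0.
- rewrite -preimage_bigcup -[X in measurable X]setTI.
  exact: measurable_tcons.
Qed.

HB.instance Definition _ := isMeasure.Build _ _ _ leb_step
  leb_step0 leb_step_ge0 leb_step_sigma_additive.

Let leb_step_sigma_finite : sigma_finite setT leb_step.
Proof.
have /sigma_finiteP[F [TF ndF Foo]] := sigma_finiteT (@lebesgue_measure R).
have /sigma_finiteP[G [TG ndG Goo]] := sigma_finiteT m.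
pose unc (s : n.+1.-tuple RR) : RR * n.-tuple RR := (thead s, [tuple of behead s]).
have uncK p : unc (tcons p) = p.
  by case: p => x s; congr pair; apply: val_inj.
exists (fun k => unc @^-1` (F k `*` G k)).
  rewrite predeqE => s; split=> // _.
  have [i _ Fi] : (\bigcup_i F i) (unc s).1 by rewrite -TF.
  have [j _ Gj] : (\bigcup_i G i) (unc s).2 by rewrite -TG.
  exists (maxn i j) => //; split.
  - by move: Fi; exact/subsetPset/ndF/leq_maxl.
  - by move: Gj; exact/subsetPset/ndG/leq_maxr.
move=> k; have [mF Fk] := Foo k; have [mG Gk] := Goo k; split.
  rewrite -[X in measurable X]setTI.
  have munc : measurable_fun setT unc.
    apply: measurable_fun_pair; first exact: measurable_tnth.
    exact: measurable_behead.
  by apply: munc => //; exact: measurableX.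
rewrite /leb_step /pushforward -comp_preimage.
rewrite (_ : unc \o @tcons n = id); last exact/funext.
by rewrite preimage_id product_measure1E// lte_mul_pinfty// ge0_fin_numE.
Qed.

HB.instance Definition _ := Measure_isSigmaFinite.Build _ _ _ leb_step
  leb_step_sigma_finite.

End step.

Fixpoint leb (n : nat) : {sigma_finite_measure set (n.-tuple RR) -> \bar R} :=
  match n with
  | 0%N => [the {sigma_finite_measure set (0.-tuple RR) -> \bar R} of
              dirac [tuple]]
  | k.+1 => [the {sigma_finite_measure set (k.+1.-tuple RR) -> \bar R} of
               leb_step (leb k)]
  end.

End lebesgue_tuple.

Section free_malliavin.
Context {R : realType}.
Local Notation RR := (measurableTypeR R).

Definition halfline : set RR := [set t | 0 <= t].
Definition orthant n : set (n.-tuple RR) := [set s | forall i, 0 <= tnth s i].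

(** Full Fock space: families (f_n) with f_n in L^2(R_+^n), n = 0 giving C   *)

Definition fock := forall n : nat, n.-tuple RR -> R[i].
HB.instance Definition _ := gen_eqMixin fock.
HB.instance Definition _ := gen_choiceMixin fock.

Definition fock_normsq (f : fock) : \bar R :=
  (\sum_(0 <= n <oo) L2normsq (leb n) (@orthant n) (f n))%E.

Definition in_fock (f : fock) :=
  (forall n, cmeasurable (@orthant n) (f n)) /\ (fock_normsq f < +oo)%E.

Definition fock_dot (f g : fock) : R[i] :=
  csum (fun n => L2dot (leb n) (@orthant n) (f n) (g n)).

Definition fock0 : fock := fun _ _ => 0.
Definition fock_add (f g : fock) : fock := fun n s => f n s + g n s.
Definition fock_sub (f g : fock) : fock := fun n s => f n s - g n s.
Definition fock_scale (c : R[i]) (f : fock) : fock := fun n s => c * f n s.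

Definition vacuum : fock := fun n _ => (n == 0%N)%:R.

Definition creation (h : RR -> R[i]) (f : fock) : fock :=
  fun n => match n with
           | 0%N => fun _ => 0
           | k.+1 => fun s => h (thead s) * f k [tuple of behead s]
           end.

Definition is_adjoint (X Y : fock -> fock) :=
  forall f g, in_fock f -> in_fock g ->
  [/\ in_fock (X f), in_fock (Y g) & fock_dot (X f) g = fock_dot f (Y g)].

Definition adjoint (X : fock -> fock) : fock -> fock :=
  xget (fun=> fock0) [set Y | is_adjoint X Y].

Definition L2real : Type :=
  {h : RR -> R | measurable_fun halfline h /\
    (\int[@lebesgue_measure R]_(t in halfline) (h t ^+ 2)%:E < +oo)%E}.

Definition semicirc (h : L2real) (f : fock) : fock :=
  fock_add (creation (fun t => (sval h t)%:C) f)
           (adjoint (creation (fun t => (sval h t)%:C)) f).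

(** The *-algebra generated by the S(h). Since each S(h) is self-adjoint, it  *)
(** is the unital algebra they generate; its elements are presented by        *)
(** noncommutative polynomials, [op A] being the operator defined by A.       *)

Inductive scalg : Type :=
| SCone
| SCgen of L2real
| SCadd of scalg & scalg
| SCscale of R[i] & scalg
| SCmul of scalg & scalg.

Fixpoint op (A : scalg) : fock -> fock :=
  match A with
  | SCone => id
  | SCgen h => semicirc h
  | SCadd A B => fun f => fock_add (op A f) (op B f)
  | SCscale c A => fun f => fock_scale c (op A f)
  | SCmul A B => op A \o op B
  end.

(** L^2(SC) is realised as the Fock space by the unitary extending            *)
(** X |-> X vacuum: X in SC becomes the vector X vacuum, the inner product    *)
(** <X, Y> = tau(Y^* X) becomes fock_dot, I_n(f) becomes the family with n-th *)
(** component f and all others 0, and tau(X) = <X, 1> is defined on L^2(SC).  *)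

Definition vec (A : scalg) : fock := op A vacuum.

Definition tau (F : fock) : R[i] := fock_dot F vacuum.

(* The involution X |-> X^* of L^2(SC), extended by continuity from the       *)
(* polynomials.                                                               *)
Definition star (F : fock) : fock :=
  xget fock0 [set G | in_fock G /\ exists A B : nat -> scalg,
    [/\ forall k, is_adjoint (op (A k)) (op (B k)),
        (fun k => fock_normsq (fock_sub (vec (A k)) F)) @ \oo --> 0%E &
        (fun k => fock_normsq (fock_sub (vec (B k)) G)) @ \oo --> 0%E]].

(* tau(F G) for F, G in L^2(SC), i.e. <G, F^*>. *)
Definition tau_mul (F G : fock) : R[i] := fock_dot G (star F).

Definition cov (F G : fock) : R[i] :=
  tau_mul (fock_sub F (fock_scale (tau F) vacuum))
          (fock_sub G (fock_scale (tau G) vacuum)).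

(** L^2(SC (x) SC^op) is the Hilbert tensor square of L^2(SC): families       *)
(** (k_{m,n}) with k_{m,n} in L^2(R_+^m x R_+^n), where X (x) Y is the family *)
(** (s, u) |-> (X vacuum)_m(s) (Y vacuum)_n(u). As tau is a trace, L^2(SC^op) *)
(** and L^2(SC) have the same inner product.                                  *)

Definition fock2 := forall m n : nat, m.-tuple RR -> n.-tuple RR -> R[i].

Definition fock2_dom m n : set (m.-tuple RR * n.-tuple RR)%type :=
  @orthant m `*` @orthant n.

Definition fock2_normsq (k : fock2) : \bar R :=
  (\sum_(0 <= m <oo) \sum_(0 <= n <oo)
     L2normsq (leb m \x leb n) (@fock2_dom m n)
       (fun p => k m n p.1 p.2))%E.

Definition fock2_dot (k l : fock2) : R[i] :=
  csum (fun m => csum (fun n =>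
    L2dot (leb m \x leb n)%E (@fock2_dom m n)
      (fun p => k m n p.1 p.2) (fun p => l m n p.1 p.2))).

(** B_2: every class in L^2(R_+; L^2(SC (x) SC^op)) has a representative      *)
(** whose components are jointly measurable in time and space.                *)

Definition b2 := RR -> fock2.
HB.instance Definition _ := gen_eqMixin b2.
HB.instance Definition _ := gen_choiceMixin b2.

Definition b2_normsq (U : b2) : \bar R :=
  (\int[@lebesgue_measure R]_(t in halfline) fock2_normsq (U t))%E.

Definition in_b2 (U : b2) :=
  (forall m n, cmeasurable (halfline `*` @fock2_dom m n)
     (fun p : RR * (m.-tuple RR * n.-tuple RR) =>
        U p.1 m n p.2.1 p.2.2)) /\
  (b2_normsq U < +oo)%E.

Definition b2_dot (U V : b2) : R[i] :=
  cintegral (@lebesgue_measure R) halfline (fun t => fock2_dot (U t) (V t)).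

Definition b2_0 : b2 := fun _ _ _ _ _ => 0.
Definition b2_sub (U V : b2) : b2 := fun t m n s u => U t m n s u - V t m n s u.

(** Malliavin derivative. The list of the (h_i, X_i, Y_i) stands for          *)
(** t |-> \sum_i h_i(t) X_i (x) Y_i.                                          *)

Definition tensors := seq (L2real * scalg * scalg).

Definition lact (A : scalg) (T : tensors) : tensors :=
  [seq (p.1.1, SCmul A p.1.2, p.2) | p <- T].

Definition ract (T : tensors) (B : scalg) : tensors :=
  [seq (p.1.1, p.1.2, SCmul p.2 B) | p <- T].

Definition b2_of (T : tensors) : b2 := fun t m n s u =>
  \sum_(p <- T) (sval p.1.1 t)%:C * (vec p.1.2 s * vec p.2 u).

Fixpoint grad (A : scalg) : tensors :=
  match A with
  | SCone => [::]
  | SCgen h => [:: (h, SCone, SCone)]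
  | SCadd A B => grad A ++ grad B
  | SCscale c A => lact (SCscale c SCone) (grad A)
  | SCmul A B => lact A (grad B) ++ ract (grad A) B
  end.

(* Closure in L^2(SC) x B_2 of the graph {(A vacuum, grad A)}. As the         *)
(* derivative is closable, U is determined by F (a.e.).                       *)
Definition nabla_graph (F : fock) (U : b2) :=
  [/\ in_fock F, in_b2 U & exists A : nat -> scalg,
    (fun k => fock_normsq (fock_sub (vec (A k)) F)) @ \oo --> 0%E /\
    (fun k => b2_normsq (b2_sub (b2_of (grad (A k))) U)) @ \oo --> 0%E].

Definition D12 : set fock := [set F | exists U, nabla_graph F U].

Definition nabla (F : fock) : b2 := xget b2_0 [set U | nabla_graph F U].

Definition OU (t : R) (f : fock) : fock :=
  fun n s => (expR (- (n%:R * t)))%:C * f n s.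

(* OU t (x) OU t: OU t applied to each leg in turn. *)
Definition OU2 (t : R) (k : fock2) : fock2 := fun m n s u =>
  OU t (fun m' s' => OU t (fun n' u' => k m' n' s' u') u) s.

End free_malliavin.

Arguments fock R : clear implicits.

(* Main.v *)
(* All inner products are recovered from norms by polarization, so that only
   sums and integrals of nonnegative functions ever have to be exchanged.
   For a polynomial A, the component (m, n) of the gradient at time t is the
   (m+n+1)-particle component of [A vacuum] with t inserted between the first
   m and the last n variables, and the involution of L^2(SC) reverses and
   conjugates each component; both facts pass to the closures. The pairing at
   time t is therefore
     sum_(m, n) exp (- (m + n) t) <F_(m+n+1), (G^* )_(m+n+1)>,
   and the integral of exp (- (m + n + 1) t) is 1 / (m + n + 1), which cancels
   the number of pairs (m, n) with the same m + n. *)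

Require Import Defs.
From HB Require Import structures.
From mathcomp Require Import all_boot all_order all_algebra.
From mathcomp.real_closed Require Import complex.
From mathcomp Require Import all_classical all_reals all_analysis measurable_realfun.
From mathcomp Require Import ring lra.

Set Implicit Arguments.
Unset Strict Implicit.
Unset Printing Implicit Defensive.

Import Order.TTheory GRing.Theory Num.Theory.
Import numFieldNormedType.Exports.

Local Open Scope classical_set_scope.
Local Open Scope ring_scope.
Local Open Scope complex_scope.
(* Under [*], the notation of the definitions parses as [Num.conj]. *)
Local Notation "z ^*" := (Num.conj z) : complex_scope.

(** * Integrals of functions controlled by polarization *)

(** [adjoint], [star] and [nabla] are picked by [xget], so their values are known only up to null
    sets, whereas the Leibniz rule and the commutation of left and right multiplications are
    pointwise computations. These are carried out for [sem], built on an explicit annihilation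
    operator, on the span of the elementary tensors, and are then transferred to the chosen objects
    through the relations [feq] and [beq]. The gradient formula comes from letting a left operator
    act on a vector whose last variables are frozen: a new term arises exactly when a creation
    operator fills the variable t, and the Leibniz rule collects these terms. The involution is
    computed from the commutation of left multiplications with their mirror images under reversal.
    Polarization needs an inner product of two vectors of the same kind, while [OU2 t] acts on only
    one side of the pairing. Since P_t is the square of the self-adjoint P_(t/2), one factor can be
    moved to the other side. *)

Section nonmeasurable_integral.
Local Open Scope ereal_scope.
Context d (T : measurableType d) (R : realType).
Variable mu : {measure set T -> \bar R}.
Import HBNNSimple.

(** The integral of a nonnegative function is a supremum over the simple functions below it, and
    enlarging the function enlarges that set. *)
Lemma nonmeasurable_ge0_le_integral (D : set T) (f g : T -> \bar R) :
  (forall x, D x -> 0 <= f x) -> (forall x, D x -> f x <= g x) ->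
  \int[mu]_(x in D) f x <= \int[mu]_(x in D) g x.
Proof.
move=> f0 fg; rewrite !ge0_integralE//; last first.
  by move=> x Dx; rewrite (le_trans (f0 _ Dx))// fg.
apply: le_ereal_sup => _ [h hf <-]; exists h => // x; rewrite (le_trans (hf x))// /patch.
by case: ifPn => // /set_mem /fg.
Qed.

(* [f] need not be measurable: the values of [csum] and [Rintegral] on the
   exceptional null set are arbitrary. *)
Lemma eq_integral_off_null (D E : set T) (f g : T -> \bar R) :
  measurable D -> measurable E -> mu E = 0 -> measurable_fun D g ->
  (forall x, D x -> ~ E x -> f x = g x) ->
  \int[mu]_(x in D) f x = \int[mu]_(x in D) g x.
Proof.
move=> mD mE E0 mg fg.
(* Positive and negative parts reduce the claim to nonnegative functions. *)
suff key (u v : T -> \bar R) : (forall x, 0 <= u x) -> (forall x, 0 <= v x) ->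
    measurable_fun D v -> (forall x, D x -> ~ E x -> u x = v x) ->
    \int[mu]_(x in D) u x = \int[mu]_(x in D) v x.
  rewrite integralE [RHS]integralE; congr (_ - _); apply: key => //.
  - exact: measurable_funepos.
  - by move=> x Dx Ex; rewrite !funeposE fg.
  - exact: measurable_funeneg.
  - by move=> x Dx Ex; rewrite !funenegE fg.
move=> u0 v0 mv uv; apply/eqP; rewrite eq_le; apply/andP; split.
(* Upper bound: [u] is at most [v] plus the function equal to [+oo] on [E], whose integral vanishes
   because [E] is null. *)
- have mb : measurable_fun D (cst +oo \_ E : T -> \bar R).
    apply: measurable_funTS; apply/(measurable_restrictT _ mE).
    exact: measurable_cst.
  apply: (@le_trans _ _ (\int[mu]_(x in D) (v x + (cst +oo \_ E) x))).
    apply: nonmeasurable_ge0_le_integral => [//|] x Dx; rewrite patchE.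
    case: ifPn => [_|/negP xE].
      by rewrite addey ?leey// gt_eqF// (lt_le_trans _ (v0 x)).
    by rewrite adde0 uv// => /mem_set.
  rewrite ge0_integralD//; last first.
    by move=> x _; rewrite patchE; case: ifP => // _; rewrite leey.
  rewrite [X in _ + X](_ : _ = 0) ?adde0//.
  rewrite (ae_eq_integral (cst 0)) ?integral0//.
  exists E; split => // x /= /not_implyP[Dx]; rewrite patchE.
  by case: ifPn => // /set_mem.
(* Lower bound: cutting [v] to 0 on [E] keeps its integral and brings it below [u]. *)
- rewrite [leLHS](_ : _ = \int[mu]_(x in D) (v \_ (~` E)) x).
    apply: nonmeasurable_ge0_le_integral => x Dx; rewrite patchE.
      by case: ifP.
    by case: ifPn => // /set_mem Ex; rewrite uv.
  apply: ae_eq_integral => //.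
    apply/measurable_restrict => //; first exact: measurableC.
    by apply: measurable_funS mv.
  exists E; split => // x /= /not_implyP[Dx]; rewrite patchE.
  by case: ifPn => // /negP xE _; apply: contrapT => Ex; apply: xE; exact/mem_set.
Qed.

End nonmeasurable_integral.

(* The value of an inner product, read off from the squared norms of
   f + g, f - g, f + i g and f - i g. *)
Definition polar {R : realType} (a b c d : \bar R) : R[i] :=
  (4^-1 * (fine a - fine b)) +i* (4^-1 * (fine c - fine d)).

(** * Complex scalars and scalar polarization *)

Section complex_algebra.
Context {R : realType}.
Implicit Types z w : R[i].

Lemma cReD z w : complex.Re (z + w) = complex.Re z + complex.Re w.
Proof. by case: z w => [? ?] [? ?]. Qed.

Lemma cImD z w : complex.Im (z + w) = complex.Im z + complex.Im w.
Proof. by case: z w => [? ?] [? ?]. Qed.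

Lemma cReM z w : complex.Re (z * w) =
  complex.Re z * complex.Re w - complex.Im z * complex.Im w.
Proof. by case: z w => [? ?] [? ?]. Qed.

Lemma cImM z w : complex.Im (z * w) =
  complex.Re z * complex.Im w + complex.Im z * complex.Re w.
Proof. by case: z w => [? ?] [? ?]. Qed.

Lemma cReJ z : complex.Re z^* = complex.Re z.
Proof. by case: z. Qed.

Lemma cImJ z : complex.Im z^* = - complex.Im z.
Proof. by case: z. Qed.

Lemma cJM z w : (z * w)^* = z^* * w^*.
Proof. exact: rmorphM. Qed.

Lemma cJreal (x : R) : (x%:C)^* = x%:C :> R[i].
Proof. by apply/eqP; rewrite eq_complex cReJ cImJ /= oppr0 !eqxx. Qed.

Lemma cJK z : z^*^* = z.
Proof. exact: conjcK. Qed.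

Lemma cabs2_ge0 z : 0 <= cabs2 z.
Proof. by rewrite addr_ge0// sqr_ge0. Qed.

Lemma cabs2M z w : cabs2 (z * w) = cabs2 z * cabs2 w.
Proof. case: z w => [a b] [c e]; rewrite /cabs2/=; ring. Qed.

Lemma cabs2J z : cabs2 z^* = cabs2 z.
Proof. by case: z => a b; rewrite /cabs2/= sqrrN. Qed.

Lemma cabs2N z : cabs2 (- z) = cabs2 z.
Proof. by case: z => a b; rewrite /cabs2/= !sqrrN. Qed.

Lemma cabs2_0 : cabs2 (0 : R[i]) = 0.
Proof. by rewrite /cabs2/= expr0n addr0. Qed.

Lemma cabs2_1 : cabs2 (1 : R[i]) = 1.
Proof. by rewrite /cabs2/= expr0n addr0 expr1n. Qed.

Lemma cabs2_i : cabs2 ('i : R[i]) = 1.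
Proof. by rewrite /cabs2/= expr0n add0r expr1n. Qed.

Lemma mulii : 'i * 'i = - 1 :> R[i].
Proof. by apply/eqP; rewrite eq_complex /= !mul0r mulr0 mulr1 sub0r addr0 oppr0 !eqxx. Qed.

Lemma cabs2_real (x : R) : cabs2 x%:C = x ^+ 2.
Proof. by rewrite /cabs2/= expr0n addr0. Qed.

Lemma cabs2_eq0 z : cabs2 z = 0 -> z = 0.
Proof.
case: z => a b; rewrite /cabs2/= => /eqP; rewrite paddr_eq0 ?sqr_ge0//.
by rewrite !sqrf_eq0 => /andP[/eqP-> /eqP->].
Qed.

Lemma cabs2D_le z w : cabs2 (z + w) <= 2 * cabs2 z + 2 * cabs2 w.
Proof.
case: z w => [a b] [c e]; rewrite /cabs2/=.
have := sqr_ge0 (a - c); have := sqr_ge0 (b - e); nra.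
Qed.

Lemma cabs2_parallelogram z w :
  cabs2 (z + w) + cabs2 (z - w) = 2 * cabs2 z + 2 * cabs2 w.
Proof. case: z w => [a b] [c e]; rewrite /cabs2/=; ring. Qed.

Lemma mulJ_polar z w : z * w^* = polar (cabs2 (z + w))%:E (cabs2 (z - w))%:E
  (cabs2 (z + 'i * w))%:E (cabs2 (z - 'i * w))%:E.
Proof. case: z w => [a b] [c e]; rewrite /cabs2/polar/=; congr (_ +i* _); lra. Qed.

End complex_algebra.

(** * Complex series and integrals computed from nonnegative ones *)

Section cvg_polar.
Context {R : realType}.
Implicit Types a b c e p q : nat -> \bar R.
Local Open Scope ereal_scope.

Lemma nneseries_fin_num p : (forall n, 0 <= p n) -> \sum_(0 <= n <oo) p n < +oo ->
  forall n, p n \is a fin_num.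
Proof.
move=> p0 poo n; rewrite ge0_fin_numE//.
apply: le_lt_trans poo; rewrite (@nneseriesD1 _ p n xpredT)// leeDl//.
by apply: nneseries_ge0.
Qed.

Lemma cvg_series_fine p : (forall n, 0 <= p n) -> \sum_(0 <= n <oo) p n < +oo ->
  (fun n => \sum_(0 <= i < n) fine (p i))%R @ \oo --> fine (\sum_(0 <= n <oo) p n).
Proof.
move=> p0 poo.
have : (fun n => \sum_(0 <= i < n) p i) @ \oo -->
    (fine (\sum_(0 <= n <oo) p n))%:E.
  rewrite fineK; last by rewrite ge0_fin_numE ?nneseries_ge0.
  exact: is_cvg_nneseries.
move/fine_cvg; apply: cvg_trans; apply: near_eq_cvg; near=> n => /=.
by rewrite sum_fine// => i _; exact: nneseries_fin_num.
Unshelve. all: by end_near. Qed.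

End cvg_polar.

Section csum.
Context {R : realType}.
Implicit Types (u v : nat -> R[i]) (a b c e : nat -> \bar R).

(** [csum] has a value even when the partial sums diverge; this relation also records the
    convergence, on which linearity rests. *)
Definition csum_to u (l : R[i]) :=
  (fun n => \sum_(0 <= i < n) complex.Re (u i)) @ \oo --> complex.Re l /\
  (fun n => \sum_(0 <= i < n) complex.Im (u i)) @ \oo --> complex.Im l.

Lemma csum_toE u l : csum_to u l -> csum u = l.
Proof. by case: l => x y [/= ux uy]; congr (_ +i* _); exact: cvg_lim. Qed.

Lemma csum_to_lin (k : R[i]) u v l m : csum_to u l -> csum_to v m ->
  csum_to (fun n => k * u n + v n) (k * l + m).
Proof.
move=> [ur ui] [vr vi]; split; rewrite ?cReD ?cReM ?cImD ?cImM.
- under eq_fun do under eq_bigr do rewrite cReD cReM.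
  under eq_fun do rewrite big_split sumrB -!mulr_sumr.
  by apply: cvgD => //; apply: cvgB; apply: cvgMr.
- under eq_fun do under eq_bigr do rewrite cImD cImM.
  under eq_fun do rewrite !big_split -!mulr_sumr.
  by apply: cvgD => //; apply: cvgD; apply: cvgMr.
Qed.

Lemma csum_to_shift u l : u 0%N = 0 -> csum_to (fun n => u n.+1) l -> csum_to u l.
Proof.
move=> u0 [ur ui]; split; rewrite -(@cvg_shiftS _ (fun n => \sum_(0 <= i < n) _)).
- by under eq_fun do rewrite big_nat_recl// u0 add0r.
- by under eq_fun do rewrite big_nat_recl// u0 add0r.
Qed.

Lemma csum_to_polar a b c e :
  (forall n, 0 <= a n)%E -> (forall n, 0 <= b n)%E ->
  (forall n, 0 <= c n)%E -> (forall n, 0 <= e n)%E ->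
  (\sum_(0 <= n <oo) a n < +oo)%E -> (\sum_(0 <= n <oo) b n < +oo)%E ->
  (\sum_(0 <= n <oo) c n < +oo)%E -> (\sum_(0 <= n <oo) e n < +oo)%E ->
  csum_to (fun n => polar (a n) (b n) (c n) (e n))
    (polar (\sum_(0 <= n <oo) a n) (\sum_(0 <= n <oo) b n)
      (\sum_(0 <= n <oo) c n) (\sum_(0 <= n <oo) e n)).
Proof.
move=> a0 b0 c0 e0 aoo boo coo eoo.
by split => /=; under eq_fun do rewrite -mulr_sumr sumrB; apply: cvgMr;
  apply: cvgB; exact: cvg_series_fine.
Qed.

End csum.

Section cintegral.
Context d (T : measurableType d) (R : realType).
Variables (mu : {measure set T -> \bar R}) (D : set T).
Hypothesis mD : measurable D.
Implicit Types (u v : T -> R[i]) (a b c e : T -> \bar R).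

Definition cintegrable u :=
  mu.-integrable D (EFin \o (fun x => complex.Re (u x))) /\
  mu.-integrable D (EFin \o (fun x => complex.Im (u x))).

Lemma eq_cintegral u v : (forall x, D x -> u x = v x) ->
  cintegral mu D u = cintegral mu D v.
Proof.
by move=> uv; congr (_ +i* _); apply: eq_Rintegral => x /set_mem Dx; rewrite uv.
Qed.

Lemma integrable_linB (x y : R) (f g : T -> R) :
  mu.-integrable D (EFin \o f) -> mu.-integrable D (EFin \o g) ->
  mu.-integrable D (EFin \o (fun t => x * f t + y * g t)) /\
  Rintegral mu D (fun t => x * f t + y * g t) =
    x * Rintegral mu D f + y * Rintegral mu D g.
Proof.
move=> fi gi.
have xf : mu.-integrable D (EFin \o (fun t => x * f t)).
  by apply: eq_integrable (integrableZl _ x fi).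
have yg : mu.-integrable D (EFin \o (fun t => y * g t)).
  by apply: eq_integrable (integrableZl _ y gi).
split; last by rewrite RintegralD// !RintegralZl.
by apply: eq_integrable (integrableD _ xf yg).
Qed.

Lemma cintegral_lin (k : R[i]) u v : cintegrable u -> cintegrable v ->
  cintegrable (fun x => k * u x + v x) /\
  cintegral mu D (fun x => k * u x + v x) = k * cintegral mu D u + cintegral mu D v.
Proof.
case: k => k l [ur ui] [vr vi].
have [r1 r2] := integrable_linB k (- l) ur ui.
have [r3 r4] := integrable_linB 1 1 r1 vr.
have [i1 i2] := integrable_linB k l ui ur.
have [i3 i4] := integrable_linB 1 1 i1 vi.
split; first split.
- apply: eq_integrable r3 => //= x _; congr EFin.
  by rewrite cReD cReM /= !mul1r mulNr.
- apply: eq_integrable i3 => //= x _; congr EFin.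
  by rewrite cImD cImM /= !mul1r.
apply/eqP; rewrite eq_complex cReD cReM cImD cImM /=; apply/andP; split; apply/eqP.
- move: r4; rewrite r2 !mul1r mulNr => <-; apply: eq_Rintegral => x _.
  by rewrite cReD cReM /= !mul1r mulNr.
- move: i4; rewrite i2 !mul1r => <-; apply: eq_Rintegral => x _.
  by rewrite cImD cImM /= !mul1r.
Qed.

Lemma cintegralZ (k : R[i]) u : cintegrable u ->
  cintegral mu D (fun x => k * u x) = k * cintegral mu D u.
Proof.
move=> iu.
have i0 : cintegrable (fun=> 0) by split; exact: integrable0.
have [_] := cintegral_lin k iu i0; under eq_cintegral do rewrite addr0.
move=> ->; rewrite [X in _ + X](_ : _ = 0) ?addr0//.
by rewrite /cintegral /Rintegral/= integral0.
Qed.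

Lemma cintegral_conj u : cintegrable u ->
  cintegral mu D (fun x => (u x)^*) = (cintegral mu D u)^*.
Proof.
move=> [ur ui]; rewrite /cintegral /=; congr (_ +i* _).
  by apply: eq_Rintegral => x _; rewrite cReJ.
rewrite -mulN1r -RintegralZl//; apply: eq_Rintegral => x _.
by rewrite cImJ mulN1r.
Qed.

(** In the applications [u] is itself a series or an integral, with an arbitrary value where it
    diverges. The formula for [u] is therefore asked only where the four functions are finite, which
    is almost everywhere because their integrals are finite. *)
Lemma cintegral_polar u a b c e :
  measurable_fun D a -> measurable_fun D b ->
  measurable_fun D c -> measurable_fun D e ->
  (forall x, D x -> 0 <= a x)%E -> (forall x, D x -> 0 <= b x)%E ->
  (forall x, D x -> 0 <= c x)%E -> (forall x, D x -> 0 <= e x)%E ->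
  (\int[mu]_(x in D) a x < +oo)%E -> (\int[mu]_(x in D) b x < +oo)%E ->
  (\int[mu]_(x in D) c x < +oo)%E -> (\int[mu]_(x in D) e x < +oo)%E ->
  (forall x, D x -> a x < +oo -> b x < +oo -> c x < +oo -> e x < +oo ->
    u x = polar (a x) (b x) (c x) (e x))%E ->
  cintegral mu D u = polar (\int[mu]_(x in D) a x) (\int[mu]_(x in D) b x)
    (\int[mu]_(x in D) c x) (\int[mu]_(x in D) e x).
Proof.
move=> ma mb mc me a0 b0 c0 e0 aoo boo coo eoo uE.
have key f : measurable_fun D f -> (forall x, D x -> 0 <= f x)%E ->
    (\int[mu]_(x in D) f x < +oo)%E ->
    [/\ mu.-integrable D (EFin \o (fine \o f)),
      Rintegral mu D (fine \o f) = fine (\int[mu]_(x in D) f x)%E &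
      {ae mu, forall x, D x -> f x \is a fin_num}].
  move=> mf f0 foo.
  have fi : mu.-integrable D f.
    apply/integrableP; split => //.
    by under eq_integral => x /set_mem Dx do rewrite gee0_abs ?f0//.
  have fae := integrable_ae mD fi.
  have mff : measurable_fun D (EFin \o (fine \o f)).
    by apply/measurable_EFinP; apply: measurableT_comp => //; exact: fine_measurable.
  have faeE : ae_eq mu D f (EFin \o (fine \o f)).
    by apply: filterS fae => x /[swap] Dx /(_ Dx) fx; rewrite /= fineK.
  split => //; last by rewrite /Rintegral (ae_eq_integral f)//; exact: ae_eq_sym.
  apply: le_integrable fi => // x Dx /=.
  by case: (f x) => [r| |]; rewrite //= ?normr0 ?leey.
have [ai aE aN] := key _ ma a0 aoo.
have [bi bE bN] := key _ mb b0 boo.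
have [ci cE cN] := key _ mc c0 coo.
have [ei eE eN] := key _ me e0 eoo.
have [N [mN N0 NE]] : {ae mu, forall x, D x -> [/\ a x < +oo, b x < +oo,
    c x < +oo & e x < +oo]%E}.
  apply: filterS (filterI (filterI aN bN) (filterI cN eN)).
  move=> x [[ha hb] [hc he]] Dx.
  by rewrite -!ge0_fin_numE ?a0 ?b0 ?c0 ?e0//; split; auto.
have uE' x : D x -> ~ N x -> u x = polar (a x) (b x) (c x) (e x).
  move=> Dx Nx; have : ~ ~ (D x -> [/\ a x < +oo, b x < +oo, c x < +oo & e x < +oo]%E).
    by move=> h; apply/Nx/NE.
  by move/contrapT/(_ Dx) => [*]; exact: uE.
have [+ +] := integrable_linB 4^-1 (- 4^-1) ai bi.
have [+ +] := integrable_linB 4^-1 (- 4^-1) ci ei.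
rewrite aE bE cE eE => /measurable_int mi iE /measurable_int mr rE.
rewrite /polar !mulrBr -!mulNr -iE -rE; congr (_ +i* _); congr fine.
- apply: (eq_integral_off_null mD mN N0) mr _ => x Dx Nx.
  by rewrite uE'//= mulrBr mulNr.
- apply: (eq_integral_off_null mD mN N0) mi _ => x Dx Nx.
  by rewrite uE'//= mulrBr mulNr.
Qed.

End cintegral.

(** * Square-integrable complex functions *)

Section L2.
Context d (T : measurableType d) (R : realType).
Variables (mu : {measure set T -> \bar R}) (D : set T).
Hypothesis mD : measurable D.
Implicit Types (f g h : T -> R[i]) (k : R[i]).
Local Notation normsq := (L2normsq mu D).

Lemma cmeasurableD f g : cmeasurable D f -> cmeasurable D g ->
  cmeasurable D (fun x => f x + g x).
Proof.
move=> [fr fi] [gr gi]; split.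
- by under eq_fun do rewrite cReD; exact: measurable_funD.
- by under eq_fun do rewrite cImD; exact: measurable_funD.
Qed.

Lemma cmeasurableM f g : cmeasurable D f -> cmeasurable D g ->
  cmeasurable D (fun x => f x * g x).
Proof.
move=> [fr fi] [gr gi]; split.
- under eq_fun do rewrite cReM.
  by apply: measurable_funB; exact: measurable_funM.
- under eq_fun do rewrite cImM.
  by apply: measurable_funD; exact: measurable_funM.
Qed.

Lemma cmeasurable_cst k : cmeasurable D (fun=> k).
Proof. by split. Qed.

Lemma cmeasurableZ k f : cmeasurable D f -> cmeasurable D (fun x => k * f x).
Proof. by apply: cmeasurableM; exact: cmeasurable_cst. Qed.

Lemma cmeasurableN f : cmeasurable D f -> cmeasurable D (fun x => - f x).
Proof.
by move=> /(cmeasurableZ (-1)) mf; under eq_fun do rewrite -mulN1r.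
Qed.

Lemma cmeasurableB f g : cmeasurable D f -> cmeasurable D g ->
  cmeasurable D (fun x => f x - g x).
Proof. by move=> mf mg; apply: cmeasurableD => //; exact: cmeasurableN. Qed.

Lemma cmeasurableJ f : cmeasurable D f -> cmeasurable D (fun x => (f x)^*).
Proof.
move=> [fr fi]; split; first by under eq_fun do rewrite cReJ.
under eq_fun do rewrite cImJ.
exact: measurable_funN.
Qed.

Lemma cmeasurable_sum I (r : seq I) (F : I -> T -> R[i]) :
  (forall i, cmeasurable D (F i)) ->
  cmeasurable D (fun x => \sum_(i <- r) F i x).
Proof.
move=> mF; elim: r => [|i r IH].
  by under eq_fun do rewrite big_nil; exact: cmeasurable_cst.
by under eq_fun do rewrite big_cons; exact: cmeasurableD.
Qed.

Lemma cmeasurable_real (h : T -> R) : measurable_fun D h ->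
  cmeasurable D (fun x => (h x)%:C).
Proof. by move=> mh; split. Qed.

Lemma measurable_cabs2 f : cmeasurable D f ->
  measurable_fun D (fun x => (cabs2 (f x))%:E).
Proof.
move=> [fr fi]; apply/measurable_EFinP.
by apply: measurable_funD; exact: measurable_funX.
Qed.

Lemma L2normsq_ge0 f : (0 <= normsq f)%E.
Proof. by apply: integral_ge0 => x _; rewrite lee_fin cabs2_ge0. Qed.

Lemma eq_L2normsq f g : (forall x, D x -> cabs2 (f x) = cabs2 (g x)) ->
  normsq f = normsq g.
Proof. by move=> fg; apply: eq_integral => x /set_mem Dx; rewrite fg. Qed.

Lemma L2normsqZ k f : cmeasurable D f ->
  normsq (fun x => k * f x) = ((cabs2 k)%:E * normsq f)%E.
Proof.
move=> mf; rewrite /L2normsq -ge0_integralZl_EFin ?cabs2_ge0//.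
- by apply: eq_integral => x _; rewrite cabs2M EFinM.
- by move=> x _; rewrite lee_fin cabs2_ge0.
- exact: measurable_cabs2.
Qed.

Lemma L2normsqD_le f g : cmeasurable D f -> cmeasurable D g ->
  (normsq (fun x => f x + g x)%R <= 2%:E * normsq f + 2%:E * normsq g)%E.
Proof.
move=> mf mg; have mf2 := measurable_cabs2 mf; have mg2 := measurable_cabs2 mg.
rewrite /L2normsq -!ge0_integralZl_EFin//; try
  by move=> x _; rewrite lee_fin cabs2_ge0.
rewrite -ge0_integralD//; first last.
- exact: emeasurable_funM.
- by move=> x _; rewrite -EFinM lee_fin mulr_ge0 ?cabs2_ge0.
- exact: emeasurable_funM.
- by move=> x _; rewrite -EFinM lee_fin mulr_ge0 ?cabs2_ge0.
apply: nonmeasurable_ge0_le_integral => x Dx; first by rewrite lee_fin cabs2_ge0.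
by rewrite -!EFinM -EFinD lee_fin cabs2D_le.
Qed.

Lemma L2normsqN f : normsq (fun x => - f x) = normsq f.
Proof. by apply: eq_L2normsq => x _; rewrite cabs2N. Qed.

Lemma L2normsqD0 f g : cmeasurable D f -> cmeasurable D g ->
  normsq f = 0 -> normsq g = 0 -> normsq (fun x => f x + g x) = 0.
Proof.
move=> mf mg f0 g0; apply/eqP; rewrite eq_le L2normsq_ge0 andbT.
by rewrite (le_trans (L2normsqD_le mf mg))// f0 g0 !mule0 adde0.
Qed.

Lemma eq_L2normsq_ae f g : cmeasurable D f -> cmeasurable D g ->
  normsq (fun x => f x - g x) = 0 -> normsq f = normsq g.
Proof.
move=> mf mg fg; apply: ae_eq_integral => //; [exact: measurable_cabs2..|].
have /(ae_eq_integral_abs _ mD) : measurable_fun D (fun x => (cabs2 (f x - g x))%:E).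
  by apply: measurable_cabs2; exact: cmeasurableB.
move=> /(_ mu)[/(_ _)+ _]; rewrite -{1}fg; case.
  by apply: eq_integral => x _; rewrite gee0_abs// lee_fin cabs2_ge0.
move=> N [mN N0 NE]; exists N; split => // x /= xfg; apply: NE => /= h.
apply: xfg => Dx; congr (cabs2 _)%:E.
by have [/cabs2_eq0 /eqP] := h Dx; rewrite subr_eq0 => /eqP.
Qed.

Lemma L2dot_polar f g : cmeasurable D f -> cmeasurable D g ->
  (normsq f < +oo)%E -> (normsq g < +oo)%E ->
  L2dot mu D f g = polar
    (normsq (fun x => f x + g x)) (normsq (fun x => f x - g x))
    (normsq (fun x => f x + 'i * g x)) (normsq (fun x => f x - 'i * g x)).
Proof.
move=> mf mg foo goo.
have mig := cmeasurableZ 'i mg.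
have igoo : (normsq (fun x => 'i * g x)%R < +oo)%E.
  by rewrite L2normsqZ// cabs2_i mul1e.
have fin u v : cmeasurable D u -> cmeasurable D v ->
    (normsq u < +oo)%E -> (normsq v < +oo)%E ->
    (normsq (fun x => u x + v x)%R < +oo)%E.
  move=> mu_ mv uoo voo; apply: (le_lt_trans (L2normsqD_le mu_ mv)).
  by rewrite lte_add_pinfty// lte_mul_pinfty// ge0_fin_numE ?L2normsq_ge0.
apply: cintegral_polar => //; try by move=> x _; rewrite lee_fin cabs2_ge0.
- by apply: measurable_cabs2; exact: cmeasurableD.
- by apply: measurable_cabs2; exact: cmeasurableB.
- by apply: measurable_cabs2; exact: cmeasurableD.
- by apply: measurable_cabs2; exact: cmeasurableB.
- exact: fin.
- by apply: fin => //; rewrite ?L2normsqN//; exact: cmeasurableN.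
- exact: fin.
- by apply: fin => //; rewrite ?L2normsqN//; exact: cmeasurableN.
- by move=> x _ _ _ _ _; rewrite mulJ_polar.
Qed.

Lemma integrable_L2dot f g : cmeasurable D f -> cmeasurable D g ->
  (normsq f < +oo)%E -> (normsq g < +oo)%E ->
  cintegrable mu D (fun x => f x * (g x)^*).
Proof.
move=> mf mg foo goo.
have mfg : cmeasurable D (fun x => f x * (g x)^*).
  by apply: cmeasurableM => //; exact: cmeasurableJ.
have int0 : mu.-integrable D (fun x => (cabs2 (f x))%:E + (cabs2 (g x))%:E)%E.
  apply: integrableD => //; apply/integrableP; split; try exact: measurable_cabs2.
  - under eq_integral do rewrite gee0_abs ?lee_fin ?cabs2_ge0//.
    exact: foo.
  - under eq_integral do rewrite gee0_abs ?lee_fin ?cabs2_ge0//.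
    exact: goo.
(* The real and imaginary parts of [(a + i b)(c - i e)] are dominated by the sum of the two squared
   moduli, which is integrable. *)
have sq0 (a b c e : R) : [/\ `|a * c + b * e| <= (a ^+ 2 + b ^+ 2) + (c ^+ 2 + e ^+ 2)
   & `|b * c - a * e| <= (a ^+ 2 + b ^+ 2) + (c ^+ 2 + e ^+ 2)].
  have := sqr_ge0 (a - c); have := sqr_ge0 (a + c); have := sqr_ge0 (b - e).
  have := sqr_ge0 (b + e); have := sqr_ge0 (b - c); have := sqr_ge0 (b + c).
  have := sqr_ge0 (a - e); have := sqr_ge0 (a + e); rewrite !ler_norml.
  by move=> *; split; apply/andP; split; nra.
split; apply: le_integrable int0 => //.
- by apply/measurable_EFinP; case: mfg.
- move=> x _ /=; rewrite lee_fin [leRHS]ger0_norm ?(addr_ge0 (cabs2_ge0 _) (cabs2_ge0 _))//.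
  rewrite cReM cReJ cImJ mulrN opprK.
  by have [] := sq0 (complex.Re (f x)) (complex.Im (f x)) (complex.Re (g x)) (complex.Im (g x)).
- by apply/measurable_EFinP; case: mfg.
- move=> x _ /=; rewrite lee_fin [leRHS]ger0_norm ?(addr_ge0 (cabs2_ge0 _) (cabs2_ge0 _))//.
  rewrite cImM cReJ cImJ mulrN [X in `|X|]addrC.
  by have [] := sq0 (complex.Re (f x)) (complex.Im (f x)) (complex.Re (g x)) (complex.Im (g x)).
Qed.

End L2.

(** * Tonelli's theorem on measurable rectangles *)

Section tonelli.
Local Open Scope ereal_scope.
Context d1 d2 (T1 : measurableType d1) (T2 : measurableType d2) (R : realType).
Variable m1 : {sigma_finite_measure set T1 -> \bar R}.
Variable m2 : {sigma_finite_measure set T2 -> \bar R}.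
Variables (D1 : set T1) (D2 : set T2).
Hypotheses (mD1 : measurable D1) (mD2 : measurable D2).
Variable f : T1 * T2 -> \bar R.
Hypothesis mf : measurable_fun (D1 `*` D2) f.
Hypothesis f0 : forall x y, D1 x -> D2 y -> 0 <= f (x, y).

(** Extension by zero turns integrals over the rectangle into integrals over the whole product, and
    its sections over [D1] and [D2] are extensions by zero of the sections of [f]. *)
Let g := f \_ (D1 `*` D2).

Let mD : measurable (D1 `*` D2).
Proof. exact: measurableX. Qed.

Let mg : measurable_fun setT g.
Proof. by apply/(measurable_restrictT _ mD). Qed.

Let g0 x : 0 <= g x.
Proof.
rewrite /g patchE; case: ifPn => // /set_mem[]; case: x => x y /=; exact: f0.
Qed.

Let gF x : D1 x -> \int[m2]_y g (x, y) = \int[m2]_(y in D2) f (x, y).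
Proof.
move=> D1x; rewrite [RHS]integral_mkcond; apply: eq_integral => y _.
by rewrite /g !patchE in_setX (mem_set D1x).
Qed.

Let gG y : D2 y -> \int[m1]_x g (x, y) = \int[m1]_(x in D1) f (x, y).
Proof.
move=> D2y; rewrite [RHS]integral_mkcond; apply: eq_integral => x _.
by rewrite /g !patchE in_setX (mem_set D2y) andbT.
Qed.

Lemma measurable_tonelli_F : measurable_fun D1 (fun x => \int[m2]_(y in D2) f (x, y)).
Proof.
apply: (eq_measurable_fun (fun x => \int[m2]_y g (x, y))).
  by move=> x /set_mem D1x; rewrite gF.
apply: measurable_funTS.
exact: (measurable_fun_fubini_tonelli_F g).
Qed.

Lemma measurable_tonelli_G : measurable_fun D2 (fun y => \int[m1]_(x in D1) f (x, y)).
Proof.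
apply: (eq_measurable_fun (fun y => \int[m1]_x g (x, y))).
  by move=> y /set_mem D2y; rewrite gG.
apply: measurable_funTS.
exact: (measurable_fun_fubini_tonelli_G g).
Qed.

Lemma tonelli1 : \int[m1 \x m2]_(z in D1 `*` D2) f z =
  \int[m1]_(x in D1) \int[m2]_(y in D2) f (x, y).
Proof.
rewrite integral_mkcond -/g fubini_tonelli1// [RHS]integral_mkcond.
apply: eq_integral => x _; rewrite /fubini_F patchE; case: ifPn => [/set_mem|] D1x.
  by rewrite gF.
by rewrite integral0_eq// => y _; rewrite /g patchE in_setX (negbTE D1x).
Qed.

Lemma tonelli2 : \int[m1 \x m2]_(z in D1 `*` D2) f z =
  \int[m2]_(y in D2) \int[m1]_(x in D1) f (x, y).
Proof.
rewrite integral_mkcond -/g fubini_tonelli2// [RHS]integral_mkcond.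
apply: eq_integral => y _; rewrite /fubini_G patchE; case: ifPn => [/set_mem|] D2y.
  by rewrite gG.
by rewrite integral0_eq// => x _; rewrite /g patchE in_setX (negbTE D2y) andbF.
Qed.

End tonelli.

Section product_measure.
Context d1 d2 (T1 : measurableType d1) (T2 : measurableType d2) (R : realType).
Variable m1 : {sigma_finite_measure set T1 -> \bar R}.
Variable m2 : {sigma_finite_measure set T2 -> \bar R}.
Local Open Scope ereal_scope.

(* [m1 \x m2] under another name: the canonical sigma-finite structure on    *)
(* [\x] found by unification is the one for pairs of subprobabilities.       *)
Definition sfprod : set (T1 * T2) -> \bar R := m1 \x m2.

HB.instance Definition _ := Measure.copy sfprod (m1 \x m2).

Let sfprod_sigma_finite : sigma_finite setT sfprod.
Proof.
have /sigma_finiteP[F [TF ndF Foo]] := sigma_finiteT m1.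
have /sigma_finiteP[G [TG ndG Goo]] := sigma_finiteT m2.
exists (fun n => F n `*` G n).
  apply/seteqP; split => // -[x y] _.
  have [i _ Fi] : (\bigcup_i F i) x by rewrite -TF.
  have [j _ Gj] : (\bigcup_i G i) y by rewrite -TG.
  exists (maxn i j) => //; split.
  - by move: Fi; exact/subsetPset/ndF/leq_maxl.
  - by move: Gj; exact/subsetPset/ndG/leq_maxr.
move=> k; have [mF Fk] := Foo k; have [mG Gk] := Goo k.
split; first exact: measurableX.
by rewrite /sfprod product_measure1E// lte_mul_pinfty// ge0_fin_numE.
Qed.

HB.instance Definition _ := Measure_isSigmaFinite.Build _ _ _ sfprod
  sfprod_sigma_finite.

End product_measure.

(** * Lebesgue measure on tuples *)

Section lebesgue_orthant.
Context {R : realType}.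
Local Notation RR := (measurableTypeR R).
Local Notation lam := (@lebesgue_measure R).
Local Notation halfline := (@halfline R).
Local Notation orth n := (@orthant R n).

Lemma measurable_halfline : measurable halfline.
Proof.
have -> : halfline = `[(0 : R), +oo[%classic by apply/seteqP; split => x /=; rewrite in_itv/= andbT.
exact: measurable_itv.
Qed.

Lemma measurable_orthant n : measurable (orth n).
Proof.
have -> : orth n = \bigcap_(i in [set: 'I_n]) ((@tnth n RR)^~ i @^-1` halfline).
  by apply/seteqP; split => [s hs i _|s hs i]; [exact: hs|exact: (hs i I)].
apply: fin_bigcap_measurable => // i _; rewrite -[X in measurable X]setTI.
by apply: measurable_tnth => //; exact: measurable_halfline.
Qed.

Lemma orthantP n (s : n.-tuple RR) : orthant s <-> all (fun x => 0 <= x) s.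
Proof.
split=> [h|/allP h i]; last exact/h/mem_tnth.
by apply/allP => x /tnthP[i ->]; exact: h.
Qed.

Lemma orthant0 : orth 0 = setT.
Proof. by apply/seteqP; split => // s _ []. Qed.

Definition consT n (t : RR) (s : n.-tuple RR) : n.+1.-tuple RR := tcons (t, s).

Lemma orthant_tcons n t (s : n.-tuple RR) :
  orthant (consT t s) <-> halfline t /\ orthant s.
Proof. by rewrite !orthantP; split => /=; [move/andP|move=> [? ?]; apply/andP]. Qed.

Lemma preimage_tcons n : @tcons R n @^-1` orth n.+1 = halfline `*` orth n.
Proof. by apply/seteqP; split => -[t s] /orthant_tcons. Qed.

Lemma measurable_cat_tuple m k :
  measurable_fun setT (fun p : m.-tuple RR * k.-tuple RR =>
    [the (m + k).-tuple RR of p.1 ++ p.2]).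
Proof.
apply/measurable_fun_tnthP => i; rewrite -(@fintype.splitK m k i).
case: (@fintype.split m k i) => j /=.
- rewrite (_ : _ \o _ = (@tnth m RR)^~ j \o fst).
    by apply: measurableT_comp => //; exact: measurable_tnth.
  by apply/funext => -[s u] /=; rewrite tnth_lshift.
- rewrite (_ : _ \o _ = (@tnth k RR)^~ j \o snd).
    by apply: measurableT_comp => //; exact: measurable_tnth.
  by apply/funext => -[s u] /=; rewrite tnth_rshift.
Qed.

Lemma orthant_cat m k (s : m.-tuple RR) (u : k.-tuple RR) :
  orthant [the (m + k).-tuple RR of s ++ u] <-> orthant s /\ orthant u.
Proof.
by rewrite !orthantP /= all_cat; split; [move/andP|move=> [? ?]; apply/andP].
Qed.

Lemma measurable_rev_tuple n :
  measurable_fun setT (fun s : n.-tuple RR => [the n.-tuple RR of rev s]).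
Proof.
apply/measurable_fun_tnthP => i.
rewrite (_ : _ \o _ = (@tnth n RR)^~ (rev_ord i)); first exact: measurable_tnth.
apply/funext => s /=; case: n i s => [[]//|n] i s.
by rewrite !(tnth_nth 0) /= nth_rev ?size_tuple// subSS.
Qed.

Lemma orthant_rev n (s : n.-tuple RR) :
  orthant [the n.-tuple RR of rev s] <-> orthant s.
Proof. by rewrite !orthantP /= all_rev. Qed.

Lemma measurable_rcons_tuple n :
  measurable_fun setT (fun p : n.-tuple RR * RR => [the n.+1.-tuple RR of rcons p.1 p.2]).
Proof.
(* [rcons s t] is [rev (t :: rev s)], a composite of maps already known to be measurable. *)
have -> : (fun p : n.-tuple RR * RR => [the n.+1.-tuple RR of rcons p.1 p.2]) =
  (fun s : n.+1.-tuple RR => [the n.+1.-tuple RR of rev s]) \o @tcons R n \o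
  (fun p : n.-tuple RR * RR => (p.2, [tuple of rev p.1])).
  by apply/funext => p; apply: val_inj; rewrite /= rev_cons revK.
apply: measurableT_comp; first exact: measurableT_comp (@measurable_rev_tuple _) (@measurable_tcons _ _).
apply: measurable_fun_pair => //.
exact: (measurableT_comp (@measurable_rev_tuple n) measurable_fst).
Qed.

Lemma orthant_rcons n (s : n.-tuple RR) t :
  orthant [the n.+1.-tuple RR of rcons s t] <-> halfline t /\ orthant s.
Proof.
by rewrite !orthantP /= all_rcons; split; [move/andP|move=> [? ?]; apply/andP].
Qed.

Local Open Scope ereal_scope.

Section cons.
Variables (n : nat) (f : n.+1.-tuple RR -> \bar R).
Hypothesis mf : measurable_fun (orth n.+1) f.
Hypothesis f0 : forall s, orthant s -> 0 <= f s.

Let mft : measurable_fun (halfline `*` orth n) (f \o @tcons R n).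
Proof.
apply: (measurable_comp (F := orth n.+1)) => //.
- exact: measurable_orthant.
- by move=> _ [[t s] ts <-]; apply/orthant_tcons.
- by apply: measurable_funTS; exact: measurable_tcons.
Qed.

Let f0t t s : halfline t -> orthant s -> 0 <= (f \o @tcons R n) (t, s).
Proof. by move=> *; apply: f0; exact/orthant_tcons. Qed.

Lemma integral_leb_prod : \int[leb n.+1]_(s in orth n.+1) f s =
  \int[lam \x leb n]_(p in halfline `*` orth n) f (tcons p).
Proof.
rewrite /= /leb_step ge0_integral_pushforward ?preimage_tcons//.
- exact: measurable_tcons.
- exact: measurable_orthant.
- by move=> s /set_mem; exact: f0.
Qed.

Lemma integral_leb_cons : \int[leb n.+1]_(s in orth n.+1) f s =
  \int[lam]_(t in halfline) \int[leb n]_(s in orth n) f (consT t s).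
Proof.
by rewrite integral_leb_prod (tonelli1 _ _ measurable_halfline (@measurable_orthant n) mft f0t).
Qed.

Lemma integral_leb_cons_swap : \int[leb n.+1]_(s in orth n.+1) f s =
  \int[leb n]_(s in orth n) \int[lam]_(t in halfline) f (consT t s).
Proof.
by rewrite integral_leb_prod (tonelli2 _ _ measurable_halfline (@measurable_orthant n) mft f0t).
Qed.

Lemma measurable_leb_tail :
  measurable_fun (orth n) (fun s => \int[lam]_(t in halfline) f (consT t s)).
Proof.
apply: (measurable_tonelli_G _ measurable_halfline (@measurable_orthant n) mft f0t).
Qed.

End cons.

Lemma integral_leb0 (f : 0.-tuple RR -> \bar R) :
  \int[leb 0]_(s in orth 0) f s = f [tuple].
Proof.
have mf : measurable_fun (orth 0) f.
  rewrite (_ : f = cst (f [tuple])); first exact: measurable_cst.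
  by apply/funext => s; rewrite (tuple0 s).
by rewrite /= integral_dirac//= ?diracE ?orthant0 ?in_setT ?mul1e.
Qed.

Section cat.
Variable k : nat.

Lemma measurable_cat_comp m (f : (m + k).-tuple RR -> \bar R) :
  measurable_fun (orth (m + k)) f ->
  measurable_fun (orth m `*` orth k) (fun p => f [the _.-tuple RR of p.1 ++ p.2]).
Proof.
move=> mf; apply: (measurable_comp (F := orth (m + k))) => //.
- exact: measurable_orthant.
- by move=> _ [[s u] su <-]; apply/orthant_cat.
- by apply: measurable_funTS; exact: measurable_cat_tuple.
Qed.

(** Induction on [m], peeling off the first variable on both sides. The tuples obtained have the
    same underlying sequence, hence the appeals to [val_inj]. *)
Lemma integral_leb_cat m (f : (m + k).-tuple RR -> \bar R) :
  measurable_fun (orth (m + k)) f -> (forall s, orthant s -> 0 <= f s) ->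
  \int[leb (m + k)]_(s in orth (m + k)) f s =
  \int[leb m]_(s in orth m) \int[leb k]_(u in orth k)
     f [the (m + k).-tuple RR of s ++ u].
Proof.
elim: m f => [|m IH] f mf f0.
  rewrite integral_leb0; apply: eq_integral => s _; congr f; exact: val_inj.
have mfc := measurable_cat_comp mf.
have fc0 s u : orthant s -> orthant u -> 0 <= f [the (m.+1 + k).-tuple RR of s ++ u].
  by move=> os ou; apply: f0; apply/orthant_cat.
rewrite (integral_leb_cons (n := m + k) mf f0) integral_leb_cons; last 2 first.
- by exact: (measurable_tonelli_F _ (@measurable_orthant _) (@measurable_orthant _) mfc).
- by move=> s os; apply: integral_ge0 => u ou; exact: fc0.
apply: eq_integral => t /set_mem ht.
rewrite (IH (fun s => f (consT t s))).
- apply: eq_integral => s _; apply: eq_integral => u _; congr f; exact: val_inj.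
- apply: (measurable_comp (F := orth (m + k).+1)) mf _.
  + exact: measurable_orthant.
  + by move=> _ [s hs <-]; apply/orthant_tcons.
  + apply: measurable_funTS; apply: measurableT_comp; first exact: measurable_tcons.
    exact: measurable_pair1.
- by move=> s hs; apply: f0; apply/orthant_tcons.
Qed.

End cat.

(** The coordinates in which a function of m + n + 1 variables becomes a component of an element of
    B_2. *)
Definition insert m n (p : RR * (m.-tuple RR * n.-tuple RR)) : (m + n.+1).-tuple RR :=
  [the (m + n.+1).-tuple RR of p.2.1 ++ consT p.1 p.2.2].

Lemma measurable_insert m n : measurable_fun setT (@insert m n).
Proof.
pose e (p : RR * (m.-tuple RR * n.-tuple RR)) := (p.2.1, consT p.1 p.2.2).
rewrite (_ : @insert m n = (fun q : m.-tuple RR * n.+1.-tuple RR => [tuple of q.1 ++ q.2]) \o e)//.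
apply: measurableT_comp; first exact: measurable_cat_tuple.
apply: measurable_fun_pair.
  exact: (measurableT_comp measurable_fst measurable_snd).
apply: (measurableT_comp (@measurable_tcons R n)).
apply: measurable_fun_pair => //.
exact: (measurableT_comp measurable_snd measurable_snd).
Qed.

Definition insert_dom m n : set (RR * (m.-tuple RR * n.-tuple RR)) :=
  halfline `*` @fock2_dom R m n.

Lemma orthant_insert m n p : orthant (@insert m n p) <-> insert_dom p.
Proof.
case: p => t [s u]; split.
  by move=> /orthant_cat[? /orthant_tcons[? ?]].
by move=> [ht [hs hu]]; apply/orthant_cat; split => //; apply/orthant_tcons.
Qed.

Lemma measurable_fock2_dom m n : measurable (@fock2_dom R m n).
Proof. by apply: measurableX; exact: measurable_orthant. Qed.

Lemma measurable_insert_dom m n : measurable (@insert_dom m n).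
Proof.
by apply: measurableX; [exact: measurable_halfline|exact: measurable_fock2_dom].
Qed.

(** Splitting off the first [m] variables and then the head of the rest integrates in the order s,
    t, u; Tonelli moves t to the front, which is the order of B_2. *)
Lemma integral_leb_insert m n (f : (m + n.+1).-tuple RR -> \bar R) :
  measurable_fun (orth (m + n.+1)) f -> (forall s, orthant s -> 0 <= f s) ->
  \int[leb (m + n.+1)]_(s in orth (m + n.+1)) f s =
  \int[sfprod lam (sfprod (leb m) (leb n))]_(p in @insert_dom m n) f (insert p).
Proof.
move=> mf f0.
have mfi : measurable_fun (@insert_dom m n) (f \o @insert m n).
  apply: (measurable_comp (F := orth (m + n.+1))) mf _.
  - exact: measurable_orthant.
  - by move=> _ [p hp <-]; apply/orthant_insert.
  - by apply: measurable_funTS; exact: measurable_insert.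
have f0i t q : halfline t -> fock2_dom q -> 0 <= f (@insert m n (t, q)).
  by move=> ht hq; apply: f0; apply/orthant_insert.
have mh := measurable_halfline; have mo k := @measurable_orthant k.
have mfc := measurable_cat_comp mf.
have fc0 s u : orthant s -> orthant u -> 0 <= f [the (m + n.+1).-tuple RR of s ++ u].
  by move=> os ou; apply: f0; apply/orthant_cat.
rewrite integral_leb_cat//.
rewrite [RHS](tonelli1 lam (sfprod (leb m) (leb n)) mh (@measurable_fock2_dom m n) mfi f0i).
transitivity (\int[leb m]_(s in orth m) \int[lam]_(t in halfline)
    \int[leb n]_(u in orth n) f (insert (t, (s, u)))).
  apply: eq_integral => s /set_mem os; rewrite integral_leb_cons//.
  - have := @measurable_pair1 _ _ (m.-tuple RR) (n.+1.-tuple RR) s.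
    move=> /(measurable_funTS (D := orth n.+1)).
    apply: (measurable_comp _ _ mfc); first exact: measurableX.
    by move=> _ [u ou <-].
  - by move=> u ou; exact: fc0.
(* With the variables regrouped as [((t, s), u)], integrating out [u] leaves a nonnegative
   measurable function of [(t, s)], for which the two orders of integration can be compared. *)
pose g (p : RR * m.-tuple RR * n.-tuple RR) := f (insert (p.1.1, (p.1.2, p.2))).
have mg : measurable_fun ((halfline `*` orth m) `*` orth n) g.
  apply: (measurable_comp (F := @insert_dom m n)) mfi _.
  - exact: measurable_insert_dom.
  - by move=> _ [[[t s] u] [[ht hs] hu] <-].
  - apply: measurable_funTS; apply: measurable_fun_pair.
      exact: (measurableT_comp measurable_fst measurable_fst).
    apply: measurable_fun_pair => //.
    exact: (measurableT_comp measurable_snd measurable_fst).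
have g0 p u : (halfline `*` orth m) p -> orthant u -> 0 <= g (p, u).
  by case: p => t s [ht hs] hu; apply: f0; apply/orthant_insert.
have mG := measurable_tonelli_F (leb n) (measurableX mh (mo m)) (mo n) mg g0.
have G0 t s : halfline t -> orthant s ->
    0 <= \int[leb n]_(u in orth n) g (t, s, u).
  by move=> ht hs; apply: integral_ge0 => u hu; exact: g0.
rewrite -[LHS](tonelli2 lam _ mh (mo m) mG G0) (tonelli1 _ _ mh (mo m) mG G0).
apply: eq_integral => t /set_mem ht.
have mft : measurable_fun (orth m `*` orth n) (fun q => f (insert (t, q))).
  apply: (measurable_comp (F := @insert_dom m n)) mfi _.
  - exact: measurable_insert_dom.
  - by move=> _ [q hq <-].
  - by apply: measurable_funTS; exact: measurable_pair1.
have f0t s u : orthant s -> orthant u -> 0 <= f (@insert m n (t, (s, u))).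
  by move=> hs hu; exact: f0i.
by rewrite (tonelli1 _ _ (mo m) (mo n) mft f0t).
Qed.

Lemma measurable_rcons_comp n (f : n.+1.-tuple RR -> \bar R) :
  measurable_fun (orth n.+1) f ->
  measurable_fun (orth n `*` halfline)
    (fun p => f [the n.+1.-tuple RR of rcons p.1 p.2]).
Proof.
move=> mf; apply: (measurable_comp (F := orth n.+1)) mf _.
- exact: measurable_orthant.
- by move=> _ [[s t] [hs ht] <-]; apply/orthant_rcons.
- by apply: measurable_funTS; exact: measurable_rcons_tuple.
Qed.

Lemma integral_leb_rcons n (f : n.+1.-tuple RR -> \bar R) :
  measurable_fun (orth n.+1) f -> (forall s, orthant s -> 0 <= f s) ->
  \int[leb n.+1]_(s in orth n.+1) f s = \int[leb n]_(s in orth n)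
    \int[lam]_(t in halfline) f [the n.+1.-tuple RR of rcons s t].
Proof.
have mh := measurable_halfline; have mo k := @measurable_orthant k.
elim: n f => [|n IH] f mf f0.
  rewrite integral_leb0 integral_leb_cons//; apply: eq_integral => t _.
  by rewrite integral_leb0; congr f; exact: val_inj.
have mfr := measurable_rcons_comp mf.
have fr0 s t : orthant s -> halfline t -> 0 <= f [the n.+2.-tuple RR of rcons s t].
  by move=> hs ht; apply: f0; apply/orthant_rcons.
rewrite integral_leb_cons// integral_leb_cons; last 2 first.
- exact: (measurable_tonelli_F _ (mo n.+1) mh mfr).
- by move=> s hs; apply: integral_ge0 => t ht; exact: fr0.
apply: eq_integral => t /set_mem ht; rewrite (IH (fun s => f (consT t s))).
- apply: eq_integral => s _; apply: eq_integral => r _; congr f; exact: val_inj.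
- apply: (measurable_comp (F := orth n.+2)) mf _.
  + exact: mo.
  + by move=> _ [s hs <-]; apply/orthant_tcons.
  + apply: measurable_funTS; apply: measurableT_comp; first exact: measurable_tcons.
    exact: measurable_pair1.
- by move=> s hs; apply: f0; apply/orthant_tcons.
Qed.

(** Reversal turns the first variable into the last one. One side is therefore decomposed by its
    head and the other by its last entry, and the remaining variables are reversed by induction. *)
Lemma integral_leb_rev n (f : n.-tuple RR -> \bar R) :
  measurable_fun (orth n) f -> (forall s, orthant s -> 0 <= f s) ->
  \int[leb n]_(s in orth n) f [the n.-tuple RR of rev s] =
  \int[leb n]_(s in orth n) f s.
Proof.
have mh := measurable_halfline; have mo k := @measurable_orthant k.
elim: n f => [|n IH] f mf f0.
  by rewrite !integral_leb0; congr f; exact: val_inj.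
have mfr := measurable_rcons_comp mf.
have fr0 s t : orthant s -> halfline t -> 0 <= f [the n.+1.-tuple RR of rcons s t].
  by move=> hs ht; apply: f0; apply/orthant_rcons.
rewrite integral_leb_cons; last 2 first.
- apply: (measurable_comp (F := orth n.+1)) mf _.
  + exact: mo.
  + by move=> _ [s hs <-]; apply/orthant_rev.
  + by apply: measurable_funTS; exact: measurable_rev_tuple.
- by move=> s hs; apply: f0; apply/orthant_rev.
rewrite integral_leb_rcons// -(tonelli1 (leb n) lam (mo n) mh mfr fr0).
rewrite (tonelli2 (leb n) lam (mo n) mh mfr fr0).
apply: eq_integral => t /set_mem ht.
rewrite -(IH (fun s => f [the n.+1.-tuple RR of rcons s t])).
- apply: eq_integral => s _; congr f; apply: val_inj.
  by rewrite /= rev_cons.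
- have := @measurable_pair2 _ _ (n.-tuple RR) RR t.
  move=> /(measurable_funTS (D := orth n)).
  apply: (measurable_comp _ _ mfr); first exact: measurableX.
  by move=> _ [u ou <-].
- by move=> s hs; exact: fr0.
Qed.

End lebesgue_orthant.

(** * The Fock space as a Hilbert space *)

Section fock_module.
Context {R : realType}.
Local Notation fock := (fock R).

Let addA : associative (@fock_add R).
Proof.
move=> f g h; apply: functional_extensionality_dep => n.
by apply/funext => s; exact: addrA.
Qed.

Let addC : commutative (@fock_add R).
Proof.
move=> f g; apply: functional_extensionality_dep => n.
by apply/funext => s; exact: addrC.
Qed.

Let add0 : left_id fock0 (@fock_add R).
Proof.
move=> f; apply: functional_extensionality_dep => n.
by apply/funext => s; exact: add0r.
Qed.

Let addN : left_inverse fock0 (fun f n s => - f n s) (@fock_add R).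
Proof.
move=> f; apply: functional_extensionality_dep => n.
by apply/funext => s; exact: addNr.
Qed.

(** [f + g] and [f - g] are convertible to [fock_add f g] and [fock_sub f g], so the definitions of
    the statement can be handled as module expressions. *)
HB.instance Definition _ := GRing.isZmodule.Build fock addA addC add0 addN.

Let scaleA (a b : R[i]) (f : fock) : fock_scale a (fock_scale b f) = fock_scale (a * b) f.
Proof.
apply: functional_extensionality_dep => n; apply/funext => s; exact: mulrA.
Qed.

Let scale1 : left_id 1 (@fock_scale R).
Proof.
move=> f; apply: functional_extensionality_dep => n.
by apply/funext => s; exact: mul1r.
Qed.

Let scaleDr : right_distributive (@fock_scale R) +%R.
Proof.
move=> a f g; apply: functional_extensionality_dep => n.
by apply/funext => s; exact: mulrDr.
Qed.

Let scaleDl (f : fock) : {morph (@fock_scale R)^~ f : a b / a + b}.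
Proof.
move=> a b; apply: functional_extensionality_dep => n.
by apply/funext => s; exact: mulrDl.
Qed.

HB.instance Definition _ := GRing.Zmodule_isLmodule.Build R[i] fock
  scaleA scale1 scaleDr scaleDl.

Lemma fockP (f g : fock) : (forall n s, f n s = g n s) -> f = g.
Proof.
by move=> fg; apply: functional_extensionality_dep => n; apply/funext.
Qed.

Lemma fock_sumE I (r : seq I) (F : I -> fock) n s :
  (\sum_(i <- r) F i) n s = \sum_(i <- r) F i n s.
Proof. by elim: r => [|i r IH]; rewrite ?big_nil// !big_cons -IH. Qed.

End fock_module.

Section fock_hilbert.
Context {R : realType}.
Local Notation RR := (measurableTypeR R).
Local Notation fock := (fock R).
Local Notation orth n := (@orthant R n).
Local Notation cnorm f n := (L2normsq (leb n) (orth n) (f n)).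
Implicit Types (f g h : fock) (k : R[i]).

Definition fock_measurable f := forall n, cmeasurable (orth n) (f n).

Lemma in_fock_measurable f : in_fock f -> fock_measurable f.
Proof. by case. Qed.

Lemma fock_measurableD f g :
  fock_measurable f -> fock_measurable g -> fock_measurable (f + g).
Proof. by move=> mf mg n; exact: cmeasurableD. Qed.

Lemma fock_measurableZ k f : fock_measurable f -> fock_measurable (k *: f).
Proof. by move=> mf n; exact: cmeasurableZ. Qed.

Lemma fock_measurableN f : fock_measurable f -> fock_measurable (- f).
Proof. by move=> mf n; exact: cmeasurableN. Qed.

Lemma fock_measurableB f g :
  fock_measurable f -> fock_measurable g -> fock_measurable (f - g).
Proof. by move=> mf mg n; exact: cmeasurableB. Qed.

Lemma fock_normsq_ge0 f : (0 <= fock_normsq f)%E.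
Proof. by apply: nneseries_ge0 => *; exact: L2normsq_ge0. Qed.

Lemma cnorm_le_fock_normsq f n : (cnorm f n <= fock_normsq f)%E.
Proof.
rewrite /fock_normsq (@nneseriesD1 _ (fun n => cnorm f n) n xpredT)//.
  by rewrite leeDl//; apply: nneseries_ge0 => *; exact: L2normsq_ge0.
by move=> *; exact: L2normsq_ge0.
Qed.

Lemma eq_fock_normsq f g : (forall n, cnorm f n = cnorm g n) ->
  fock_normsq f = fock_normsq g.
Proof. by move=> fg; apply: eq_eseriesr => n _; rewrite fg. Qed.

Lemma fock_normsq_eq0 f : fock_normsq f = 0 <-> forall n, cnorm f n = 0.
Proof.
split=> [f0 n|f0]; last by apply: eseries0 => n _ _; rewrite f0.
by apply/eqP; rewrite eq_le L2normsq_ge0 andbT -f0 cnorm_le_fock_normsq.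
Qed.

Lemma fock_normsqN f : fock_normsq (- f) = fock_normsq f.
Proof. by apply: eq_fock_normsq => n; exact: L2normsqN. Qed.

Lemma fock_normsqBC f g : fock_normsq (f - g) = fock_normsq (g - f).
Proof. by rewrite -fock_normsqN opprB. Qed.

Lemma fock_normsqZ k f : fock_measurable f ->
  fock_normsq (k *: f) = ((cabs2 k)%:E * fock_normsq f)%E.
Proof.
move=> mf; rewrite /fock_normsq -nneseriesZl; last by move=> *; exact: L2normsq_ge0.
by apply: eq_eseriesr => n _; rewrite L2normsqZ//; exact: measurable_orthant.
Qed.

Lemma fock_normsqD_le f g : fock_measurable f -> fock_measurable g ->
  (fock_normsq (f + g)%R <= 2%:E * fock_normsq f + 2%:E * fock_normsq g)%E.
Proof.
move=> mf mg; rewrite /fock_normsq.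
rewrite -!nneseriesZl; [|by move=> *; exact: L2normsq_ge0..].
rewrite -nneseriesD; [|by move=> *; apply: mule_ge0 => //; exact: L2normsq_ge0..].
apply: lee_nneseries => n _; first by move=> _; exact: L2normsq_ge0.
exact: (L2normsqD_le (leb n) (@measurable_orthant R n) (mf n) (mg n)).
Qed.

Lemma in_fockD f g : in_fock f -> in_fock g -> in_fock (f + g).
Proof.
move=> [mf foo] [mg goo]; split; first exact: fock_measurableD.
apply: (le_lt_trans (fock_normsqD_le mf mg)).
by rewrite lte_add_pinfty// lte_mul_pinfty// ge0_fin_numE// fock_normsq_ge0.
Qed.

Lemma in_fockZ k f : in_fock f -> in_fock (k *: f).
Proof.
move=> [mf foo]; split; first exact: fock_measurableZ.
by rewrite fock_normsqZ// lte_mul_pinfty// ?lee_fin ?cabs2_ge0.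
Qed.

Lemma in_fockN f : in_fock f -> in_fock (- f).
Proof.
move=> [mf foo]; split; first exact: fock_measurableN.
by rewrite fock_normsqN.
Qed.

Lemma in_fockB f g : in_fock f -> in_fock g -> in_fock (f - g).
Proof. by move=> hf hg; exact: in_fockD hf (in_fockN hg). Qed.

Lemma in_fock0 : in_fock (0 : fock).
Proof.
split=> [n|]; first exact: cmeasurable_cst.
rewrite (_ : fock_normsq _ = 0)//; apply/fock_normsq_eq0 => n.
by rewrite /L2normsq; under eq_integral do rewrite cabs2_0; rewrite integral0.
Qed.

Lemma in_fock_vacuum : in_fock (@vacuum R).
Proof.
split=> [n|]; first exact: cmeasurable_cst.
rewrite /fock_normsq nneseries_recl//; last by move=> *; exact: L2normsq_ge0.
rewrite [X in (_ + X)%E](_ : _ = 0) ?adde0; last first.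
  apply: eseries0 => -[|n]// _ _; rewrite /L2normsq.
  by under eq_integral do rewrite cabs2_0; rewrite integral0.
by rewrite /L2normsq integral_leb0 /vacuum eqxx cabs2_1 ltry.
Qed.

(** Equality of the classes modulo null sets. Transitivity and compatibility with the operations
    rest on the norm inequality for sums, hence the measurability hypotheses in the lemmas below. *)
Definition feq f g := fock_normsq (f - g) = 0.

Lemma feq_refl f : feq f f.
Proof.
rewrite /feq subrr; apply/fock_normsq_eq0 => n.
by rewrite /L2normsq; under eq_integral do rewrite cabs2_0; rewrite integral0.
Qed.

Lemma feq_sym f g : feq f g -> feq g f.
Proof. by rewrite /feq fock_normsqBC. Qed.

Lemma feqD f f' g g' :
  fock_measurable f -> fock_measurable f' -> fock_measurable g -> fock_measurable g' ->
  feq f f' -> feq g g' -> feq (f + g) (f' + g').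
Proof.
move=> mf mf' mg mg' ff gg; apply/eqP; rewrite eq_le fock_normsq_ge0 andbT.
rewrite opprD addrACA (le_trans (fock_normsqD_le _ _))//; try exact: fock_measurableB.
by rewrite ff gg !mule0 adde0.
Qed.

Lemma feqZ k f g : fock_measurable f -> fock_measurable g ->
  feq f g -> feq (k *: f) (k *: g).
Proof.
move=> mf mg fg; rewrite /feq -scalerBr fock_normsqZ ?fg ?mule0//.
exact: fock_measurableB.
Qed.

Lemma feq_trans f g h : fock_measurable f -> fock_measurable g ->
  fock_measurable h -> feq f g -> feq g h -> feq f h.
Proof.
move=> mf mg mh fg gh; apply/eqP; rewrite eq_le fock_normsq_ge0 andbT.
rewrite -(subrKA g) (le_trans (fock_normsqD_le _ _))//; try exact: fock_measurableB.
by rewrite fg gh !mule0 adde0.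
Qed.

Lemma feq_cnorm f g n : fock_measurable f -> fock_measurable g ->
  feq f g -> cnorm f n = cnorm g n.
Proof.
move=> mf mg /fock_normsq_eq0/(_ n) fg.
exact: (eq_L2normsq_ae (@measurable_orthant R n) (mf n) (mg n) fg).
Qed.

Lemma feq_fock_normsq f g : fock_measurable f -> fock_measurable g ->
  feq f g -> fock_normsq f = fock_normsq g.
Proof. by move=> mf mg fg; apply: eq_fock_normsq => n; exact: feq_cnorm. Qed.

Lemma fock_dot_csum_to f g : in_fock f -> in_fock g ->
  csum_to (fun n => L2dot (leb n) (orth n) (f n) (g n))
    (polar (fock_normsq (f + g)) (fock_normsq (f - g))
      (fock_normsq (f + 'i *: g)) (fock_normsq (f - 'i *: g))).
Proof.
move=> hf hg; have [mf foo] := hf; have [mg goo] := hg.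
under eq_fun => n do rewrite (L2dot_polar (@measurable_orthant R n) (mf n) (mg n)
  (le_lt_trans (cnorm_le_fock_normsq f n) foo)
  (le_lt_trans (cnorm_le_fock_normsq g n) goo)).
apply: (csum_to_polar (a := fun n => cnorm (f + g) n) (b := fun n => cnorm (f - g) n)
  (c := fun n => cnorm (f + 'i *: g) n) (e := fun n => cnorm (f - 'i *: g) n)).
all: try by move=> n; exact: L2normsq_ge0.
- by case: (in_fockD hf hg).
- by case: (in_fockB hf hg).
- by case: (in_fockD hf (in_fockZ 'i hg)).
- by case: (in_fockB hf (in_fockZ 'i hg)).
Qed.

Lemma fock_dot_polar f g : in_fock f -> in_fock g ->
  fock_dot f g = polar (fock_normsq (f + g)) (fock_normsq (f - g))
      (fock_normsq (f + 'i *: g)) (fock_normsq (f - 'i *: g)).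
Proof. by move=> hf hg; exact: csum_toE (fock_dot_csum_to hf hg). Qed.

Lemma fock_dot_cvg f g : in_fock f -> in_fock g ->
  csum_to (fun n => L2dot (leb n) (orth n) (f n) (g n)) (fock_dot f g).
Proof. by move=> hf hg; rewrite (fock_dot_polar hf hg); exact: fock_dot_csum_to hf hg. Qed.

Lemma in_fock_cnorm f n : in_fock f -> (cnorm f n < +oo)%E.
Proof. by move=> [_ foo]; exact: le_lt_trans (cnorm_le_fock_normsq f n) foo. Qed.

Lemma fock_dot_lin k f g h : in_fock f -> in_fock g -> in_fock h ->
  fock_dot (k *: f + g) h = k * fock_dot f h + fock_dot g h.
Proof.
move=> hf hg hh; apply: csum_toE.
under eq_fun => n.
  rewrite (_ : L2dot _ _ _ _ = k * L2dot (leb n) (orth n) (f n) (h n) +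
    L2dot (leb n) (orth n) (g n) (h n)); first by over.
  have [_ <-] := cintegral_lin (@measurable_orthant R n) k
    (integrable_L2dot (@measurable_orthant R n) (in_fock_measurable hf n)
      (in_fock_measurable hh n) (in_fock_cnorm n hf) (in_fock_cnorm n hh))
    (integrable_L2dot (@measurable_orthant R n) (in_fock_measurable hg n)
      (in_fock_measurable hh n) (in_fock_cnorm n hg) (in_fock_cnorm n hh)).
  by apply: eq_cintegral => s _; rewrite mulrDl mulrA.
by apply: csum_to_lin; exact: fock_dot_cvg.
Qed.

Lemma polar_conj (a b c e : \bar R) : (polar a b c e)^* = polar a b e c.
Proof. by apply/eqP; rewrite eq_complex cReJ cImJ /= -mulrN opprB !eqxx. Qed.

(** Multiplication by ['i], of modulus one, carries [f - i g] to [g + i f]. This is what makes the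
    polarized inner product conjugate symmetric. *)
Lemma normsq_subiZ f g : fock_measurable f -> fock_measurable g ->
  fock_normsq (f - 'i *: g) = fock_normsq (g + 'i *: f).
Proof.
move=> mf mg; rewrite -[LHS]mul1e -cabs2_i -fock_normsqZ; last first.
  by apply: fock_measurableB => //; exact: fock_measurableZ.
by rewrite scalerBr scalerA mulii scaleN1r opprK addrC.
Qed.

Lemma fock_dotC f g : in_fock f -> in_fock g -> fock_dot g f = (fock_dot f g)^*.
Proof.
move=> hf hg; have [mf mg] := (in_fock_measurable hf, in_fock_measurable hg).
rewrite (fock_dot_polar hg hf) (fock_dot_polar hf hg) polar_conj (addrC g f).
by rewrite (fock_normsqBC g f) (normsq_subiZ mg mf) (normsq_subiZ mf mg).
Qed.

Lemma fock_dotD f g h : in_fock f -> in_fock g -> in_fock h ->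
  fock_dot (f + g) h = fock_dot f h + fock_dot g h.
Proof. by move=> hf hg hh; rewrite -[f in LHS]scale1r (fock_dot_lin 1 hf hg hh) mul1r. Qed.

Lemma fock_dot0 h : in_fock h -> fock_dot 0 h = 0.
Proof.
move=> hh; have := fock_dotD in_fock0 in_fock0 hh.
by rewrite addr0 => /eqP; rewrite -subr_eq0 opprD addNKr oppr_eq0 => /eqP.
Qed.

Lemma fock_dotZ k f h : in_fock f -> in_fock h ->
  fock_dot (k *: f) h = k * fock_dot f h.
Proof.
move=> hf hh; rewrite -[k *: f]addr0 (fock_dot_lin k hf in_fock0 hh).
by rewrite (fock_dot0 hh) addr0.
Qed.

Lemma fock_dotBr f g h : in_fock f -> in_fock g -> in_fock h ->
  fock_dot h (f - g) = fock_dot h f - fock_dot h g.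
Proof.
move=> hf hg hh.
rewrite (fock_dotC (in_fockB hf hg) hh) (fock_dotC hf hh) (fock_dotC hg hh).
by rewrite addrC -scaleN1r (fock_dot_lin _ hg hf hh) mulN1r addrC rmorphB.
Qed.

Lemma fock_dot_self f : in_fock f -> fock_dot f f = (fine (fock_normsq f))%:C.
Proof.
move=> hf; have mf := in_fock_measurable hf.
(* The imaginary part vanishes because [f + i f] and [f - i f] have the same norm; the real part is
   a quarter of the squared norm of [2 f]. *)
rewrite (fock_dot_polar hf hf) (normsq_subiZ mf mf) /polar subrr mulr0; congr (_ +i* _).
have two : (2 : R)%:C = 1 + 1.
  by apply/eqP; rewrite eq_complex /= addr0 !eqxx.
rewrite -[f + f](_ : (2 : R)%:C *: f = _); last by rewrite two scalerDl scale1r.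
rewrite (feq_refl f) subr0 (fock_normsqZ _ mf) cabs2_real.
rewrite fineM//; last by rewrite ge0_fin_numE ?fock_normsq_ge0//; case: hf.
by rewrite /= mulrA (_ : 4^-1 * 2 ^+ 2 = 1) ?mul1r//; field.
Qed.

(** Testing against [f - g] itself gives its squared norm. *)
Lemma feq_dot f g : in_fock f -> in_fock g ->
  (forall h, in_fock h -> fock_dot h f = fock_dot h g) -> feq f g.
Proof.
move=> hf hg fg; have hfg := in_fockB hf hg.
have := fock_dot_self hfg; rewrite (fock_dotBr hf hg hfg) (fg _ hfg) subrr => -[/esym/eqP].
rewrite fine_eq0; first by move=> /eqP.
by rewrite ge0_fin_numE ?fock_normsq_ge0//; case: hfg.
Qed.

Lemma feq_fock_dotl f g h : in_fock f -> in_fock g -> in_fock h ->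
  feq f g -> fock_dot f h = fock_dot g h.
Proof.
move=> hf hg hh fg; rewrite (fock_dot_polar hf hh) (fock_dot_polar hg hh).
have key u : in_fock u -> fock_normsq (f + u) = fock_normsq (g + u).
  move=> hu; apply: feq_fock_normsq; try
    by apply: fock_measurableD; exact: in_fock_measurable.
  by apply: feqD; try exact: in_fock_measurable; last exact: feq_refl.
have hi := in_fockZ 'i hh.
by rewrite (key _ hh) (key _ (in_fockN hh)) (key _ hi) (key _ (in_fockN hi)).
Qed.

Lemma feq_fock_dotr f g h : in_fock f -> in_fock g -> in_fock h ->
  feq f g -> fock_dot h f = fock_dot h g.
Proof.
by move=> hf hg hh fg; rewrite (fock_dotC hf hh) (feq_fock_dotl hf hg hh fg) -(fock_dotC hg hh).
Qed.

Lemma feq_lim (F : nat -> fock) f g :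
  (forall i, fock_measurable (F i)) -> fock_measurable f -> fock_measurable g ->
  (fun i => fock_normsq (F i - f)) @ \oo --> 0%E ->
  (fun i => fock_normsq (F i - g)) @ \oo --> 0%E -> feq f g.
Proof.
move=> mF mf mg Ff Fg; apply/eqP; rewrite eq_le fock_normsq_ge0 andbT.
have : (fun i => 2%:E * fock_normsq (F i - f)%R + 2%:E * fock_normsq (F i - g)%R)%E
    @ \oo --> (2%:E * 0 + 2%:E * 0)%E.
  have h1 := cvgeZl (isT : (2%:E : \bar R) \is a fin_num) Ff.
  have h2 := cvgeZl (isT : (2%:E : \bar R) \is a fin_num) Fg.
  by apply: (cvgeD _ h1 h2); rewrite !mule0.
rewrite !mule0 adde0 => lim0; apply: (cvge_ge _ lim0).
near=> i.
rewrite -(subrKA (F i)) (fock_normsqBC (F i) f).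
exact: (fock_normsqD_le (fock_measurableB mf (mF i)) (fock_measurableB (mF i) mg)).
Unshelve. all: by end_near. Qed.

(* The Fock space side of the involution of L^2(SC). *)
Definition flip (f : fock) : fock := fun n s => (f n [the n.-tuple RR of rev s])^*.

Lemma flipK : involutive flip.
Proof.
move=> f; apply: fockP => n s; rewrite /flip cJK; congr (f n).
by apply: val_inj; rewrite /= revK.
Qed.

Lemma flipD f g : flip (f + g) = flip f + flip g.
Proof. by apply: fockP => n s; exact: rmorphD. Qed.

Lemma flipB f g : flip (f - g) = flip f - flip g.
Proof. by apply: fockP => n s; exact: rmorphB. Qed.

Lemma flipZ k f : flip (k *: f) = k^* *: flip f.
Proof. by apply: fockP => n s; exact: rmorphM. Qed.

Lemma fock_measurable_flip f : fock_measurable f -> fock_measurable (flip f).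
Proof.
move=> mf n; apply: cmeasurableJ; have [fr fi] := mf n.
have h : set_fun (orth n) (orth n) (fun s : n.-tuple RR => [the n.-tuple RR of rev s]).
  by move=> s os; apply/orthant_rev.
have mr := measurable_funTS (D := orth n) (@measurable_rev_tuple R n).
have im : [set [the n.-tuple RR of rev s] | s in orth n] `<=` orth n.
  by move=> _ [s os <-]; exact: h.
split; first exact: (measurable_comp (@measurable_orthant R n) im fr mr).
exact: (measurable_comp (@measurable_orthant R n) im fi mr).
Qed.

Lemma cnorm_flip f n : fock_measurable f -> cnorm (flip f) n = cnorm f n.
Proof.
move=> mf; rewrite /L2normsq.
under eq_integral do rewrite cabs2J.
rewrite (integral_leb_rev (f := fun s => (cabs2 (f n s))%:E))//.
- exact: measurable_cabs2.
- by move=> s _; rewrite lee_fin cabs2_ge0.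
Qed.

Lemma fock_normsq_flip f : fock_measurable f ->
  fock_normsq (flip f) = fock_normsq f.
Proof. by move=> mf; apply: eq_fock_normsq => n; exact: cnorm_flip. Qed.

Lemma in_fock_flip f : in_fock f -> in_fock (flip f).
Proof.
by move=> [mf foo]; split; [exact: fock_measurable_flip|rewrite fock_normsq_flip].
Qed.

Lemma feq_flip f g : fock_measurable f -> fock_measurable g ->
  feq f g -> feq (flip f) (flip g).
Proof.
by move=> mf mg; rewrite /feq -flipB fock_normsq_flip//; exact: fock_measurableB.
Qed.

End fock_hilbert.

(** * Creation and annihilation *)

Section cauchy_schwarz.
Context d (T : measurableType d) (R : realType).
Variables (mu : {measure set T -> \bar R}) (D : set T).
Hypothesis mD : measurable D.
Implicit Types (h b : T -> R).

Lemma integrable_mul_sq h b : measurable_fun D h -> measurable_fun D b ->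
  mu.-integrable D (EFin \o (fun t => h t ^+ 2)) ->
  mu.-integrable D (EFin \o (fun t => b t ^+ 2)) ->
  mu.-integrable D (EFin \o (fun t => h t * b t)).
Proof.
move=> mh mb ih ib.
have ihb := (integrable_linB mD 1 1 ih ib).1.
apply: le_integrable ihb => //.
  by apply/measurable_EFinP; exact: measurable_funM.
move=> t _ /=; rewrite lee_fin !mul1r [leRHS]ger0_norm; last first.
  by rewrite addr_ge0 ?sqr_ge0.
rewrite ler_norml.
have := sqr_ge0 (h t - b t); have := sqr_ge0 (h t + b t).
by move=> *; apply/andP; split; nra.
Qed.

(* Cauchy-Schwarz with the constant weakened by 1, so that no case analysis  *)
(* is needed when [h] vanishes almost everywhere.                            *)
Lemma weak_cauchy_schwarz h b : measurable_fun D h -> measurable_fun D b ->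
  mu.-integrable D (EFin \o (fun t => h t ^+ 2)) ->
  mu.-integrable D (EFin \o (fun t => b t ^+ 2)) ->
  Rintegral mu D (fun t => h t * b t) ^+ 2 <=
  (Rintegral mu D (fun t => h t ^+ 2) + 1) * Rintegral mu D (fun t => b t ^+ 2).
Proof.
move=> mh mb ih ib; have ihb := integrable_mul_sq mh mb ih ib.
set I := Rintegral _ _ _; set A := Rintegral _ _ _; set B := Rintegral _ _ _.
have A0 : 0 <= A by apply: Rintegral_ge0 => t _; exact: sqr_ge0.
(* The integral of [(l h - b)^2] is nonnegative for every [l]. *)
have pos l : 0 <= l ^+ 2 * A + (- 2 * l) * I + B.
  have [i1 e1] := integrable_linB mD (l ^+ 2) (- 2 * l) ih ihb.
  have [_ e2] := integrable_linB mD 1 1 i1 ib.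
  rewrite -e1 -[X in X + _]mul1r -[X in _ + X]mul1r -e2.
  apply: Rintegral_ge0 => t _.
  rewrite (_ : _ + _ = (l * h t - b t) ^+ 2); last by ring.
  exact: sqr_ge0.
have C0 : 0 < A + 1 by rewrite ltr_wpDl.
have eC : I / (A + 1) * (A + 1) = I by rewrite divfK// gt_eqF.
(* This [l] minimizes the quadratic polynomial with [A + 1] in place of [A]; the value is legitimate
   because [A + 1] is positive. *)
move: (I / (A + 1)) eC (pos (I / (A + 1))) => l <- {}pos.
have lB : l ^+ 2 * (A + 1) <= B.
  have := sqr_ge0 l; move: pos; rewrite !expr2; nra.
by have := ler_wpM2l (ltW C0) lB; apply: le_trans; rewrite !expr2; nra.
Qed.

End cauchy_schwarz.

Section creation_annihilation.
Context {R : realType}.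
Local Notation RR := (measurableTypeR R).
Local Notation lam := (@lebesgue_measure R).
Local Notation halfline := (@halfline R).
Local Notation fock := (fock R).
Local Notation orth n := (@orthant R n).
Local Notation cnorm f n := (L2normsq (leb n) (orth n) (f n)).
Let mh := @measurable_halfline R.
Let mo n := @measurable_orthant R n.
Implicit Types (f g : fock) (h : @L2real R).

Definition cre h : fock -> fock := creation (fun t => (sval h t)%:C).

(** The annihilation operator: the first variable is integrated against [h], which is real and so
    needs no conjugate. It witnesses that [cre h] has an adjoint and, unlike the one selected by
    [adjoint], has known values at every point. *)
Definition ann h f : fock := fun n s =>
  cintegral lam halfline (fun t => (sval h t)%:C * f n.+1 (consT t s)).

Arguments cre h f : clear implicits.
Arguments ann h f : clear implicits.

Lemma L2real_integrable h : lam.-integrable halfline (EFin \o (fun t => sval h t ^+ 2)).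
Proof.
case: h => h [mh' hoo] /=; apply/integrableP; split.
  by apply/measurable_EFinP; exact: measurable_funX.
by under eq_integral do rewrite gee0_abs ?lee_fin ?sqr_ge0//.
Qed.

Lemma L2real_measurable h : measurable_fun halfline (sval h).
Proof. by case: h => h []. Qed.

Lemma L2real_cmeasurable h : cmeasurable halfline (fun t => (sval h t)%:C).
Proof. exact: cmeasurable_real (L2real_measurable h). Qed.

Lemma L2real_normsq h : (L2normsq lam halfline (fun t => (sval h t)%:C) < +oo)%E.
Proof.
case: h => h [mh' hoo]; rewrite /L2normsq /=;
by  under eq_integral do rewrite cabs2_real.
Qed.

Lemma measurable_head_comp n (v : RR -> R) : measurable_fun halfline v ->
  measurable_fun (orth n.+1) (fun s => v (thead s)).
Proof.
move=> mv; apply: (measurable_comp (F := halfline)) mv _ => //.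
- by move=> _ [s os <-]; exact: os.
- by apply: measurable_funTS; exact: measurable_tnth.
Qed.

Lemma measurable_behead_comp n (v : n.-tuple RR -> R) : measurable_fun (orth n) v ->
  measurable_fun (orth n.+1) (fun s : n.+1.-tuple RR => v [tuple of behead s]).
Proof.
move=> mv; apply: (measurable_comp (F := orth n)) mv _.
- exact: mo.
- move=> _ [s os <-]; case/tupleP: s os => t s os.
  rewrite (_ : [tuple of _] = s); last exact: val_inj.
  by have [] := (orthant_tcons t s).1 os.
- by apply: measurable_funTS; exact: measurable_behead.
Qed.

Lemma fock_measurable_cre h f : fock_measurable f -> fock_measurable (cre h f).
Proof.
move=> mf [|n]; first exact: cmeasurable_cst.
apply: cmeasurableM; split.
- exact: measurable_head_comp (L2real_measurable h).
- exact: measurable_cst.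
- by have [mr _] := mf n; exact: measurable_behead_comp mr.
- by have [_ mi] := mf n; exact: measurable_behead_comp mi.
Qed.

Lemma cre_tcons h f n t s : cre h f n.+1 (consT t s) = (sval h t)%:C * f n s.
Proof. by rewrite /cre /creation; congr (_ * f n _); apply: val_inj. Qed.

Lemma cnorm_cre h f n : fock_measurable f ->
  cnorm (cre h f) n.+1 =
  (L2normsq lam halfline (fun t => (sval h t)%:C) * cnorm f n)%E.
Proof.
move=> mf; rewrite /L2normsq integral_leb_cons; last 2 first.
- by apply: measurable_cabs2; exact: fock_measurable_cre.
- by move=> s _; rewrite lee_fin cabs2_ge0.
rewrite -ge0_integralZr//; last 3 first.
- exact: measurable_cabs2 (L2real_cmeasurable h).
- by move=> t _; rewrite lee_fin cabs2_ge0.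
- exact: L2normsq_ge0.
apply: eq_integral => t _.
transitivity (\int[leb n]_(s in orth n) ((cabs2 (sval h t)%:C)%:E * (cabs2 (f n s))%:E))%E.
  by apply: eq_integral => s _; rewrite cre_tcons cabs2M EFinM.
rewrite ge0_integralZl//.
- exact: mo.
- exact: measurable_cabs2 (mf n).
- by move=> s _; rewrite lee_fin cabs2_ge0.
- by rewrite lee_fin cabs2_ge0.
Qed.

Lemma in_fock_cre h f : in_fock f -> in_fock (cre h f).
Proof.
move=> [mf foo]; split; first exact: fock_measurable_cre.
rewrite /fock_normsq nneseries_recl//; last by move=> *; exact: L2normsq_ge0.
rewrite -(nneseries_addn 1); last by move=> *; exact: L2normsq_ge0.
rewrite [X in (X + _)%E](_ : _ = 0) ?add0e; last first.
  by rewrite /L2normsq; under eq_integral do rewrite cabs2_0; rewrite integral0.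
have Hfin : L2normsq lam halfline (fun t => (sval h t)%:C) \is a fin_num.
  by rewrite ge0_fin_numE ?L2normsq_ge0// L2real_normsq.
under eq_eseriesr do rewrite addn1 (cnorm_cre _ _ mf) -(fineK Hfin).
rewrite nneseriesZl; last by move=> *; exact: L2normsq_ge0.
by rewrite lte_mul_pinfty// lee_fin fine_ge0// L2normsq_ge0.
Qed.

(** [v] is only measurable, so Tonelli is applied separately to its positive and negative parts. *)
Lemma measurable_Rintegral_tail n (v : n.+1.-tuple RR -> R) :
  measurable_fun (orth n.+1) v ->
  measurable_fun (orth n)
    (fun s => Rintegral lam halfline (fun t => v (consT t s))).
Proof.
move=> mv; have mv' : measurable_fun (orth n.+1) (EFin \o v) by exact/measurable_EFinP.
apply: measurableT_comp; first exact: fine_measurable.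
under eq_fun do rewrite integralE.
apply: emeasurable_funB.
- have := @measurable_leb_tail R n _ (measurable_funepos mv')
    (fun s _ => funepos_ge0 _ s).
  apply: eq_measurable_fun => s _; apply: eq_integral => t _.
  by rewrite !funeposE.
- have := @measurable_leb_tail R n _ (measurable_funeneg mv')
    (fun s _ => funeneg_ge0 _ s).
  apply: eq_measurable_fun => s _; apply: eq_integral => t _.
  by rewrite !funenegE.
Qed.

Lemma fock_measurable_ann h f : fock_measurable f -> fock_measurable (ann h f).
Proof.
move=> mf n; have [fr fi] := mf n.+1.
have mht := measurable_head_comp (n := n) (L2real_measurable h).
split.
- have := measurable_Rintegral_tail (measurable_funM mht fr).
  apply: eq_measurable_fun => s _; apply: eq_Rintegral => t _.
  by rewrite cReM /= mul0r subr0.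
- have := measurable_Rintegral_tail (measurable_funM mht fi).
  apply: eq_measurable_fun => s _; apply: eq_Rintegral => t _.
  by rewrite cImM /= mul0r addr0.
Qed.

Lemma cmeasurable_tcons n (u : n.+1.-tuple RR -> R[i]) s :
  cmeasurable (orth n.+1) u -> orthant s ->
  cmeasurable halfline (fun t => u (consT t s)).
Proof.
move=> [ur ui] os.
have mt : measurable_fun halfline (fun t => consT t s).
  apply: measurable_funTS; apply: (measurableT_comp (@measurable_tcons R n)).
  exact: measurable_pair2.
have im : [set consT t s | t in halfline] `<=` orth n.+1.
  by move=> _ [t ht <-]; apply/orthant_tcons.
by split; [exact: (measurable_comp (@mo n.+1) im ur mt)|
  exact: (measurable_comp (@mo n.+1) im ui mt)].
Qed.

Lemma cabs2_ann_le h f n s : fock_measurable f -> orthant s ->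
  ((cabs2 (ann h f n s))%:E <=
  (Rintegral lam halfline (fun t => sval h t ^+ 2) + 1)%:E *
  \int[lam]_(t in halfline) (cabs2 (f n.+1 (consT t s)))%:E)%E.
Proof.
move=> mf os; set H := Rintegral _ _ _.
have H0 : 0 <= H by apply: Rintegral_ge0 => t _; exact: sqr_ge0.
have ms := cmeasurable_tcons (mf n.+1) os; have [mr mi] := ms.
have I0 : (0 <= \int[lam]_(t in halfline) (cabs2 (f n.+1 (consT t s)))%:E)%E.
  by apply: integral_ge0 => t _; rewrite lee_fin cabs2_ge0.
(* If the section is not square integrable the bound is [+oo], because the constant is at least 1
   and hence positive. Otherwise Cauchy-Schwarz applies to the real and imaginary parts. *)
have [->|] := eqVneq (\int[lam]_(t in halfline) (cabs2 (f n.+1 (consT t s)))%:E)%E +oo%E.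
  by rewrite gt0_muley ?leey// lte_fin ltr_wpDl.
rewrite -ltey => Ioo.
have ii : lam.-integrable halfline (EFin \o (fun t => cabs2 (f n.+1 (consT t s)))).
  apply/integrableP; split; first exact: measurable_cabs2.
  by under eq_integral do rewrite gee0_abs ?lee_fin ?cabs2_ge0//.
have ir : lam.-integrable halfline (EFin \o (fun t => complex.Re (f n.+1 (consT t s)) ^+ 2)).
  apply: le_integrable ii => //; first exact/measurable_EFinP/measurable_funX.
  by move=> t _; rewrite lee_fin !ger0_norm ?cabs2_ge0 ?sqr_ge0// lerDl sqr_ge0.
have iI : lam.-integrable halfline (EFin \o (fun t => complex.Im (f n.+1 (consT t s)) ^+ 2)).
  apply: le_integrable ii => //; first exact/measurable_EFinP/measurable_funX.
  by move=> t _; rewrite lee_fin !ger0_norm ?cabs2_ge0 ?sqr_ge0// lerDr sqr_ge0.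
have Cr := weak_cauchy_schwarz mh (L2real_measurable h) mr (L2real_integrable h) ir.
have Ci := weak_cauchy_schwarz mh (L2real_measurable h) mi (L2real_integrable h) iI.
rewrite -(fineK (x := (\int[lam]_(t in _) _)%E)) ?ge0_fin_numE// -EFinM lee_fin.
have -> : fine (\int[lam]_(t in halfline) (cabs2 (f n.+1 (consT t s)))%:E) =
  Rintegral lam halfline (fun t => complex.Re (f n.+1 (consT t s)) ^+ 2) +
  Rintegral lam halfline (fun t => complex.Im (f n.+1 (consT t s)) ^+ 2).
  by rewrite -RintegralD.
rewrite mulrDr {1}/cabs2 lerD//.
- apply: le_trans Cr; rewrite le_eqVlt; apply/orP; left; apply/eqP; congr (_ ^+ 2).
  by apply: eq_Rintegral => t _; rewrite cReM /= mul0r subr0.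
- apply: le_trans Ci; rewrite le_eqVlt; apply/orP; left; apply/eqP; congr (_ ^+ 2).
  by apply: eq_Rintegral => t _; rewrite cImM /= mul0r addr0.
Qed.

Lemma in_fock_ann h f : in_fock f -> in_fock (ann h f).
Proof.
move=> [mf foo]; split; first exact: fock_measurable_ann.
set C := Rintegral lam halfline (fun t => sval h t ^+ 2) + 1.
have C0 : 0 <= C by rewrite addr_ge0// Rintegral_ge0// => t _; exact: sqr_ge0.
(* The pointwise bound integrated over [s]: degree [n] of the image is controlled by degree [n.+1]
   of [f], with a constant independent of [n]. *)
have le1 n : (cnorm (ann h f) n <= C%:E * cnorm f n.+1)%E.
  have mf2 : measurable_fun (orth n.+1) (fun s => (cabs2 (f n.+1 s))%:E).
    exact: measurable_cabs2 (mf n.+1).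
  have f20 s : orth n.+1 s -> (0 <= (cabs2 (f n.+1 s))%:E)%E.
    by rewrite lee_fin cabs2_ge0.
  rewrite /L2normsq (integral_leb_cons_swap mf2 f20) -ge0_integralZl//.
  - apply: nonmeasurable_ge0_le_integral => s os; first by rewrite lee_fin cabs2_ge0.
    exact: cabs2_ann_le.
  - exact: mo.
  - exact: measurable_leb_tail mf2 f20.
  - by move=> s os; apply: integral_ge0 => t ht; rewrite lee_fin cabs2_ge0.
apply: (@le_lt_trans _ _ (\sum_(0 <= n <oo) C%:E * cnorm f n.+1)%E).
  by apply: lee_nneseries => n _; [move=> _; exact: L2normsq_ge0|exact: le1].
rewrite nneseriesZl; last by move=> *; exact: L2normsq_ge0.
rewrite lte_mul_pinfty//; apply: le_lt_trans foo.
rewrite /fock_normsq [leRHS]nneseries_recl//; last by move=> *; exact: L2normsq_ge0.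
rewrite -(nneseries_addn 1); last by move=> *; exact: L2normsq_ge0.
under [in leRHS]eq_eseriesr do rewrite addn1.
by rewrite leeDr// L2normsq_ge0.
Qed.

(** Both sides are polarized. Iterating the norms in [n.+1] variables reduces the claim to a fixed
    [s], where it compares the pairing of [h f(s)] and the section of [g] with the integral defining
    [ann]. *)
Lemma L2dot_cre h f g n : in_fock f -> in_fock g ->
  L2dot (leb n.+1) (orth n.+1) (cre h f n.+1) (g n.+1) =
  L2dot (leb n) (orth n) (f n) (ann h g n).
Proof.
move=> hf hg; have [mf mg] := (in_fock_measurable hf, in_fock_measurable hg).
have hl := in_fock_cre h hf.
rewrite (L2dot_polar (@mo n.+1) (in_fock_measurable hl n.+1) (mg n.+1)
  (in_fock_cnorm n.+1 hl) (in_fock_cnorm n.+1 hg)).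
have key u : in_fock u ->
  [/\ measurable_fun (orth n) (fun s => \int[lam]_(t in halfline)
        (cabs2 (u n.+1 (consT t s)))%:E)%E,
      forall s, orth n s -> (0 <= \int[lam]_(t in halfline)
        (cabs2 (u n.+1 (consT t s)))%:E)%E,
      cnorm u n.+1 = (\int[leb n]_(s in orth n) \int[lam]_(t in halfline)
        (cabs2 (u n.+1 (consT t s)))%:E)%E &
      (\int[leb n]_(s in orth n) \int[lam]_(t in halfline)
        (cabs2 (u n.+1 (consT t s)))%:E < +oo)%E].
  move=> hu.
  have mu2 : measurable_fun (orth n.+1) (fun s => (cabs2 (u n.+1 s))%:E).
    exact: measurable_cabs2 (in_fock_measurable hu n.+1).
  have u20 s : orth n.+1 s -> (0 <= (cabs2 (u n.+1 s))%:E)%E.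
    by rewrite lee_fin cabs2_ge0.
  have eu : cnorm u n.+1 = (\int[leb n]_(s in orth n) \int[lam]_(t in halfline)
        (cabs2 (u n.+1 (consT t s)))%:E)%E by rewrite /L2normsq integral_leb_cons_swap.
  split => //.
  - exact: measurable_leb_tail mu2 u20.
  - by move=> s _; apply: integral_ge0 => t _; rewrite lee_fin cabs2_ge0.
  - by rewrite -eu in_fock_cnorm.
have hig := in_fockZ 'i hg.
have [ma a0 ea aoo] := key _ (in_fockD hl hg).
have [mb b0 eb boo] := key _ (in_fockB hl hg).
have [mc c0 ec coo] := key _ (in_fockD hl hig).
have [me e0 ee eoo] := key _ (in_fockB hl hig).
rewrite [L2normsq _ _ _]ea [L2normsq _ _ _]eb [L2normsq _ _ _]ec [L2normsq _ _ _]ee.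
pose sec (u : fock) s := (\int[lam]_(t in halfline) (cabs2 (u n.+1 (consT t s)))%:E)%E.
suff H s : orth n s -> (sec (cre h f + g)%R s < +oo)%E ->
    (sec (cre h f - g)%R s < +oo)%E -> (sec (cre h f + 'i *: g)%R s < +oo)%E ->
    (sec (cre h f - 'i *: g)%R s < +oo)%E ->
    f n s * (ann h g n s)^* = polar (sec (cre h f + g) s) (sec (cre h f - g) s)
      (sec (cre h f + 'i *: g) s) (sec (cre h f - 'i *: g) s).
  exact: (esym (cintegral_polar (@mo n) ma mb mc me a0 b0 c0 e0 aoo boo coo eoo H)).
move=> os asoo _ _ _.
have mgs := cmeasurable_tcons (mg n.+1) os.
have mls : cmeasurable halfline (fun t => (sval h t)%:C * f n s).
  by apply: cmeasurableM; [exact: L2real_cmeasurable|exact: cmeasurable_cst].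
have lsoo : (L2normsq lam halfline (fun t => (sval h t)%:C * f n s)%R < +oo)%E.
  rewrite (eq_L2normsq lam (g := fun t => f n s * (sval h t)%:C)); last first.
    by move=> t _; rewrite mulrC.
  rewrite L2normsqZ//; last exact: L2real_cmeasurable.
  by rewrite lte_mul_pinfty ?L2real_normsq// lee_fin cabs2_ge0.
(* The section of [g] is that of [cre h f + g] minus [h f(s)], and both are square integrable. *)
have gsoo : (L2normsq lam halfline (fun t => g n.+1 (consT t s))%R < +oo)%E.
  have -> : (fun t => g n.+1 (consT t s)) = (fun t =>
      (cre h f + g) n.+1 (consT t s) + - ((sval h t)%:C * f n s)).
    by apply/funext => t; rewrite -cre_tcons addrAC [LHS](esym (add0r _)) subrr.
  apply: le_lt_trans (L2normsqD_le lam mh _ _) _.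
  - have ml := in_fock_measurable (in_fockD hl hg) n.+1.
    exact: (cmeasurable_tcons ml os).
  - exact: cmeasurableN.
  - rewrite L2normsqN lte_add_pinfty// lte_mul_pinfty//.
have ihg := integrable_L2dot mh mgs (L2real_cmeasurable h) gsoo (L2real_normsq h).
have e1 : L2dot lam halfline (fun t => (sval h t)%:C * f n s)
    (fun t => g n.+1 (consT t s)) = f n s * (ann h g n s)^*.
  have i2 : cintegrable lam halfline (fun t => (sval h t)%:C * g n.+1 (consT t s)).
    rewrite (_ : (fun t => _) = fun t => g n.+1 (consT t s) * ((sval h t)%:C)^*)//.
    by apply/funext => t; rewrite cJreal mulrC.
  rewrite -(cintegral_conj mh i2) -cintegralZ//.
    by apply: eq_cintegral => t _; rewrite cJM cJreal mulrA [f n s * _]mulrC.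
  have := integrable_L2dot mh (L2real_cmeasurable h) mgs (L2real_normsq h) gsoo.
  rewrite (_ : (fun t => _ * _) = fun t => ((sval h t)%:C * g n.+1 (consT t s))^*)//.
  by apply/funext => t; rewrite cJM cJreal.
rewrite -e1 (L2dot_polar mh mls mgs lsoo gsoo).
by congr polar; apply: eq_integral => t _; rewrite -cre_tcons.
Qed.

Lemma cre_adjoint h : is_adjoint (cre h) (ann h).
Proof.
move=> f g hf hg; split; [exact: in_fock_cre|exact: in_fock_ann|].
(* The degree 0 component of a created vector is zero, so the series on the left is the one on the
   right shifted by one. *)
apply: csum_toE; apply: csum_to_shift.
  rewrite /L2dot /cre /creation /cintegral /Rintegral.
  by under eq_integral do rewrite mul0r; rewrite integral0;
    under eq_integral do rewrite mul0r; rewrite integral0.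
under eq_fun do rewrite L2dot_cre//.
exact: fock_dot_cvg hf (in_fock_ann h hg).
Qed.

Lemma adjoint_cre h : is_adjoint (cre h) (adjoint (cre h)).
Proof. by apply: (@xgetPex _ _ [set Y | is_adjoint (cre h) Y]); exists (ann h); exact: cre_adjoint. Qed.

(** Adjoints are unique up to null sets, since all inner products with a fixed second vector
    determine a class. This is how the operator selected by [adjoint] is compared with [ann]. *)
Lemma is_adjoint_feq (X Y Y' : fock -> fock) f g : is_adjoint X Y -> is_adjoint X Y' ->
  in_fock f -> in_fock g -> feq f g -> feq (Y f) (Y' g).
Proof.
move=> XY XY' hf hg fg; apply: feq_dot.
- by have [] := XY _ _ hf hf.
- by have [] := XY' _ _ hg hg.
move=> u hu; have [hXu hYf <-] := XY _ _ hu hf; have [_ _ <-] := XY' _ _ hu hg.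
exact: feq_fock_dotr.
Qed.

End creation_annihilation.

Arguments cre {R} h f _ _.
Arguments ann {R} h f _ _.

(** * Polynomial vectors *)

Section algebraic_fock.
Context {R : realType}.
Local Notation RR := (measurableTypeR R).
Local Notation lam := (@lebesgue_measure R).
Local Notation halfline := (@halfline R).
Local Notation fock := (fock R).
Local Notation orth n := (@orthant R n).
Local Notation cnorm f n := (L2normsq (leb n) (orth n) (f n)).
Local Notation vac := (@vacuum R).
Local Notation scalg := (@scalg R).
Let mh := @measurable_halfline R.
Implicit Types (f g : fock) (h k a : @L2real R) (c : R[i]) (A B : scalg).

(** The elementary tensor of the functions in [w]; see [wordE]. *)
Definition word (w : seq (@L2real R)) : fock := foldr cre vac w.

Arguments word w : simpl never, clear implicits.

Definition ip h a : R[i] :=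
  cintegral lam halfline (fun t => (sval h t)%:C * (sval a t)%:C).

Lemma ipC h a : ip h a = ip a h.
Proof. by apply: eq_cintegral => t _; rewrite mulrC. Qed.

Lemma cintegrable_ip h a :
  cintegrable lam halfline (fun t => (sval h t)%:C * (sval a t)%:C).
Proof.
have := integrable_L2dot mh (L2real_cmeasurable h) (L2real_cmeasurable a)
  (L2real_normsq h) (L2real_normsq a).
by rewrite (_ : (fun t => _ * _) = fun t => (sval h t)%:C * (sval a t)%:C)//;
  apply/funext => t; rewrite cJreal.
Qed.

Lemma conj_ip h a : (ip h a)^* = ip h a.
Proof.
rewrite -(cintegral_conj mh (cintegrable_ip h a)).
by apply: eq_cintegral => t _; rewrite cJM !cJreal.
Qed.

Lemma cre_lin h c f g : cre h (c *: f + g) = c *: cre h f + cre h g.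
Proof.
apply: fockP => -[|n] s.
  by rewrite [LHS](_ : _ = 0)// [RHS](_ : _ = c * 0 + 0)// mulr0 addr0.
by rewrite /cre /creation [LHS]mulrDr mulrCA.
Qed.

Lemma ann_vacuum h : ann h vac = 0.
Proof.
apply: fockP => n s; rewrite /ann /vacuum /=.
rewrite (eq_cintegral lam (v := fun=> 0)); last by move=> t _; rewrite mulr0.
by rewrite /cintegral /Rintegral /= integral0.
Qed.

Lemma ann_cre h a f : ann h (cre a f) = ip h a *: f.
Proof.
apply: fockP => n s; rewrite /ann.
rewrite (eq_cintegral lam (v := fun t => f n s * ((sval h t)%:C * (sval a t)%:C))).
  by rewrite (cintegralZ mh _ (cintegrable_ip h a)) mulrC.
by move=> t _; rewrite cre_tcons mulrA mulrC.
Qed.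

(** Integrability at every [s], and not merely at almost every [s]: it makes [ann h] linear as an
    identity between functions. *)
Definition annihilable f := forall h n (s : n.-tuple RR),
  cintegrable lam halfline (fun t => (sval h t)%:C * f n.+1 (consT t s)).

Lemma annihilable_word w : annihilable (word w).
Proof.
move=> h n s; case: w => [|a w].
  rewrite (_ : (fun t => _) = fun=> 0); last by apply/funext => t; rewrite mulr0.
  by split; exact: integrable0.
have i0 : cintegrable lam halfline (fun=> 0 : R[i]) by split; exact: integrable0.
have [+ _] := cintegral_lin mh (word w n s) (cintegrable_ip h a) i0.
rewrite (_ : (fun t => _) =
  fun t => (sval h t)%:C * cre a (word w) n.+1 (consT t s))//.
by apply/funext => t; rewrite addr0 cre_tcons mulrCA [word w n s * _]mulrC.
Qed.

Lemma annihilable_lin c f g :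
  annihilable f -> annihilable g -> annihilable (c *: f + g).
Proof.
move=> af ag h n s; have [+ _] := cintegral_lin mh c (af h n s) (ag h n s).
rewrite (_ : (fun t => _) =
  fun t => (sval h t)%:C * (c *: f + g) n.+1 (consT t s))//.
by apply/funext => t; rewrite [RHS]mulrDr mulrCA.
Qed.

Lemma ann_lin h c f g : annihilable f -> annihilable g ->
  ann h (c *: f + g) = c *: ann h f + ann h g.
Proof.
move=> af ag; apply: fockP => n s.
have [_ E] := cintegral_lin mh c (af h n s) (ag h n s); apply: etrans E.
by apply: eq_cintegral => t _; rewrite [LHS]mulrDr mulrCA.
Qed.

(** The linear span of the elementary tensors. It is stable under left and right multiplications,
    slices and [flip], so the pointwise computations never leave it. *)
Inductive alg : fock -> Prop :=
| alg0 : alg 0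
| alg_cons c w f : alg f -> alg (c *: word w + f).

Lemma algD f g : alg f -> alg g -> alg (f + g).
Proof.
elim=> [|c w {}f _ IH] hg; first by rewrite add0r.
by rewrite -addrA; apply: alg_cons; exact: IH.
Qed.

Lemma algZ c f : alg f -> alg (c *: f).
Proof.
elim=> [|b w {}f _ IH]; first by rewrite scaler0; exact: alg0.
by rewrite scalerDr scalerA; exact: alg_cons.
Qed.

Lemma alg_lin c f g : alg f -> alg g -> alg (c *: f + g).
Proof. by move=> hf hg; apply: algD => //; exact: algZ. Qed.

Lemma alg_word w : alg (word w).
Proof.
by rewrite -[word w]scale1r -[_ *: _]addr0; apply: alg_cons; exact: alg0.
Qed.

Lemma alg_sum I (r : seq I) (F : I -> fock) :
  (forall i, alg (F i)) -> alg (\sum_(i <- r) F i).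
Proof.
move=> hF; elim: r => [|i r IH]; rewrite ?big_nil ?big_cons; first exact: alg0.
exact: algD.
Qed.

Lemma in_fock_word w : in_fock (word w).
Proof. by elim: w => [|h w IH]; [exact: in_fock_vacuum|exact: in_fock_cre]. Qed.

Lemma in_fock_alg f : alg f -> in_fock f.
Proof.
elim=> [|c w {}f _ IH]; first exact: in_fock0.
exact: in_fockD (in_fockZ c (in_fock_word w)) IH.
Qed.

Lemma alg_annihilable f : alg f -> annihilable f.
Proof.
elim=> [|c w {}f _ IH]; last exact: annihilable_lin (annihilable_word w) IH.
have := annihilable_lin (-1) (annihilable_word [::]) (annihilable_word [::]).
by rewrite scaleN1r addNr.
Qed.

Definition gen h f : fock := cre h f + ann h f.

Arguments gen h f : simpl never, clear implicits.

Lemma gen_lin h c f g : alg f -> alg g ->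
  gen h (c *: f + g) = c *: gen h f + gen h g.
Proof.
move=> /alg_annihilable hf /alg_annihilable hg.
by rewrite /gen cre_lin (ann_lin h c hf hg) scalerDr addrACA.
Qed.

Lemma gen_nil h : gen h (word [::]) = word [:: h].
Proof. by rewrite /gen [word [::]]/(vac) ann_vacuum addr0. Qed.

Lemma gen_cons h a w :
  gen h (word (a :: w)) = word [:: h, a & w] + ip h a *: word w.
Proof. by rewrite /gen [word (a :: w)]/(cre a (word w)) ann_cre. Qed.

Lemma alg_gen_word h w : alg (gen h (word w)).
Proof.
case: w => [|a w]; first by rewrite gen_nil; exact: alg_word.
by rewrite gen_cons; apply: algD; [|apply: algZ]; exact: alg_word.
Qed.

Lemma gen0 h : gen h 0 = 0.
Proof.
have := gen_lin h 1 alg0 alg0; rewrite !scale1r addr0 => /eqP.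
by rewrite -subr_eq0 opprD addNKr oppr_eq0 => /eqP.
Qed.

Lemma alg_gen h f : alg f -> alg (gen h f).
Proof.
elim=> [|c w {}f hf IH]; first by rewrite gen0; exact: alg0.
rewrite gen_lin//; last exact: alg_word.
by apply: alg_lin => //; exact: alg_gen_word.
Qed.

(* [op A], with the adjoint of the creation operator replaced by [ann]. On   *)
(* [alg] it is linear pointwise, and not only almost everywhere.             *)
Fixpoint sem A : fock -> fock :=
  match A with
  | SCone => id
  | SCgen h => gen h
  | SCadd A B => fun f => sem A f + sem B f
  | SCscale c A => fun f => c *: sem A f
  | SCmul A B => fun f => sem A (sem B f)
  end.

Arguments sem A f : clear implicits.

Lemma alg_sem A f : alg f -> alg (sem A f).
Proof.
elim: A f => [|h|A IA B IB|c A IA|A IA B IB] f hf //=.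
- exact: alg_gen.
- by apply: algD; [exact: IA|exact: IB].
- by apply: algZ; exact: IA.
- by apply: IA; exact: IB.
Qed.

Lemma sem_lin A c f g : alg f -> alg g ->
  sem A (c *: f + g) = c *: sem A f + sem A g.
Proof.
elim: A f g => [|h|A IA B IB|b A IA|A IA B IB] f g hf hg //=.
- exact: gen_lin.
- by rewrite IA// IB// scalerDr addrACA.
- by rewrite IA// scalerDr !scalerA mulrC.
- by rewrite IB// IA//; exact: alg_sem.
Qed.

Lemma semD A f g : alg f -> alg g -> sem A (f + g) = sem A f + sem A g.
Proof. by move=> hf hg; rewrite -[f in LHS]scale1r sem_lin// scale1r. Qed.

Lemma sem0 A : sem A 0 = 0.
Proof.
have := semD A alg0 alg0; rewrite addr0 => /eqP.
by rewrite -subr_eq0 opprD addNKr oppr_eq0 => /eqP.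
Qed.

Lemma semZ A c f : alg f -> sem A (c *: f) = c *: sem A f.
Proof. by move=> hf; rewrite -[c *: f]addr0 (sem_lin A c hf alg0) sem0 addr0. Qed.

Lemma sem_sum A I (r : seq I) (F : I -> fock) : (forall i, alg (F i)) ->
  sem A (\sum_(i <- r) F i) = \sum_(i <- r) sem A (F i).
Proof.
move=> hF; elim: r => [|i r IH]; first by rewrite !big_nil sem0.
by rewrite !big_cons semD ?IH//; exact: alg_sum.
Qed.

(** A left operator works on the front variables. With the last [n.+1] of them frozen as [(t, u)],
    the others form a Fock vector on which it still acts, except that a creation operator may fill
    the slot [t]; these exceptions build up the gradient. *)
Definition slice f n (t : RR) (u : n.-tuple RR) : fock := fun m s =>
  f (m + n.+1)%N [the (m + n.+1).-tuple RR of s ++ consT t u].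

Arguments slice f n t u : clear implicits.

Lemma slice_lin c f g n t (u : n.-tuple RR) :
  slice (c *: f + g) n t u = c *: slice f n t u + slice g n t u.
Proof. by []. Qed.

Lemma slice_vacuum n t (u : n.-tuple RR) : slice vac n t u = 0.
Proof. by apply: fockP => m s; rewrite /slice /vacuum addnS. Qed.

(** When no variable precedes [t], the created variable is [t] itself: this yields the vacuum term
    with coefficient [h(t)]. *)
Lemma slice_cre h f n t (u : n.-tuple RR) : slice (cre h f) n t u =
  ((sval h t)%:C * f n u) *: vac + cre h (slice f n t u).
Proof.
apply: fockP => -[|m] s; rewrite /slice.
  transitivity (cre h f n.+1 (consT t u)).
    by congr (cre h f n.+1 _); apply: val_inj; rewrite (tuple0 s).
  by rewrite cre_tcons [RHS](_ : _ = (sval h t)%:C * f n u * 1 + 0)// mulr1 addr0.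
case/tupleP: s => r s.
transitivity (cre h f (m + n.+1).+1
    (consT r [the (m + n.+1).-tuple RR of s ++ consT t u])).
  by congr (cre h f (m + n.+1).+1 _); exact: val_inj.
rewrite [LHS]cre_tcons [RHS](_ : _ = (sval h t)%:C * f n u * 0 +
  cre h (slice f n t u) m.+1 (consT r s)); first by rewrite mulr0 add0r cre_tcons.
by congr (_ * _ + cre _ _ _ _); exact: val_inj.
Qed.

Lemma slice_ann h f n t (u : n.-tuple RR) :
  slice (ann h f) n t u = ann h (slice f n t u).
Proof.
apply: fockP => m s; apply: eq_cintegral => r _.
by congr (_ * f _ _); exact: val_inj.
Qed.

Lemma slice_gen h f n t (u : n.-tuple RR) : slice (gen h f) n t u =
  ((sval h t)%:C * f n u) *: vac + gen h (slice f n t u).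
Proof.
rewrite [LHS](_ : _ = slice (cre h f) n t u + slice (ann h f) n t u)//.
by rewrite slice_cre slice_ann -addrA.
Qed.

Lemma alg_slice_word w n t (u : n.-tuple RR) : alg (slice (word w) n t u).
Proof.
elim: w => [|h w IH]; first by rewrite slice_vacuum; exact: alg0.
rewrite [word _]/(cre h (word w)) slice_cre.
apply: alg_lin; first exact: (alg_word [::]).
elim: IH => [|c v f _ IH].
  have := cre_lin h 1 0 0; rewrite !scale1r addr0 => /eqP.
  by rewrite -subr_eq0 opprD addNKr oppr_eq0 => /eqP ->; exact: alg0.
by rewrite cre_lin; apply: alg_lin => //; exact: (alg_word (h :: v)).
Qed.

Lemma alg_slice f n t (u : n.-tuple RR) : alg f -> alg (slice f n t u).
Proof.
elim=> [|c w {}f _ IH]; last first.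
  by rewrite slice_lin; apply: alg_lin => //; exact: alg_slice_word.
by rewrite (_ : slice 0 n t u = 0)//; exact: alg0.
Qed.

(** The Leibniz rule, for every [f] so that products can be treated: for [SCmul A B], the rule for
    [A] at [sem B f] produces the [ract] part, and the rule for [B], pushed through [sem A],
    produces the [lact] part. *)
Lemma slice_sem A f n t (u : n.-tuple RR) : alg f ->
  slice (sem A f) n t u =
  \sum_(p <- grad A) ((sval p.1.1 t)%:C * sem p.2 f n u) *: sem p.1.2 vac +
  sem A (slice f n t u).
Proof.
have avac : alg vac by exact: (alg_word [::]).
elim: A f => [|h|A IA B IB|c A IA|A IA B IB] f hf /=.
- by rewrite big_nil add0r.
- by rewrite big_seq1 slice_gen.
- rewrite [LHS](_ : _ = slice (sem A f) n t u + slice (sem B f) n t u)//.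
  by rewrite big_cat /= IA// IB// addrACA.
- rewrite [LHS](_ : _ = c *: slice (sem A f) n t u)// IA// scalerDr; congr (_ + _).
  rewrite big_map scaler_sumr; apply: eq_bigr => p _ /=.
  by rewrite !scalerA mulrC.
- rewrite IA ?IB//; last exact: alg_sem.
  rewrite semD; last 2 first.
  + by apply: alg_sum => p; apply: algZ; exact: alg_sem.
  + by apply: alg_sem; exact: alg_slice.
  rewrite addrA big_cat /= !big_map; congr (_ + _).
  rewrite addrC; congr (_ + _); rewrite sem_sum; last first.
    by move=> p; apply: algZ; exact: alg_sem.
  by apply: eq_bigr => p _; rewrite semZ//; exact: alg_sem.
Qed.

Lemma sem_grad A m n (s : m.-tuple RR) t (u : n.-tuple RR) :
  sem A vac (m + n.+1)%N [the (m + n.+1).-tuple RR of s ++ consT t u] =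
  \sum_(p <- grad A) (sval p.1.1 t)%:C * (sem p.1.2 vac m s * sem p.2 vac n u).
Proof.
have avac : alg vac by exact: (alg_word [::]).
rewrite -[LHS]/(slice (sem A vac) n t u m s) (slice_sem A t u avac) slice_vacuum sem0.
rewrite addr0 fock_sumE; apply: eq_bigr => p _.
by rewrite -[LHS]/(_ * _) -mulrA [sem p.1.2 vac m s * _]mulrC.
Qed.

Lemma wordE w n (s : n.-tuple RR) : word w n s =
  if size w == n then \prod_(p <- zip w s) (sval p.1 p.2)%:C else 0.
Proof.
elim: w n s => [|h w IH] [|n] s //=; first by rewrite (tuple0 s) big_nil.
case/tupleP: s => t s.
rewrite -[LHS]/(cre h (word w) n.+1 (consT t s)) cre_tcons IH eqSS.
by case: ifP; rewrite ?mulr0// big_cons.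
Qed.

Lemma flip_word w : flip (word w) = word (rev w).
Proof.
apply: fockP => n s; rewrite /flip !wordE size_rev.
case: eqVneq => [e|_]; last by rewrite rmorph0.
rewrite rmorph_prod (eq_bigr (fun p => (sval p.1 p.2)%:C)); last first.
  by move=> p _; exact: cJreal.
have -> : zip (rev w) s = rev (zip w (rev s)).
  by rewrite rev_zip ?revK// size_rev size_tuple.
by rewrite [RHS]big_rev.
Qed.

Lemma alg_flip f : alg f -> alg (flip f).
Proof.
elim=> [|c w {}f _ IH].
  rewrite (_ : flip 0 = 0); first exact: alg0.
  by apply: fockP => n s; exact: rmorph0.
by rewrite flipD flipZ flip_word; exact: alg_cons.
Qed.

Lemma flip_vacuum : flip vac = vac.
Proof. exact: (flip_word [::]). Qed.

(* The right semicircular operator. *)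
Definition rgen h f : fock := flip (gen h (flip f)).

Lemma rgen_lin h c f g : alg f -> alg g ->
  rgen h (c *: f + g) = c *: rgen h f + rgen h g.
Proof.
move=> hf hg; rewrite /rgen (flipD (c *: f)) flipZ.
rewrite (gen_lin h c^* (alg_flip hf) (alg_flip hg)).
by rewrite (flipD (c^* *: _)) flipZ cJK.
Qed.

Lemma alg_rgen h f : alg f -> alg (rgen h f).
Proof. by move=> hf; apply/alg_flip/alg_gen/alg_flip. Qed.

Lemma rgen_nil h : rgen h (word [::]) = word [:: h].
Proof. by rewrite /rgen flip_word gen_nil flip_word. Qed.

Lemma rgen_rcons h w a : rgen h (word (rcons w a)) =
  word (rcons (rcons w a) h) + ip h a *: word w.
Proof.
rewrite /rgen flip_word rev_rcons gen_cons flipD flipZ conj_ip !flip_word.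
by rewrite !rev_cons !revK.
Qed.

(* Left and right multiplications commute: the reason why [tau] is a trace. *)
Lemma gen_rgen_word h k w :
  gen h (rgen k (word w)) = rgen k (gen h (word w)).
Proof.
have avac := alg_word [::].
(* In length 0 each operator may annihilate what the other one created, and the scalars agree by
   symmetry of [ip]. In length 1 both may annihilate the same letter. From length 2 on they act on
   different letters. *)
case: w => [|a w].
  rewrite rgen_nil !gen_nil gen_cons -[[:: h]]/(rcons [::] h) rgen_rcons.
  by rewrite (ipC k).
case/lastP: w => [|w b].
  rewrite -{1}[[:: a]]/(rcons [::] a) rgen_rcons /= gen_cons.
  rewrite [in LHS]addrC (gen_lin h (ip k a) avac) ?gen_nil; last exact: alg_word.
  rewrite gen_cons [in RHS]addrC (rgen_lin k (ip h a) avac) ?rgen_nil; last exact: alg_word.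
  rewrite -[[:: h; a]]/(rcons [:: h] a) rgen_rcons /=.
  by rewrite addrCA [RHS]addrCA; congr (_ + _); rewrite addrC.
rewrite -rcons_cons rgen_rcons !rcons_cons gen_cons.
rewrite addrC (gen_lin h _ (alg_word _) (alg_word _)) !gen_cons.
rewrite [in RHS]addrC (rgen_lin k _ (alg_word _) (alg_word _)).
rewrite -!rcons_cons !rgen_rcons !scalerDr !scalerA !rcons_cons.
rewrite [ip h a * _]mulrC -!addrA [RHS]addrC -!addrA addrCA; congr (_ + _).
by rewrite addrCA.
Qed.

Lemma rgen0 k : rgen k 0 = 0.
Proof.
have := rgen_lin k 1 alg0 alg0; rewrite !scale1r addr0 => /eqP.
by rewrite -subr_eq0 opprD addNKr oppr_eq0 => /eqP.
Qed.

Lemma gen_rgen h k f : alg f -> gen h (rgen k f) = rgen k (gen h f).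
Proof.
elim=> [|c w {}f hf IH]; first by rewrite rgen0 gen0 rgen0.
have aw := alg_word w.
rewrite (rgen_lin k c aw hf) (gen_lin h c (alg_rgen k aw) (alg_rgen k hf)).
rewrite (gen_lin h c aw hf) (rgen_lin k c (alg_gen h aw) (alg_gen h hf)).
by rewrite gen_rgen_word IH.
Qed.

Lemma sem_rgen A k f : alg f -> sem A (rgen k f) = rgen k (sem A f).
Proof.
elim: A f => [|h|A IA B IB|c A IA|A IA B IB] f hf //=.
- exact: gen_rgen.
- rewrite IA// IB// -[sem A f in RHS]scale1r.
  by rewrite (rgen_lin k 1 (alg_sem A hf) (alg_sem B hf)) scale1r.
- rewrite IA// -[c *: sem A f]addr0 (rgen_lin k c (alg_sem A hf) alg0).
  by rewrite rgen0 addr0.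
- by rewrite IB// IA//; exact: alg_sem.
Qed.

(** Conjugating [sem B] by [flip] gives a right multiplication. Induction on [B] extends the
    commutation with left multiplications from the generators, where it is [sem_rgen]. *)
Lemma sem_flip_sem A B f : alg f ->
  sem A (flip (sem B (flip f))) = flip (sem B (flip (sem A f))).
Proof.
elim: B f => [|h|B IB C IC|c B IB|B IB C IC] f hf /=.
- by rewrite !flipK.
- exact: sem_rgen.
- rewrite !flipD semD ?IB ?IC//; apply/alg_flip/alg_sem; exact: alg_flip.
- rewrite !flipZ semZ ?IB//; apply/alg_flip/alg_sem; exact: alg_flip.
- have aC : alg (flip (sem C (flip f))) by apply/alg_flip/alg_sem/alg_flip.
  by rewrite -{1}[sem C _]flipK IB// IC// flipK.
Qed.

Fixpoint adj A : scalg :=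
  match A with
  | SCone => SCone
  | SCgen h => SCgen h
  | SCadd A B => SCadd (adj A) (adj B)
  | SCscale c A => SCscale c^* (adj A)
  | SCmul A B => SCmul (adj B) (adj A)
  end.

(** In a product, the adjoint of [B] is applied to [flip (sem A vac)], that is, to a right
    multiplication applied to the vacuum. Commuting the two lets the adjoint of [B] meet the vacuum
    first, where the induction hypothesis applies. *)
Lemma sem_adj_vacuum A : sem (adj A) vac = flip (sem A vac).
Proof.
have avac : alg vac by exact: (alg_word [::]).
elim: A => [|h|A IA B IB|c A IA|A IA B IB] /=.
- by rewrite flip_vacuum.
- by rewrite [vac]/(word [::]) gen_nil flip_word.
- by rewrite IA IB flipD.
- by rewrite IA flipZ.
- rewrite IA -{1}flip_vacuum sem_flip_sem// IB.
  by rewrite flipK.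
Qed.

Lemma fock_dotDr f g (u : fock) : in_fock f -> in_fock g -> in_fock u ->
  fock_dot u (f + g) = fock_dot u f + fock_dot u g.
Proof.
move=> hf hg hu; rewrite (fock_dotC (in_fockD hf hg) hu) (fock_dotD hf hg hu).
by rewrite rmorphD (fock_dotC hf hu) (fock_dotC hg hu).
Qed.

(** [is_adjoint] includes the stability of the Fock space under both operators, so this induction
    also yields [in_fock_op]. *)
Lemma op_adjoint A : is_adjoint (op A) (op (adj A)).
Proof.
elim: A => [|h|A IA B IB|c A IA|A IA B IB] f g hf hg.
- by split.
- have [hLf _ _] := @cre_adjoint R h _ _ hf hf; have [hLg _ _] := @cre_adjoint R h _ _ hg hg.
  have [_ hYg e1] := @adjoint_cre R h _ _ hf hg; have [_ hYf e2] := @adjoint_cre R h _ _ hg hf.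
  split; [exact: in_fockD hLf hYf|exact: in_fockD hLg hYg|].
  rewrite [LHS](fock_dotD hLf hYf hg) [RHS](fock_dotDr hLg hYg hf) addrC.
  congr (_ + _); last exact: e1.
  by rewrite (fock_dotC hg hYf) -e2 -(fock_dotC hLg hf).
- have [hAf hAg e1] := IA _ _ hf hg; have [hBf hBg e2] := IB _ _ hf hg.
  split; [exact: in_fockD hAf hBf|exact: in_fockD hAg hBg|].
  by rewrite [LHS](fock_dotD hAf hBf hg) [RHS](fock_dotDr hAg hBg hf) e1 e2.
- have [hAf hAg e1] := IA _ _ hf hg.
  split; [exact (in_fockZ c hAf)|exact (in_fockZ c^* hAg)|].
  rewrite [LHS](fock_dotZ c hAf hg) e1 [RHS](fock_dotC (in_fockZ c^* hAg) hf).
  by rewrite (fock_dotZ c^* hAg hf) cJM cJK -(fock_dotC hAg hf).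
- have [hBf _ _] := IB _ _ hf hf; have [_ hAg _] := IA _ _ hg hg.
  have [hABf _ e1] := IA _ _ hBf hg; have [_ hBAg e2] := IB _ _ hf hAg.
  split; [exact: hABf|exact: hBAg|exact: (etrans e1 e2)].
Qed.

Lemma in_fock_op A f : in_fock f -> in_fock (op A f).
Proof. by move=> hf; have [] := @op_adjoint A _ _ hf hf. Qed.

Lemma in_fock_vec A : in_fock (vec A).
Proof. exact: in_fock_op in_fock_vacuum. Qed.

Lemma feq_cre h f g : in_fock f -> in_fock g -> feq f g -> feq (cre h f) (cre h g).
Proof.
move=> hf hg fg; apply: feq_dot (in_fock_cre h hf) (in_fock_cre h hg) _ => u hu.
have [hLf hYu e1] := @adjoint_cre R h _ _ hf hu; have [hLg _ e2] := @adjoint_cre R h _ _ hg hu.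
rewrite (fock_dotC hLf hu) (fock_dotC hLg hu) e1 e2.
by rewrite (feq_fock_dotl hf hg hYu fg).
Qed.

(** The two arguments may differ on a null set, because in a product the inner factor is already
    known only up to [feq]. *)
Lemma op_sem A f g : in_fock f -> alg g -> feq f g -> feq (op A f) (sem A g).
Proof.
have mea := @in_fock_measurable R.
elim: A f g => [|h|A IA B IB|c A IA|A IA B IB] f g hf ag fg.
- exact: fg.
- have hg := in_fock_alg ag.
  have [hLf hYf _] := @adjoint_cre R h _ _ hf hf.
  exact (feqD (mea _ hLf) (mea _ (in_fock_cre h hg)) (mea _ hYf)
    (mea _ (in_fock_ann h hg)) (feq_cre h hf hg fg)
    (is_adjoint_feq (@adjoint_cre R h) (@cre_adjoint R h) hf hg fg)).
- exact (feqD (mea _ (in_fock_op A hf)) (mea _ (in_fock_alg (alg_sem A ag)))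
    (mea _ (in_fock_op B hf)) (mea _ (in_fock_alg (alg_sem B ag)))
    (IA _ _ hf ag fg) (IB _ _ hf ag fg)).
- exact (feqZ c (mea _ (in_fock_op A hf)) (mea _ (in_fock_alg (alg_sem A ag)))
    (IA _ _ hf ag fg)).
- exact (IA _ _ (in_fock_op B hf) (alg_sem B ag) (IB _ _ hf ag fg)).
Qed.

Lemma vec_sem A : feq (vec A) (sem A vac).
Proof. exact: op_sem in_fock_vacuum (alg_word [::]) (feq_refl _). Qed.

Lemma in_fock_sem_vacuum A : in_fock (sem A vac).
Proof. exact: in_fock_alg (alg_sem A (alg_word [::])). Qed.

Lemma vec_adj A B : is_adjoint (op A) (op B) -> feq (vec B) (flip (vec A)).
Proof.
move=> AB; have mea := @in_fock_measurable R.
have hs C := in_fock_sem_vacuum C.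
have e1 : feq (vec B) (vec (adj A)).
  exact: is_adjoint_feq AB (@op_adjoint A) in_fock_vacuum in_fock_vacuum (feq_refl _).
have e2 := vec_sem (adj A); rewrite sem_adj_vacuum in e2.
have e3 := feq_flip (mea _ (hs A)) (mea _ (in_fock_vec A)) (feq_sym (vec_sem A)).
have hf := in_fock_flip (hs A).
have e4 := feq_trans (mea _ (in_fock_vec (adj A))) (mea _ hf)
  (mea _ (in_fock_flip (in_fock_vec A))) e2 e3.
exact: feq_trans (mea _ (in_fock_vec B)) (mea _ (in_fock_vec (adj A)))
  (mea _ (in_fock_flip (in_fock_vec A))) e1 e4.
Qed.

End algebraic_fock.

Arguments slice {R} f n t u _ _.
Arguments sem {R} A f _ _.

(** * The involution and the gradient *)

Section star_nabla.
Context {R : realType}.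
Local Notation RR := (measurableTypeR R).
Local Notation lam := (@lebesgue_measure R).
Local Notation halfline := (@halfline R).
Local Notation fock := (fock R).
Local Notation orth n := (@orthant R n).
Local Notation cnorm f n := (L2normsq (leb n) (orth n) (f n)).
Local Notation vac := (@vacuum R).
Local Notation scalg := (@scalg R).
Local Notation b2 := (@b2 R).
Let mea := @in_fock_measurable R.
Implicit Types (F G : fock) (U V W : b2).

Definition approximates F (A : nat -> scalg) :=
  (fun k => fock_normsq (fock_sub (vec (A k)) F)) @ \oo --> 0%E.

Lemma feqB_normsq F F' G G' :
  in_fock F -> in_fock F' -> in_fock G -> in_fock G' ->
  feq F F' -> feq G G' -> fock_normsq (F - G) = fock_normsq (F' - G').
Proof.
move=> hF hF' hG hG' FF GG.
apply: (feq_fock_normsq (mea (in_fockB hF hG)) (mea (in_fockB hF' hG'))).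
apply: (feqD (mea hF) (mea hF') (mea (in_fockN hG)) (mea (in_fockN hG')) FF).
rewrite -[- G]scaleN1r -[- G']scaleN1r.
exact: (feqZ (-1) (mea hG) (mea hG') GG).
Qed.

Lemma fock_normsq_vec_adj (A B : scalg) F : in_fock F ->
  is_adjoint (op A) (op B) ->
  fock_normsq (vec B - flip F) = fock_normsq (vec A - F).
Proof.
move=> hF AB; have hA := in_fock_vec A.
rewrite (feqB_normsq (in_fock_vec B) (in_fock_flip hA) (in_fock_flip hF)
  (in_fock_flip hF) (vec_adj AB) (feq_refl _)) -flipB.
exact: fock_normsq_flip (mea (in_fockB hA hF)).
Qed.

(** [flip F] is an admissible value, being approximated by the formal adjoints of the [A k]. Any
    admissible value is a limit of vectors that agree almost everywhere with the flips of vectors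
    tending to [F]; as [flip] preserves norms, it equals [flip F] up to a null set. *)
Lemma star_flip F A : in_fock F -> approximates F A ->
  in_fock (star F) /\ feq (star F) (flip F).
Proof.
move=> hF AF; have hfF := in_fock_flip hF.
set P := [set G | in_fock G /\ exists A B : nat -> scalg,
    [/\ forall k, is_adjoint (op (A k)) (op (B k)),
        (fun k => fock_normsq (fock_sub (vec (A k)) F)) @ \oo --> 0%E &
        (fun k => fock_normsq (fock_sub (vec (B k)) G)) @ \oo --> 0%E]].
have [hs [A' [B' [AB A'F B'F]]]] : P (star F).
  apply: (@xgetPex _ fock0 P); exists (flip F); split => //.
  exists A, (fun k => adj (A k)).
  split; [by move=> k; exact: op_adjoint|exact: AF|].
  have -> : (fun k => fock_normsq (fock_sub (vec (adj (A k))) (flip F))) =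
      (fun k => fock_normsq (fock_sub (vec (A k)) F)).
    apply/funext => k; exact: (fock_normsq_vec_adj hF (@op_adjoint R (A k))).
  exact: AF.
split => //; apply: (feq_lim (F := fun k => vec (B' k))) _ (mea hs) (mea hfF) B'F _.
  by move=> k; exact: mea (in_fock_vec _).
have -> : (fun k => fock_normsq (vec (B' k) - flip F)) =
    (fun k => fock_normsq (fock_sub (vec (A' k)) F)).
  by apply/funext => k; exact: (fock_normsq_vec_adj hF (AB k)).
exact: A'F.
Qed.

Definition bcomp W m n (p : RR * (m.-tuple RR * n.-tuple RR)) : R[i] :=
  W p.1 m n p.2.1 p.2.2.

Definition b2_measurable W := forall m n, cmeasurable (@insert_dom R m n) (bcomp W (n:=n)).

Local Notation rho m n := (sfprod lam (sfprod (leb m) (leb n))).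

(** Time and space are integrated together against one product measure, so each component of an
    element of B_2 becomes an ordinary square-integrable function; [b2_normsqE] recovers the norm of
    B_2. *)
Definition bnorm W m n : \bar R := L2normsq (rho m n) (@insert_dom R m n) (bcomp W (n:=n)).

Lemma bnorm_ge0 W m n : (0 <= bnorm W m n)%E.
Proof. exact: L2normsq_ge0. Qed.

Let mh := @measurable_halfline R.
Let md m n := @measurable_insert_dom R m n.
Let m2 m n := @measurable_fock2_dom R m n.

Lemma bnorm_tonelli W m n : b2_measurable W ->
  measurable_fun halfline (fun t => L2normsq (leb m \x leb n) (@fock2_dom R m n)
    (fun p => W t m n p.1 p.2))%E /\
  bnorm W m n = (\int[lam]_(t in halfline) L2normsq (leb m \x leb n)
    (@fock2_dom R m n) (fun p => W t m n p.1 p.2))%E.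
Proof.
move=> mW; have mf := measurable_cabs2 (mW m n).
have f0 t q : halfline t -> @fock2_dom R m n q ->
  (0 <= (cabs2 (bcomp W (n := n) (t, q)))%:E)%E by rewrite lee_fin cabs2_ge0.
split.
  exact: (measurable_tonelli_F (sfprod (leb m) (leb n)) mh (@m2 m n) mf f0).
exact: (tonelli1 lam (sfprod (leb m) (leb n)) mh (@m2 m n) mf f0).
Qed.

Lemma measurable_fock2_normsq W : b2_measurable W ->
  measurable_fun halfline (fun t => fock2_normsq (W t)).
Proof.
move=> mW; rewrite /fock2_normsq.
apply: ge0_emeasurable_sum => [m t _ _|m _].
  by apply: nneseries_ge0 => n _ _; exact: L2normsq_ge0.
apply: ge0_emeasurable_sum => [n t _ _|n _]; first exact: L2normsq_ge0.
exact: (bnorm_tonelli m n mW).1.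
Qed.

Lemma b2_normsqE W : b2_measurable W ->
  b2_normsq W = (\sum_(0 <= m <oo) \sum_(0 <= n <oo) bnorm W m n)%E.
Proof.
move=> mW; rewrite /b2_normsq /fock2_normsq integral_nneseries//; last 2 first.
- move=> m; apply: ge0_emeasurable_sum => [n t _ _|n _]; first exact: L2normsq_ge0.
  exact: (bnorm_tonelli m n mW).1.
- by move=> m t _; apply: nneseries_ge0 => n _ _; exact: L2normsq_ge0.
apply: eq_eseriesr => m _; rewrite integral_nneseries//; last 2 first.
- by move=> n; exact: (bnorm_tonelli m n mW).1.
- by move=> n t _; exact: L2normsq_ge0.
by apply: eq_eseriesr => n _; rewrite (bnorm_tonelli m n mW).2.
Qed.

Lemma bnorm_le W m n : b2_measurable W -> (bnorm W m n <= b2_normsq W)%E.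
Proof.
move=> mW; rewrite b2_normsqE// (@nneseriesD1 _ _ m xpredT)//; last first.
  by move=> k _; apply: nneseries_ge0 => *; exact: bnorm_ge0.
rewrite (@nneseriesD1 _ (fun n => bnorm W m n) n xpredT)//; last first.
  by move=> k _; exact: bnorm_ge0.
rewrite -addeA leeDl// adde_ge0//; apply: nneseries_ge0 => k _ _.
  exact: bnorm_ge0.
by apply: nneseries_ge0 => *; exact: bnorm_ge0.
Qed.

Definition b2_add U V : b2 := fun t m n s u => U t m n s u + V t m n s u.
Definition b2_scale (c : R[i]) U : b2 := fun t m n s u => c * U t m n s u.

Lemma b2_measurable_add U V :
  b2_measurable U -> b2_measurable V -> b2_measurable (b2_add U V).
Proof. by move=> mU mV m n; exact: cmeasurableD (mU m n) (mV m n). Qed.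

Lemma b2_measurable_sub U V :
  b2_measurable U -> b2_measurable V -> b2_measurable (b2_sub U V).
Proof. by move=> mU mV m n; exact: cmeasurableB (mU m n) (mV m n). Qed.

Lemma b2_measurable_scale c U : b2_measurable U -> b2_measurable (b2_scale c U).
Proof. by move=> mU m n; exact: cmeasurableZ (mU m n). Qed.

Definition beq U V := forall m n, bnorm (b2_sub U V) m n = 0.

Lemma beq_bnorm U V m n : b2_measurable U -> b2_measurable V -> beq U V ->
  bnorm U m n = bnorm V m n.
Proof.
by move=> mU mV UV; exact: (eq_L2normsq_ae (@md m n) (mU m n) (mV m n) (UV m n)).
Qed.

Lemma bnormD0 U V m n : b2_measurable U -> b2_measurable V ->
  bnorm U m n = 0 -> bnorm V m n = 0 -> bnorm (b2_add U V) m n = 0.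
Proof.
by move=> mU mV; exact: (L2normsqD0 (@md m n) (mU m n) (mV m n)).
Qed.

Lemma bnormZ c U m n : b2_measurable U ->
  bnorm (b2_scale c U) m n = ((cabs2 c)%:E * bnorm U m n)%E.
Proof. by move=> mU; exact: (L2normsqZ _ (@md m n) c (mU m n)). Qed.

Lemma b2P U V : (forall t m n s u, U t m n s u = V t m n s u) -> U = V.
Proof.
move=> UV; apply/funext => t; apply: functional_extensionality_dep => m.
apply: functional_extensionality_dep => n.
by apply/funext => s; apply/funext => u.
Qed.

Lemma beq_trans U V W : b2_measurable U -> b2_measurable V -> b2_measurable W ->
  beq U V -> beq V W -> beq U W.
Proof.
move=> mU mV mW UV VW m n.
rewrite (_ : b2_sub U W = b2_add (b2_sub U V) (b2_sub V W)).
  apply: (bnormD0 _ _ (UV m n) (VW m n)); exact: b2_measurable_sub.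
by apply: b2P => t k l s u; rewrite /b2_add /b2_sub subrKA.
Qed.

Lemma beq_lin c U U' V V' : b2_measurable U -> b2_measurable U' ->
  b2_measurable V -> b2_measurable V' -> beq U U' -> beq V V' ->
  beq (b2_add U (b2_scale c V)) (b2_add U' (b2_scale c V')).
Proof.
move=> mU mU' mV mV' UU VV m n.
rewrite (_ : b2_sub _ _ = b2_add (b2_sub U U') (b2_scale c (b2_sub V V'))).
  have mVV := b2_measurable_sub mV mV'.
  apply: bnormD0 (b2_measurable_sub mU mU') (b2_measurable_scale c mVV) (UU m n) _.
  by rewrite bnormZ// VV mule0.
by apply: b2P => t k l s u; rewrite /b2_scale /b2_sub /b2_add; ring.
Qed.

Lemma b2_subE U V : b2_sub U V = b2_add U (b2_scale (-1) V).
Proof. by apply: b2P => t k l s u; rewrite /b2_scale /b2_sub /b2_add mulN1r. Qed.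

(** The explicit gradient: the variable in position [m + 1] is read as time. *)
Definition bslice F : b2 := fun t m n s u => slice F n t u m s.

Lemma b2_measurable_slice F : fock_measurable F -> b2_measurable (bslice F).
Proof.
move=> mF m n; have [mr mi] := mF (m + n.+1)%N.
have im : [set insert p | p in @insert_dom R m n] `<=` orth (m + n.+1).
  by move=> _ [p hp <-]; apply/orthant_insert.
have mins := measurable_funTS (D := @insert_dom R m n) (@measurable_insert R m n).
split; first exact: (measurable_comp (@measurable_orthant R _) im mr mins).
exact: (measurable_comp (@measurable_orthant R _) im mi mins).
Qed.

Lemma bnorm_slice F m n : fock_measurable F ->
  bnorm (bslice F) m n = cnorm F (m + n.+1)%N.
Proof.
move=> mF; rewrite /L2normsq (integral_leb_insert (n := n))//.
- exact: measurable_cabs2 (mF _).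
- by move=> s _; rewrite lee_fin cabs2_ge0.
Qed.

Lemma beq_slice F G : fock_measurable F -> fock_measurable G -> feq F G ->
  beq (bslice F) (bslice G).
Proof.
move=> mF mG FG m n; rewrite -[b2_sub _ _]/(bslice (F - G)) bnorm_slice.
  by move/fock_normsq_eq0 : FG; exact.
exact: fock_measurableB.
Qed.

Definition tensor (h : @L2real R) F G : b2 := fun t m n s u =>
  (sval h t)%:C * (F m s * G n u).

Arguments tensor h F G : clear implicits.

Lemma b2_measurable_tensor h F G : fock_measurable F -> fock_measurable G ->
  b2_measurable (tensor h F G).
Proof.
move=> mF mG m n.
apply: cmeasurableM; last apply: cmeasurableM.
- have [mr mi] := L2real_cmeasurable h.
  have im : [set p.1 | p in @insert_dom R m n] `<=` halfline by move=> _ [p [hp _] <-].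
  have mp := measurable_funTS (D := @insert_dom R m n) (@measurable_fst _ _ RR (m.-tuple RR * n.-tuple RR)%type).
  by split; [exact: (measurable_comp mh im mr mp)|exact: (measurable_comp mh im mi mp)].
- have [mr mi] := mF m.
  have im : [set p.2.1 | p in @insert_dom R m n] `<=` orth m by move=> _ [p [_ [hp _]] <-].
  have mp : measurable_fun (@insert_dom R m n) (fun p => p.2.1).
    by apply: measurable_funTS; exact: (measurableT_comp measurable_fst measurable_snd).
  by split; [exact: (measurable_comp (@measurable_orthant R m) im mr mp)|
    exact: (measurable_comp (@measurable_orthant R m) im mi mp)].
- have [mr mi] := mG n.
  have im : [set p.2.2 | p in @insert_dom R m n] `<=` orth n by move=> _ [p [_ [_ hp]] <-].
  have mp : measurable_fun (@insert_dom R m n) (fun p => p.2.2).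
    by apply: measurable_funTS; exact: (measurableT_comp measurable_snd measurable_snd).
  by split; [exact: (measurable_comp (@measurable_orthant R n) im mr mp)|
    exact: (measurable_comp (@measurable_orthant R n) im mi mp)].
Qed.

(** At each time the squared norm factorizes over the two legs, so it vanishes as soon as one leg is
    null. *)
Lemma bnorm_tensor0 h F G m n : fock_measurable F -> fock_measurable G ->
  cnorm F m = 0 \/ cnorm G n = 0 -> bnorm (tensor h F G) m n = 0.
Proof.
move=> mF mG FG0; rewrite (bnorm_tonelli m n (b2_measurable_tensor h mF mG)).2.
have mfg : cmeasurable (@fock2_dom R m n) (fun p => F m p.1 * G n p.2).
  have [Fr Fi] := mF m; have [Gr Gi] := mG n.
  have i1 : [set p.1 | p in @fock2_dom R m n] `<=` orth m by move=> _ [p [hp _] <-].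
  have i2 : [set p.2 | p in @fock2_dom R m n] `<=` orth n by move=> _ [p [_ hp] <-].
  have m1' := measurable_funTS (D := @fock2_dom R m n) (@measurable_fst _ _ (m.-tuple RR) (n.-tuple RR)).
  have m2' := measurable_funTS (D := @fock2_dom R m n) (@measurable_snd _ _ (m.-tuple RR) (n.-tuple RR)).
  apply: cmeasurableM.
  - by split; [exact: (measurable_comp (@measurable_orthant R m) i1 Fr m1')|
      exact: (measurable_comp (@measurable_orthant R m) i1 Fi m1')].
  - by split; [exact: (measurable_comp (@measurable_orthant R n) i2 Gr m2')|
      exact: (measurable_comp (@measurable_orthant R n) i2 Gi m2')].
apply: integral0_eq => t _.
rewrite (L2normsqZ (leb m \x leb n)%E (@m2 m n) _ mfg).
suff -> : L2normsq (leb m \x leb n)%E (@fock2_dom R m n)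
    (fun p => F m p.1 * G n p.2) = (cnorm F m * cnorm G n)%E.
  by case: FG0 => ->; rewrite ?mul0e !mule0.
have mf := measurable_cabs2 mfg.
have f0 s u : orth m s -> orth n u -> (0 <= (cabs2 (F m s * G n u))%:E)%E.
  by rewrite lee_fin cabs2_ge0.
rewrite [LHS](tonelli1 (leb m) (leb n) (@measurable_orthant R m) (@measurable_orthant R n) mf f0).
rewrite /L2normsq -ge0_integralZr//; last 4 first.
- exact: measurable_orthant.
- exact: measurable_cabs2 (mF m).
- by move=> s _; rewrite lee_fin cabs2_ge0.
- exact: L2normsq_ge0.
apply: eq_integral => s _ /=.
transitivity (\int[leb n]_(u in orth n) ((cabs2 (F m s))%:E * (cabs2 (G n u))%:E))%E.
  by apply: eq_integral => u _; rewrite cabs2M EFinM.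
rewrite ge0_integralZl//.
- exact: measurable_orthant.
- exact: measurable_cabs2 (mG n).
- by move=> u _; rewrite lee_fin cabs2_ge0.
- by rewrite lee_fin cabs2_ge0.
Qed.

Lemma beq_tensor h F F' G G' : in_fock F -> in_fock F' -> in_fock G -> in_fock G' ->
  feq F F' -> feq G G' -> beq (tensor h F G) (tensor h F' G').
Proof.
move=> hF hF' hG hG' /fock_normsq_eq0 FF /fock_normsq_eq0 GG m n.
have mFF := mea (in_fockB hF hF'); have mGG := mea (in_fockB hG hG').
(* The difference of two products is split so that each term has one null factor. *)
rewrite (_ : b2_sub _ _ = b2_add (tensor h (F - F') G) (tensor h F' (G - G'))).
  apply: bnormD0.
  - exact: b2_measurable_tensor mFF (mea hG).
  - exact: b2_measurable_tensor (mea hF') mGG.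
  - by apply: bnorm_tensor0 mFF (mea hG) _; left.
  - by apply: bnorm_tensor0 (mea hF') mGG _; right.
apply: b2P => t k l s u; rewrite /b2_add /b2_sub /tensor.
rewrite -[(F - F') k s]/(F k s - F' k s) -[(G - G') l u]/(G l u - G' l u).
ring.
Qed.

Lemma b2_of_cons p T : b2_of (p :: T) = b2_add (tensor p.1.1 (vec p.1.2) (vec p.2)) (b2_of T).
Proof. by apply: b2P => t m n s u; rewrite /b2_of big_cons. Qed.

Lemma b2_measurable_of T : b2_measurable (b2_of T).
Proof.
elim: T => [|p T IH].
  rewrite (_ : b2_of _ = b2_scale 0 (bslice vac)).
    exact: b2_measurable_scale (b2_measurable_slice (mea in_fock_vacuum)).
  by apply: b2P => t m n s u; rewrite /b2_of big_nil /b2_scale mul0r.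
rewrite b2_of_cons; apply: b2_measurable_add IH.
exact: b2_measurable_tensor (mea (in_fock_vec _)) (mea (in_fock_vec _)).
Qed.

(** For [sem] the identity is pointwise, by [sem_grad]. The passage to [vec] replaces each leg of
    each tensor by an almost everywhere equal one. *)
Lemma beq_grad (A : scalg) : beq (b2_of (grad A)) (bslice (vec A)).
Proof.
have hs := @in_fock_sem_vacuum R.
apply: (beq_trans (V := bslice (sem A vac))).
- exact: b2_measurable_of.
- exact: b2_measurable_slice (mea (hs A)).
- exact: b2_measurable_slice (mea (in_fock_vec A)).
- rewrite (_ : bslice _ = fun t m n s u =>
      \sum_(p <- grad A) tensor p.1.1 (sem p.1.2 vac) (sem p.2 vac) t m n s u).
    elim: (grad A) => [|p T IH] m n.
      rewrite (_ : b2_sub _ _ = b2_scale 0 (bslice vac)).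
        by rewrite bnormZ ?cabs2_0 ?mul0e//; exact: b2_measurable_slice (mea in_fock_vacuum).
      by apply: b2P => t k l s u; rewrite /b2_sub /b2_of !big_nil subrr /b2_scale mul0r.
    rewrite b2_of_cons (_ : b2_sub _ _ = b2_add
      (b2_sub (tensor p.1.1 (vec p.1.2) (vec p.2)) (tensor p.1.1 (sem p.1.2 vac) (sem p.2 vac)))
      (b2_sub (b2_of T) (fun t m n s u =>
        \sum_(p <- T) tensor p.1.1 (sem p.1.2 vac) (sem p.2 vac) t m n s u))); last first.
      by apply: b2P => t k l s u; rewrite /b2_sub /b2_add big_cons; ring.
    apply: bnormD0 _ _ _ (IH m n).
    + apply: b2_measurable_sub; apply: b2_measurable_tensor; apply: mea => //;
      exact: in_fock_vec.
    + apply: b2_measurable_sub; first exact: b2_measurable_of.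
      move=> k l; apply: (cmeasurable_sum _ (F := fun p q =>
        tensor p.1.1 (sem p.1.2 vac) (sem p.2 vac) q.1 k l q.2.1 q.2.2)).
      by move=> q; exact: b2_measurable_tensor (mea (hs _)) (mea (hs _)) k l.
    + exact: beq_tensor (in_fock_vec _) (hs _) (in_fock_vec _) (hs _) (vec_sem _) (vec_sem _) m n.
  by apply: b2P => t m n s u; exact: sem_grad.
- apply: beq_slice (mea (hs A)) (mea (in_fock_vec A)) _.
  exact: feq_sym (vec_sem A).
Qed.

End star_nabla.

(** * Sums along diagonals and exponential integrals *)

Section series_and_exponential.
Context {R : realType}.
Local Open Scope ereal_scope.

Lemma squeeze0 (x : \bar R) (a b : nat -> \bar R) : 0 <= x ->
  (forall k, x <= 2%:E * a k + 2%:E * b k) ->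
  a @ \oo --> 0 -> b @ \oo --> 0 -> x = 0.
Proof.
move=> x0 xab a0 b0; apply/eqP; rewrite eq_le x0 andbT.
have h1 := cvgeZl (isT : (2%:E : \bar R) \is a fin_num) a0.
have h2 := cvgeZl (isT : (2%:E : \bar R) \is a fin_num) b0.
have : (fun k => 2%:E * a k + 2%:E * b k) @ \oo --> 2%:E * 0 + 2%:E * 0.
  by apply: (cvgeD _ h1 h2); rewrite !mule0.
rewrite !mule0 adde0 => lim0; apply: (cvge_ge _ lim0).
by near=> k; exact: xab.
Unshelve. all: by end_near. Qed.

Lemma nneseries_diag (b : nat -> \bar R) : (forall n, 0 <= b n) ->
  \sum_(0 <= m <oo) \sum_(0 <= n <oo) b (m + n)%N =
  \sum_(0 <= n <oo) n.+1%:R%:E * b n.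
Proof.
(* With [i = m + n] the inner sum runs over [i >= m]. Padding by zero gives a full double series,
   whose sums can be interchanged; then [n.+1] values of [m] contribute to each index. *)
move=> b0; pose f m i := if (m <= i)%N then b i else 0.
have f0 m i : 0 <= f m i by rewrite /f; case: ifP.
transitivity (\sum_(0 <= m <oo) \sum_(0 <= i <oo) f m i).
  apply: eq_eseriesr => m _.
  rewrite (nneseries_split (f := f m) 0 m)// add0n.
  rewrite [X in _ = X + _](_ : _ = 0) ?add0e; last first.
    rewrite big_nat_cond big1// => i /andP[/andP[_ im] _].
    by rewrite /f leqNgt im.
  rewrite -(nneseries_addn m)//; apply: eq_eseriesr => i _.
  by rewrite /f leq_addl addnC.
rewrite nneseries_interchange//; apply: eq_eseriesr => n _.
rewrite (nneseries_split (f := f ^~ n) 0 n.+1)// add0n.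
rewrite [X in _ + X](_ : _ = 0) ?adde0; last first.
  by apply: eseries0 => i ni _; rewrite /f leqNgt ni.
rewrite (eq_big_nat _ _ (F2 := fun=> b n)); last first.
  by move=> i /andP[_]; rewrite ltnS /f => ->.
rewrite big_const_nat subn0 -[RHS]/((n.+1%:R)%:E * b n) mule_natl.
elim: (n.+1) => [|k IH]; first by rewrite mule0n.
by rewrite iterS IH -[RHS]/(iterop _ _ _ _); case: k {IH} => [|k]; rewrite ?adde0.
Qed.

Lemma integral_halfline_expR (k : R) : (0 < k)%R ->
  \int[@lebesgue_measure R]_(t in @halfline R) (expR (- (k * t)))%:E = (k^-1)%:E.
Proof.
move=> k0; have mh := @measurable_halfline R.
have me : measurable_fun (@halfline R) (fun t => (expR (- (k * t)))%:E).
  apply/measurable_EFinP; apply: measurable_funTS.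
  apply: (measurableT_comp (@measurable_expR R)).
  apply: measurable_funN; exact: measurable_funM.
(* The exponential density of rate [k] has total mass 1. *)
have := integral_exponential_pdf k0; rewrite /exponential_pdf.
rewrite (_ : (fun x => _) = (fun t => k%:E * (expR (- (k * t)))%:E) \_ (@halfline R)).
  rewrite -integral_mkcond ge0_integralZl ?lee_fin ?ltW//.
  move=> kI; set I := \int[_]_(t in _) _ in kI *.
  have I0 : 0 <= I by apply: integral_ge0 => t _; rewrite lee_fin expR_ge0.
  (* An infinite [I] would make the total mass [k I] infinite. *)
  have If : I \is a fin_num.
    rewrite ge0_fin_numE// ltNge; apply/negP; rewrite leye_eq => /eqP Ioo.
    by move: kI; rewrite Ioo gt0_muley ?lte_fin.
  rewrite -(fineK If); congr EFin; apply: (mulfI (lt0r_neq0 k0)).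
  rewrite mulfV ?gt_eqF//; apply: EFin_inj.
  by rewrite EFinM fineK// kI.
apply/funext => t; rewrite !patchE.
have -> : (t \in [set` `[0%R, +oo[]) = (t \in @halfline R).
  by apply/idP/idP; rewrite !inE /= in_itv /= andbT.
by case: ifP => // _; rewrite -EFinM mulNr.
Qed.

End series_and_exponential.

(** Polarization with the coefficient [c] as a variable: one computation of the squared norm of
    [f + c g] for general [c] settles all four terms. *)
Definition polar4 {R : realType} (f : R[i] -> \bar R) : R[i] :=
  polar (f 1) (f (-1)) (f 'i) (f (- 'i)).

Section polar4.
Context {R : realType}.

Lemma eq_polar4 (f g : R[i] -> \bar R) : (forall c, f c = g c) -> polar4 f = polar4 g.
Proof. by move=> fg; rewrite /polar4 !fg. Qed.

Lemma polar4_scale (r : R) (f : R[i] -> \bar R) : 0 < r ->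
  (forall c, 0 <= f c)%E -> r%:C * polar4 f = polar4 (fun c => r%:E * f c)%E.
Proof.
move=> r0 f0.
have fineZ x : (0 <= x)%E -> fine (r%:E * x) = r * fine x :> R.
  by case: x => [x| |]//= _; rewrite gt0_muley ?lte_fin//= mulr0.
apply/eqP; rewrite eq_complex /= !mul0r subr0 addr0 !fineZ//.
by rewrite !mulrA ![_ * 4^-1]mulrC -!mulrA !mulrBr !eqxx.
Qed.

Lemma fock_dot_polar4 (f g : fock R) : in_fock f -> in_fock g ->
  fock_dot f g = polar4 (fun c => fock_normsq (f + c *: g)).
Proof.
move=> hf hg; rewrite (fock_dot_polar hf hg) /polar4.
by rewrite scale1r scaleN1r scaleNr.
Qed.

Lemma csum_to_polar4 (f : R[i] -> nat -> \bar R) :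
  (forall c n, 0 <= f c n)%E ->
  (forall c : R[i], c \in [:: 1; -1; 'i; - 'i] -> (\sum_(0 <= n <oo) f c n < +oo)%E) ->
  csum_to (fun n => polar4 (f ^~ n)) (polar4 (fun c => \sum_(0 <= n <oo) f c n)%E).
Proof. by move=> f0 foo; apply: csum_to_polar => //; apply: foo; rewrite !inE eqxx ?orbT. Qed.

Lemma cintegral_polar4 d (T : measurableType d) (mu : {measure set T -> \bar R})
    (D : set T) (u : T -> R[i]) (f : R[i] -> T -> \bar R) : measurable D ->
  (forall c, measurable_fun D (f c)) ->
  (forall c x, D x -> 0 <= f c x)%E ->
  (forall c, \int[mu]_(x in D) f c x < +oo)%E ->
  (forall x, D x -> (forall c : R[i], c \in [:: 1; -1; 'i; - 'i] -> (f c x < +oo)%E) ->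
    u x = polar4 (f ^~ x)) ->
  cintegral mu D u = polar4 (fun c => \int[mu]_(x in D) f c x)%E.
Proof.
move=> mD mf f0 foo uf; apply: cintegral_polar => //; try exact: f0.
move=> x Dx f1 f2 f3 f4; apply: uf => // c.
by rewrite !inE => /or4P[] /eqP ->.
Qed.

(** At a fixed time only the norms of the four combinations are known to be finite. The
    parallelogram law gives back the finiteness for [f] and [g] separately. *)
Lemma L2dot_polar4 d (T : measurableType d) (mu : {measure set T -> \bar R})
    (D : set T) (f g : T -> R[i]) : measurable D ->
  cmeasurable D f -> cmeasurable D g ->
  (forall c : R[i], c \in [:: 1; -1; 'i; - 'i] ->
    (L2normsq mu D (fun x => f x + c * g x)%R < +oo)%E) ->
  L2dot mu D f g = polar4 (fun c => L2normsq mu D (fun x => f x + c * g x)).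
Proof.
move=> mD mf mg fin.
have N1 : L2normsq mu D (fun x => f x + 1 * g x) = L2normsq mu D (fun x => f x + g x).
  by apply: eq_L2normsq => x _; rewrite mul1r.
have N2 c : L2normsq mu D (fun x => f x + (- c) * g x) =
    L2normsq mu D (fun x => f x - c * g x).
  by apply: eq_L2normsq => x _; rewrite mulNr.
have N3 : L2normsq mu D (fun x => f x - 1 * g x) = L2normsq mu D (fun x => f x - g x).
  by apply: eq_L2normsq => x _; rewrite mul1r.
have f1 : (L2normsq mu D (fun x => f x + g x)%R < +oo)%E.
  by rewrite -N1; apply: fin; rewrite !inE eqxx.
have f2 : (L2normsq mu D (fun x => f x - g x)%R < +oo)%E.
  by rewrite -N3 -N2; apply: fin; rewrite !inE eqxx orbT.
have bound h : (forall x, cabs2 (h x) <= cabs2 (f x + g x) + cabs2 (f x - g x)) ->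
    (L2normsq mu D h < +oo)%E.
  move=> hb; apply: (@le_lt_trans _ _ (L2normsq mu D (fun x => f x + g x)%R +
     L2normsq mu D (fun x => f x - g x)%R)%E); last exact: lte_add_pinfty.
  rewrite /L2normsq -ge0_integralD//.
  - apply: nonmeasurable_ge0_le_integral => x _; first by rewrite lee_fin cabs2_ge0.
    by rewrite -EFinD lee_fin.
  - by move=> x _; rewrite lee_fin cabs2_ge0.
  - exact: measurable_cabs2 (cmeasurableD mf mg).
  - by move=> x _; rewrite lee_fin cabs2_ge0.
  - exact: measurable_cabs2 (cmeasurableB mf mg).
rewrite (L2dot_polar mD mf mg).
- by rewrite /polar4 !N2 N3 N1.
- by apply: bound => x; rewrite cabs2_parallelogram; have := cabs2_ge0 (f x);
    have := cabs2_ge0 (g x); lra.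
- by apply: bound => x; rewrite cabs2_parallelogram; have := cabs2_ge0 (f x);
    have := cabs2_ge0 (g x); lra.
Qed.

End polar4.

(** * The closed gradient, and polarization in B_2 *)

Section gradient.
Context {R : realType}.
Local Notation RR := (measurableTypeR R).
Local Notation lam := (@lebesgue_measure R).
Local Notation halfline := (@halfline R).
Local Notation fock := (fock R).
Local Notation orth n := (@orthant R n).
Local Notation cnorm f n := (L2normsq (leb n) (orth n) (f n)).
Local Notation scalg := (@scalg R).
Local Notation b2 := (@b2 R).
Local Notation rho m n := (sfprod lam (sfprod (leb m) (leb n))).
Let mea := @in_fock_measurable R.
Let md m n := @measurable_insert_dom R m n.
Implicit Types (F G : fock) (U V W : b2).

Lemma bnorm_subC U V m n : bnorm (b2_sub U V) m n = bnorm (b2_sub V U) m n.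
Proof. by apply: eq_L2normsq => p _; rewrite /bcomp /b2_sub -cabs2N opprB. Qed.

Lemma bnorm_sub_congr U U' V V' m n :
  b2_measurable U -> b2_measurable U' -> b2_measurable V -> b2_measurable V' ->
  beq U U' -> beq V V' -> bnorm (b2_sub U V) m n = bnorm (b2_sub U' V') m n.
Proof.
move=> mU mU' mV mV' UU VV; rewrite !b2_subE; apply: beq_bnorm.
- exact: b2_measurable_add mU (b2_measurable_scale (-1) mV).
- exact: b2_measurable_add mU' (b2_measurable_scale (-1) mV').
- exact: beq_lin mU mU' mV mV' UU VV.
Qed.

Lemma beq_refl U : b2_measurable U -> beq U U.
Proof.
move=> mU m n; rewrite (_ : b2_sub U U = b2_scale 0 U).
  by rewrite bnormZ// cabs2_0 mul0e.
by apply: b2P => t k l s u; rewrite /b2_sub /b2_scale subrr mul0r.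
Qed.

Lemma bnorm_grad_sub (A : scalg) F m n : in_fock F ->
  bnorm (b2_sub (b2_of (grad A)) (bslice F)) m n = cnorm (vec A - F) (m + n.+1)%N.
Proof.
move=> hF; have mF := b2_measurable_slice (mea hF).
have mA := b2_measurable_slice (mea (in_fock_vec A)).
rewrite (bnorm_sub_congr m n (b2_measurable_of _) mA mF mF (beq_grad A) (beq_refl mF)).
by rewrite -[b2_sub _ _]/(bslice (vec A - F)) bnorm_slice//;
  exact: fock_measurableB (mea (in_fock_vec A)) (mea hF).
Qed.

(** Both [U] and the slice of [F] are limits, component by component, of the gradients of the same
    polynomials: the first by hypothesis, the second because slicing preserves component norms.
    Closability is contained in this. *)
Lemma nabla_graph_slice F U : nabla_graph F U -> beq U (bslice F).
Proof.
move=> [hF [mU Uoo] [A [AF AU]]] m n.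
have mF := b2_measurable_slice (mea hF).
apply: (@squeeze0 R _ (fun k => b2_normsq (b2_sub (b2_of (grad (A k))) U))
  (fun k => fock_normsq (fock_sub (vec (A k)) F))) AU AF; first exact: bnorm_ge0.
move=> k; have mA := b2_measurable_of (grad (A k)).
rewrite (_ : b2_sub U _ = b2_add (b2_sub U (b2_of (grad (A k))))
    (b2_sub (b2_of (grad (A k))) (bslice F))); last first.
  by apply: b2P => t k' l s u; rewrite /b2_add /b2_sub subrKA.
have m1 := b2_measurable_sub mU mA; have m2 := b2_measurable_sub mA mF.
apply: le_trans (L2normsqD_le (rho m n) (@md m n) (m1 m n) (m2 m n)) _.
apply: leeD; apply: lee_wpmul2l => //.
- by rewrite -/(bnorm _ _ _) bnorm_subC; exact: bnorm_le (b2_measurable_sub mA mU).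
- by rewrite -/(bnorm _ _ _) bnorm_grad_sub//; exact: cnorm_le_fock_normsq.
Qed.

Lemma b2_normsq_beq_slice U F : b2_measurable U -> in_fock F -> beq U (bslice F) ->
  b2_normsq U = (\sum_(0 <= m <oo) \sum_(0 <= n <oo) cnorm F (m + n.+1)%N)%E.
Proof.
move=> mU hF UF; rewrite b2_normsqE//; apply: eq_eseriesr => m _.
apply: eq_eseriesr => n _; rewrite (beq_bnorm m n mU (b2_measurable_slice (mea hF)) UF).
exact: bnorm_slice (mea hF).
Qed.

(** The formal adjoints of the polynomials approximating [G] approximate [star G]. Their errors, for
    the vectors and for the gradients, equal those for [G], because reversal preserves every
    component norm. *)
Lemma star_graph G U : nabla_graph G U ->
  [/\ in_fock (star G), feq (star G) (flip G) &
    nabla_graph (star G) (bslice (star G))].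
Proof.
move=> GU; have [hG [mU Uoo] [A [AG AU]]] := GU.
have [hs sG] := star_flip hG AG; split; [exact: hs|exact: sG|].
have hf := in_fock_flip hG; have mS := b2_measurable_slice (mea hs).
have UG := nabla_graph_slice GU.
have cs n : cnorm (star G) n = cnorm G n.
  by rewrite (feq_cnorm n (mea hs) (mea hf) sG) (cnorm_flip n (mea hG)).
have AS k : fock_normsq (vec (adj (A k)) - star G) = fock_normsq (vec (A k) - G).
  rewrite (feqB_normsq (in_fock_vec _) (in_fock_vec _) hs hf (feq_refl _) sG).
  exact: (fock_normsq_vec_adj hG (@op_adjoint R (A k))).
split; first exact: hs.
  split; first exact: mS.
  rewrite (b2_normsq_beq_slice mS hs (beq_refl mS)).
  under eq_eseriesr do under eq_eseriesr do rewrite cs.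
  by rewrite -(b2_normsq_beq_slice mU hG UG).
have E1 : (fun k => fock_normsq (fock_sub (vec (adj (A k))) (star G))) =
    (fun k => fock_normsq (fock_sub (vec (A k)) G)).
  by apply/funext => k; exact: AS.
have E2 : (fun k => b2_normsq (b2_sub (b2_of (grad (adj (A k)))) (bslice (star G)))) =
    (fun k => b2_normsq (b2_sub (b2_of (grad (A k))) U)).
  apply/funext => k; have mA B := @b2_measurable_of R (grad B).
  rewrite (b2_normsqE (b2_measurable_sub (mA _) mS)) (b2_normsqE (b2_measurable_sub (mA _) mU)).
  apply: eq_eseriesr => m _; apply: eq_eseriesr => n _.
  have mG := b2_measurable_slice (mea hG).
  rewrite (bnorm_grad_sub _ m n hs).
  rewrite (bnorm_sub_congr m n (mA (A k)) (mA (A k)) mU mG (beq_refl (mA _)) UG).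
  rewrite (bnorm_grad_sub _ m n hG).
  have hA := in_fock_vec (A k); have hA' := in_fock_vec (adj (A k)).
  have e : feq (vec (adj (A k)) - star G) (flip (vec (A k) - G)).
    rewrite flipB; apply: feqD (mea hA') (mea (in_fock_flip hA)) (mea (in_fockN hs))
      (mea (in_fockN hf)) (vec_adj (@op_adjoint R (A k))) _.
    rewrite -[- star G]scaleN1r -[- flip G]scaleN1r.
    exact: (feqZ (-1) (mea hs) (mea hf) sG).
  rewrite (feq_cnorm _ (mea (in_fockB hA' hs)) (mea (in_fock_flip (in_fockB hA hG))) e).
  exact: cnorm_flip (mea (in_fockB hA hG)).
by exists (fun k => adj (A k)); rewrite E1 E2; split; [exact: AG|exact: AU].
Qed.

Lemma nablaP F : D12 F -> nabla_graph F (nabla F).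
Proof. by move=> hF; exact: (@xgetPex _ b2_0 [set U | nabla_graph F U]). Qed.

Lemma b2_normsq_le (x y : R) U V W : 0 <= x -> 0 <= y ->
  b2_measurable U -> b2_measurable V -> b2_measurable W ->
  (forall m n, bnorm W m n <= x%:E * bnorm U m n + y%:E * bnorm V m n)%E ->
  (b2_normsq W <= x%:E * b2_normsq U + y%:E * b2_normsq V)%E.
Proof.
move=> x0 y0 mU mV mW UVW; rewrite (b2_normsqE mU) (b2_normsqE mV) (b2_normsqE mW).
have s0 (Z : b2) m : (0 <= \sum_(0 <= n <oo) bnorm Z m n)%E.
  by apply: nneseries_ge0 => *; exact: bnorm_ge0.
rewrite -!nneseriesZl// -nneseriesD; [|by move=> *; rewrite mule_ge0..].
apply: lee_nneseries => [m _ _|m _]; first exact: s0.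
rewrite -!nneseriesZl; [|by move=> *; exact: bnorm_ge0..].
rewrite -nneseriesD; [|by move=> *; rewrite mule_ge0// bnorm_ge0..].
by apply: lee_nneseries => [n _ _|n _]; [exact: bnorm_ge0|exact: UVW].
Qed.

Lemma in_b2_add_scale c U V : in_b2 U -> in_b2 V -> in_b2 (b2_add U (b2_scale c V)).
Proof.
move=> [mU Uoo] [mV Voo].
have mcV : b2_measurable (b2_scale c V) by exact: b2_measurable_scale.
have mW : b2_measurable (b2_add U (b2_scale c V)) by exact: b2_measurable_add.
have c0 : 0 <= 2 * cabs2 c by rewrite mulr_ge0// cabs2_ge0.
split; first exact: mW.
apply: (le_lt_trans (b2_normsq_le (x := 2) (y := 2 * cabs2 c) _ c0 mU mV mW _)) => //.
  move=> m n; apply: le_trans (L2normsqD_le (rho m n) (@md m n) (mU m n) (mcV m n)) _.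
  apply: leeD => //; rewrite EFinM -muleA.
  by rewrite -(bnormZ c m n mV).
apply: lte_add_pinfty.
  by apply: (@lte_mul_pinfty _ 2%:E _ _ _ Uoo).
by apply: (@lte_mul_pinfty _ (2 * cabs2 c)%:E _ _ _ Voo); rewrite ?lee_fin.
Qed.

(** [fock2_dot] nests two values of [csum]. Finiteness of the double sum of norms makes every inner
    series converge, so polarization passes first through the inner sum and then through the outer
    one. *)
Lemma fock2_dot_polar4 (k l : fock2) :
  (forall m n, cmeasurable (@fock2_dom R m n) (fun p => k m n p.1 p.2)) ->
  (forall m n, cmeasurable (@fock2_dom R m n) (fun p => l m n p.1 p.2)) ->
  (forall c : R[i], c \in [:: 1; -1; 'i; - 'i] ->
    (fock2_normsq (fun m n s u => k m n s u + c * l m n s u)%R < +oo)%E) ->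
  fock2_dot k l = polar4 (fun c => fock2_normsq (fun m n s u => k m n s u + c * l m n s u)).
Proof.
move=> mk ml fin; have m2 m n := @measurable_fock2_dom R m n.
pose N c m n := L2normsq (leb m \x leb n)%E (@fock2_dom R m n)
  (fun p => k m n p.1 p.2 + c * l m n p.1 p.2).
have N0 c m n : (0 <= N c m n)%E by exact: L2normsq_ge0.
have S0 c m : (0 <= \sum_(0 <= n <oo) N c m n)%E by exact: nneseries_ge0.
have Sle c m : (\sum_(0 <= n <oo) N c m n <=
    fock2_normsq (fun m n s u => k m n s u + c * l m n s u)%R)%E.
  rewrite /fock2_normsq (@nneseriesD1 _ (fun m => \sum_(0 <= n <oo) N c m n)%E m xpredT)//.
  by rewrite leeDl//; apply: nneseries_ge0 => *; exact: S0.
have Nle c m n : (N c m n <= \sum_(0 <= n <oo) N c m n)%E.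
  by rewrite (@nneseriesD1 _ (N c m) n xpredT)// leeDl//; exact: nneseries_ge0.
apply: csum_toE.
apply: (eq_ind_r (fun u => csum_to u _) (csum_to_polar4 (f := fun c m =>
  (\sum_(0 <= n <oo) N c m n)%E) S0 fin)).
apply/funext => m; apply: csum_toE.
have finm c : c \in [:: 1; -1; 'i; - 'i] -> (\sum_(0 <= n <oo) N c m n < +oo)%E.
  by move=> /fin; exact: le_lt_trans.
apply: (eq_ind_r (fun u => csum_to u _) (csum_to_polar4 (f := fun c n => N c m n)
  (fun c n => N0 c m n) finm)).
apply/funext => n; apply: (L2dot_polar4 (m2 m n) (mk m n) (ml m n)) => c /finm.
exact: le_lt_trans (Nle c m n).
Qed.

Lemma cmeasurable_b2_section W t m n : b2_measurable W -> halfline t ->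
  cmeasurable (@fock2_dom R m n) (fun p => W t m n p.1 p.2).
Proof.
move=> mW ht; have [mr mi] := mW m n.
have im : [set (t, p) | p in @fock2_dom R m n] `<=` @insert_dom R m n.
  by move=> _ [p hp <-].
have mp := measurable_funTS (D := @fock2_dom R m n)
  (@measurable_pair1 _ _ RR (m.-tuple RR * n.-tuple RR)%type t).
by split; [exact: (measurable_comp (@md m n) im mr mp)|
  exact: (measurable_comp (@md m n) im mi mp)].
Qed.

Lemma b2_dot_polar4 U V : in_b2 U -> in_b2 V ->
  b2_dot U V = polar4 (fun c => b2_normsq (b2_add U (b2_scale c V))).
Proof.
move=> hU hV; have [mU _] := hU; have [mV _] := hV.
have hc c := in_b2_add_scale c hU hV.
apply: (cintegral_polar4 (f := fun c t => fock2_normsq (b2_add U (b2_scale c V) t))).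
- exact: measurable_halfline.
- by move=> c; apply: measurable_fock2_normsq; case: (hc c).
- move=> c t _; apply: nneseries_ge0 => m _ _; apply: nneseries_ge0 => n _ _.
  exact: L2normsq_ge0.
- by move=> c; case: (hc c).
- move=> t ht fin; apply: fock2_dot_polar4 => //.
  + by move=> m n; exact: cmeasurable_b2_section.
  + by move=> m n; exact: cmeasurable_b2_section.
Qed.

End gradient.

(** * The covariance identity *)

Section covariance.
Context {R : realType}.
Local Notation RR := (measurableTypeR R).
Local Notation lam := (@lebesgue_measure R).
Local Notation halfline := (@halfline R).
Local Notation fock := (fock R).
Local Notation orth n := (@orthant R n).
Local Notation cnorm f n := (L2normsq (leb n) (orth n) (f n)).
Local Notation vac := (@vacuum R).
Local Notation b2 := (@b2 R).
Local Notation rho m n := (sfprod lam (sfprod (leb m) (leb n))).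
Let mea := @in_fock_measurable R.
Let md m n := @measurable_insert_dom R m n.
Let mh := @measurable_halfline R.
Implicit Types (F G H : fock) (U V W : b2) (t : R).

Definition ou t U : b2 := fun r => OU2 t (U r).

Lemma expR_half m t :
  (expR (- (m%:R * t)))%:C = (expR (- (m%:R * (t / 2))))%:C * (expR (- (m%:R * (t / 2))))%:C :> R[i].
Proof.
rewrite -rmorphM -expRD; congr (expR _)%:C.
by rewrite -opprD -mulrDr -splitr.
Qed.

(** The weights are real, so half of each exponent can be carried by the second vector. Both
    arguments are then transformed alike and [ou_lin] gathers them under one operator. *)
Lemma b2_dot_ou t U V : b2_dot (ou t U) V = b2_dot (ou (t / 2) U) (ou (t / 2) V).
Proof.
apply: eq_cintegral => r _; congr csum; apply/funext => m; congr csum.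
apply/funext => n; apply: eq_cintegral => p _.
rewrite /ou /OU2 /OU !cJM !cJreal (expR_half m) (expR_half n).
ring.
Qed.

Lemma ou_lin c t U V : b2_add (ou t U) (b2_scale c (ou t V)) =
  ou t (b2_add U (b2_scale c V)).
Proof.
apply: b2P => r m n s u; rewrite /b2_add /b2_scale /ou /OU2 /OU.
ring.
Qed.

Lemma b2_measurable_ou t U : b2_measurable U -> b2_measurable (ou t U).
Proof. by move=> mU m n; exact: cmeasurableZ (cmeasurableZ _ (mU m n)). Qed.

Lemma bnorm_ou t U m n : b2_measurable U -> bnorm (ou t U) m n =
  (((expR (- (m%:R * t)) * expR (- (n%:R * t))) ^+ 2)%:E * bnorm U m n)%E.
Proof.
move=> mU; pose c := expR (- (m%:R * t)) * expR (- (n%:R * t)).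
rewrite -(cabs2_real c) -(bnormZ c%:C m n mU); apply: eq_L2normsq => p _.
by rewrite /bcomp /ou /OU2 /OU /b2_scale /c rmorphM mulrA.
Qed.

Lemma in_b2_ou t U : 0 <= t -> in_b2 U -> in_b2 (ou t U).
Proof.
move=> t0 [mU Uoo]; have mO := b2_measurable_ou t mU; split; first exact: mO.
apply: le_lt_trans Uoo; rewrite (b2_normsqE mO) (b2_normsqE mU).
have e1 k : 0 <= expR (- (k%:R * t)) <= 1.
  by rewrite expR_ge0 /= -expR0 ler_expR oppr_le0 mulr_ge0.
apply: lee_nneseries => [m _ _|m _].
  by apply: nneseries_ge0 => *; exact: bnorm_ge0.
apply: lee_nneseries => [n _ _|n _]; first exact: bnorm_ge0.
rewrite bnorm_ou// -[leRHS]mul1e; apply: lee_wpmul2r; first exact: bnorm_ge0.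
have /andP[a0 a1] := e1 m; have /andP[b0 b1] := e1 n.
by rewrite lee_fin exprn_ile1// ?mulr_ge0// mulr_ile1.
Qed.

(** The squared norm of [F - tau(F)]: the vacuum component is left out. *)
Definition reduced_normsq F : \bar R := (\sum_(0 <= n <oo) cnorm F n.+1)%E.

(** [exp (- t)] times the squared norm in B_2 of P_(t/2) (x) P_(t/2) applied to the slices of [F];
    the prefactor raises the exponent from m + n to m + n + 1. *)
Definition ou_normsq F t : \bar R := (\sum_(0 <= m <oo) \sum_(0 <= n <oo)
  (expR (- ((m + n).+1%:R * t)))%:E * cnorm F (m + n).+1)%E.

Let term_ge0 F t m n :
  (0 <= (expR (- ((m + n).+1%:R * t)))%:E * cnorm F (m + n).+1)%E.
Proof. by rewrite mule_ge0 ?lee_fin ?expR_ge0// L2normsq_ge0. Qed.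

Lemma ou_normsq_ge0 F t : (0 <= ou_normsq F t)%E.
Proof. by apply: nneseries_ge0 => m _ _; exact: nneseries_ge0. Qed.

Let measurable_term F m n : measurable_fun halfline (fun t =>
  (expR (- ((m + n).+1%:R * t)))%:E * cnorm F (m + n).+1)%E.
Proof.
apply: emeasurable_funM; last exact: measurable_cst.
apply/measurable_EFinP; apply: measurable_funTS.
apply: (measurableT_comp (@measurable_expR R)).
by apply: measurable_funN; exact: measurable_funM.
Qed.

Lemma measurable_ou_normsq F : measurable_fun halfline (ou_normsq F).
Proof.
apply: ge0_emeasurable_sum => [m t _ _|m _]; first exact: nneseries_ge0.
by apply: ge0_emeasurable_sum => [n t _ _|n _]; [exact: term_ge0|exact: measurable_term].
Qed.

Lemma integral_ou_normsq F :
  (\int[lam]_(t in halfline) ou_normsq F t = reduced_normsq F)%E.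
Proof.
have mS m : measurable_fun halfline (fun t => \sum_(0 <= n <oo)
    (expR (- ((m + n).+1%:R * t)))%:E * cnorm F (m + n).+1)%E.
  by apply: ge0_emeasurable_sum => [n t _ _|n _]; [exact: term_ge0|exact: measurable_term].
rewrite (integral_nneseries lam mh mS); last by move=> m t _; exact: nneseries_ge0.
pose b n := ((n.+1%:R^-1)%:E * cnorm F n.+1)%E.
transitivity (\sum_(0 <= m <oo) \sum_(0 <= n <oo) b (m + n)%N)%E.
  apply: eq_eseriesr => m _; rewrite integral_nneseries//.
  apply: eq_eseriesr => n _.
  have me : measurable_fun halfline (fun t => (expR (- ((m + n).+1%:R * t)))%:E).
    apply/measurable_EFinP; apply: measurable_funTS.
    apply: (measurableT_comp (@measurable_expR R)).
    by apply: measurable_funN; exact: measurable_funM.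
  have e0 t : halfline t -> (0 <= (expR (- ((m + n).+1%:R * t)))%:E)%E.
    by move=> _; rewrite lee_fin expR_ge0.
  rewrite (ge0_integralZr lam mh me e0); last exact: L2normsq_ge0.
  by rewrite integral_halfline_expR.
rewrite nneseries_diag.
  apply: eq_eseriesr => n _; rewrite /b muleA -EFinM mulfV ?mul1e//.
by move=> n; rewrite mule_ge0 ?lee_fin ?invr_ge0// L2normsq_ge0.
Qed.

Lemma fock_normsq_reduced F : (fock_normsq F = cnorm F 0%N + reduced_normsq F)%E.
Proof.
rewrite /fock_normsq nneseries_recl//; last by move=> *; exact: L2normsq_ge0.
rewrite -(nneseries_addn 1); last by move=> *; exact: L2normsq_ge0.
by congr (_ + _)%E; apply: eq_eseriesr => n _; rewrite addn1.
Qed.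

Lemma reduced_normsq_lty F : in_fock F -> (reduced_normsq F < +oo)%E.
Proof.
move=> [_]; apply: le_lt_trans; rewrite fock_normsq_reduced leeDr//.
exact: L2normsq_ge0.
Qed.

Lemma ou_pairing F H U V t : in_fock F -> in_fock H -> in_b2 U -> in_b2 V ->
  beq U (bslice F) -> beq V (bslice H) -> 0 <= t ->
  (expR (- t))%:C * b2_dot (ou t U) V = polar4 (fun c => ou_normsq (F + c *: H) t).
Proof.
move=> hF hH hU hV UF VH t0; have t20 : 0 <= t / 2 by rewrite divr_ge0.
rewrite b2_dot_ou (b2_dot_polar4 (in_b2_ou t20 hU) (in_b2_ou t20 hV)).
rewrite polar4_scale ?expR_gt0//; last first.
  move=> c; apply: integral_ge0 => r _; apply: nneseries_ge0 => m _ _.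
  by apply: nneseries_ge0 => n _ _; exact: L2normsq_ge0.
apply: eq_polar4 => c; rewrite ou_lin.
have [mU _] := hU; have [mV _] := hV.
have mF := b2_measurable_slice (mea hF); have mH := b2_measurable_slice (mea hH).
have hFH : in_fock (F + c *: H) by exact: in_fockD hF (in_fockZ c hH).
have mW : b2_measurable (b2_add U (b2_scale c V)).
  exact: b2_measurable_add mU (b2_measurable_scale c mV).
have WF : beq (b2_add U (b2_scale c V)) (bslice (F + c *: H)).
  exact: (beq_lin c mU mF mV mH UF VH).
have mFH := b2_measurable_slice (mea hFH).
rewrite (b2_normsqE (b2_measurable_ou (t / 2) mW)) -nneseriesZl; last first.
  by move=> m _; apply: nneseries_ge0 => *; exact: bnorm_ge0.
apply: eq_eseriesr => m _; rewrite -nneseriesZl; last by move=> n _; exact: bnorm_ge0.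
apply: eq_eseriesr => n _; rewrite bnorm_ou// (beq_bnorm m n mW mFH WF).
rewrite (bnorm_slice m n (mea hFH)) muleA -EFinM addnS; congr (_%:E * _)%E.
(* The square undoes the halving of [t], and the factor [exp (- t)] accounts for the variable
   singled out as time. *)
rewrite -expRD expr2 -!expRD; congr expR.
by rewrite -[(m + n).+1]addn1 !natrD; field.
Qed.

Lemma integral_ou_pairing F H U V :
  in_fock F -> in_fock H -> in_b2 U -> in_b2 V ->
  beq U (bslice F) -> beq V (bslice H) ->
  cintegral lam halfline (fun t => (expR (- t))%:C * b2_dot (ou t U) V) =
  polar4 (fun c => reduced_normsq (F + c *: H)).
Proof.
move=> hF hH hU hV UF VH.
have hFH c : in_fock (F + c *: H) by exact: in_fockD hF (in_fockZ c hH).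
transitivity (polar4 (fun c =>
    \int[lam]_(t in halfline) ou_normsq (F + c *: H)%R t)%E); last first.
  by apply: eq_polar4 => c; exact: integral_ou_normsq.
have m c : measurable_fun halfline (ou_normsq (F + c *: H)) by exact: measurable_ou_normsq.
have n0 c t : halfline t -> (0 <= ou_normsq (F + c *: H)%R t)%E.
  by move=> _; exact: ou_normsq_ge0.
have fin c : (\int[lam]_(t in halfline) ou_normsq (F + c *: H)%R t < +oo)%E.
  by rewrite integral_ou_normsq; exact: reduced_normsq_lty (hFH c).
have e t : halfline t -> (forall c : R[i], c \in [:: 1; -1; 'i; - 'i] ->
    (ou_normsq (F + c *: H)%R t < +oo)%E) ->
    (expR (- t))%:C * b2_dot (ou t U) V = polar4 (fun c => ou_normsq (F + c *: H) t).
  by move=> t0 _; exact: ou_pairing.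
exact: (cintegral_polar4 mh m n0 fin e).
Qed.

(** The measure in degree 0 is a Dirac mass, so the value at the empty tuple is well defined on
    classes; the vacuum kills all other degrees. *)
Lemma tauE F : tau F = F 0%N [tuple].
Proof.
pose u n := L2dot (leb n) (orth n) (F n) (@vacuum R n).
have u0 : u 0%N = F 0%N [tuple].
  have v1 : (@vacuum R 0%N [tuple])^* = 1 by exact: rmorph1.
  rewrite /u /L2dot /cintegral /Rintegral !integral_leb0 v1 mulr1 /=.
  by case: (F 0%N [tuple]).
have uS n : u n.+1 = 0.
  rewrite /u /L2dot (eq_cintegral _ (v := fun=> 0)).
    by rewrite /cintegral /Rintegral /= integral0.
  by move=> s _; rewrite /vacuum /= rmorph0 mulr0.
apply: csum_toE; rewrite -u0.
split; rewrite -(@cvg_shiftS _ (fun n => \sum_(0 <= i < n) _)).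
- rewrite (_ : (fun n => _) = fun=> complex.Re (u 0%N)); first exact: cvg_cst.
  apply/funext => n; rewrite big_nat_recl// big1_seq ?addr0// => i _.
  by rewrite -/(u i.+1) uS.
- rewrite (_ : (fun n => _) = fun=> complex.Im (u 0%N)); first exact: cvg_cst.
  apply/funext => n; rewrite big_nat_recl// big1_seq ?addr0// => i _.
  by rewrite -/(u i.+1) uS.
Qed.

(** [flip] is antilinear and preserves norms. It replaces [c] by its conjugate, which exchanges the
    ['i] and [- 'i] terms, and this is the conjugation of the polarized value. *)
Lemma fock_dot_flip F G : in_fock F -> in_fock G ->
  fock_dot (flip F) (flip G) = fock_dot G F.
Proof.
move=> hF hG; rewrite (fock_dotC hF hG).
rewrite (fock_dot_polar4 (in_fock_flip hF) (in_fock_flip hG)) (fock_dot_polar4 hF hG).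
rewrite /polar4 polar_conj.
have key c : fock_normsq (flip F + c *: flip G) = fock_normsq (F + c^* *: G).
  rewrite -(fock_normsq_flip (mea (in_fockD hF (in_fockZ c^* hG)))).
  by rewrite flipD flipZ cJK.
have c1 : (1 : R[i])^* = 1 by exact: rmorph1.
have cN1 : (-1 : R[i])^* = -1 by exact: rmorphN1.
have ci : ('i : R[i])^* = - 'i.
  by apply/eqP; rewrite eq_complex cReJ cImJ /= oppr0 !eqxx.
have cNi : (- 'i : R[i])^* = 'i by rewrite -ci cJK.
by rewrite (key 1) (key (-1)) (key 'i) (key (- 'i)) c1 cN1 ci cNi.
Qed.

Definition centered F : fock := fock_sub F (fock_scale (tau F) vac).

Arguments centered F : clear implicits.

Lemma in_fock_centered F : in_fock F -> in_fock (centered F).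
Proof. by move=> hF; exact: in_fockB hF (in_fockZ _ in_fock_vacuum). Qed.

Lemma approximates_centered F A : approximates F A ->
  approximates (centered F) (fun k => SCadd (A k) (SCscale (- tau F) SCone)).
Proof.
move=> AF; rewrite /approximates (_ : (fun k => _) = fun k => fock_normsq (fock_sub (vec (A k)) F)).
  exact: AF.
apply/funext => k; congr fock_normsq; apply: fockP => n s.
rewrite /fock_sub /centered /vec /= /fock_add /fock_scale /fock_sub.
ring.
Qed.

(** Centering empties degree 0 and leaves the other degrees untouched. *)
Lemma centered_flip_normsq c F G : in_fock F -> in_fock G ->
  fock_normsq (centered F + c *: flip (centered G)) =
  reduced_normsq (F + c *: flip G).
Proof.
move=> hF hG; rewrite fock_normsq_reduced [X in (X + _)%E](_ : _ = 0) ?add0e.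
  apply: eq_eseriesr => n _; apply: eq_L2normsq => s _; congr cabs2.
  have e K (s' : n.+1.-tuple RR) : centered K n.+1 s' = K n.+1 s'.
    by rewrite /centered /fock_sub /fock_scale /vacuum /= mulr0 subr0.
  by rewrite -[LHS]/(centered F n.+1 s + c * (centered G n.+1 _)^*) !e.
have e K (s : 0.-tuple RR) : centered K 0%N s = 0.
  rewrite (tuple0 s) -[LHS]/(K 0%N [tuple] - tau K * 1) tauE.
  by rewrite mulr1 subrr.
rewrite /L2normsq integral_leb0.
have -> : (centered F + c *: flip (centered G)) 0%N [tuple] = 0.
  rewrite -[LHS]/(centered F 0%N [tuple] + c * (centered G 0%N _)^*) !e.
  by rewrite rmorph0 mulr0 addr0.
by rewrite cabs2_0.
Qed.

Lemma cov_polar4 F G A : in_fock F -> in_fock G -> in_fock (star G) ->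
  feq (star G) (flip G) -> approximates F A ->
  cov F G = polar4 (fun c => reduced_normsq (F + c *: star G)).
Proof.
move=> hF hG hsG sG AF.
have hcF := in_fock_centered hF; have hcG := in_fock_centered hG.
have [hs sF] := star_flip hcF (approximates_centered AF).
rewrite [LHS](feq_fock_dotr hs (in_fock_flip hcF) hcG sF).
(* Writing the centered [G] as a double flip lets antiunitarity turn its pairing with
   [flip (centered F)] into the pairing of [centered F] with [flip (centered G)], which is linear in
   [F]. *)
rewrite -[centered G]flipK (fock_dot_flip (in_fock_flip hcG) hcF).
rewrite (fock_dot_polar4 hcF (in_fock_flip hcG)); apply: eq_polar4 => c.
rewrite (centered_flip_normsq c hF hG); apply: eq_eseriesr => n _.
have hfG := in_fock_flip hG.
apply: feq_cnorm (mea (in_fockD hF (in_fockZ c hfG))) (mea (in_fockD hF (in_fockZ c hsG))) _.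
apply: feqD (mea hF) (mea hF) (mea (in_fockZ c hfG)) (mea (in_fockZ c hsG)) (feq_refl F) _.
exact: feqZ (mea hfG) (mea hsG) (feq_sym sG).
Qed.

End covariance.

Theorem lemma9 (R : realType) (F G : fock R) (hF : D12 F) (hG : D12 G) :
  cov F G =
  cintegral (@lebesgue_measure R) halfline
    (fun t => (expR (- t))%:C *
       b2_dot (fun r => OU2 t (nabla F r)) (nabla (star G))).
Proof.
have gF := nablaP hF; have gG := nablaP hG.
have [hsG sG gs] := star_graph gG.
(* [nabla (star G)] is meaningful only once [star G] is known to lie in the domain; [star_graph]
   supplies a gradient for it. *)
have gS : nabla_graph (star G) (nabla (star G)) by apply: nablaP; eexists; exact: gs.
have [iF bF [A [AF _]]] := gF; have [iG _ _] := gG; have [_ bS _] := gS.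
rewrite (cov_polar4 iF iG hsG sG AF).
exact: (esym (integral_ou_pairing iF hsG bF bS (nabla_graph_slice gF)
  (nabla_graph_slice gS))).
Qed.
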